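(* Let $f_0\in A^1(\mathbb{T})$ satisfy $$\|f_0\|_{\dot A^1}<\frac12 .$$ Then the Cauchy problem $$\partial_t f+\Lambda f=\Lambda(f\,\Lambda f)+\partial_x(f\,\partial_x f),\qquad f|_{t=0}=f_0,$$ is globally well-posed, in the sense that it admits a unique global solution $$f\in L^\infty(\mathbb{R}_+;A^1(\mathbb{T}))\cap\mathcal{M}(\mathbb{R}_+;A^2(\mathbb{T})),$$ and this solution satisfies, for $t\ge 0$, $$\|f(t)\|_{A^1}\le\|f_0\|_{A^1}\qquad\text{and}\qquad \|f(t)\|_{A^0}\le\|f_0\|_{A^0}\,e^{-(1-2\|f_0\|_{A^1})t}.$$
   Context: $\mathbb{T}=\mathbb{R}/2\pi\mathbb{Z}$. For a function $u$ on $\mathbb{T}$ the Fourier coefficients are $\hat u(n)=\frac{1}{\sqrt{2\pi}}\int_{\mathbb{T}}u(x)e^{-inx}\,dx$, so that $u(x)=\frac{1}{\sqrt{2\pi}}\sum_{n\in\mathbb{Z}}\hat u(n)e^{inx}$. The operator $\Lambda$ is the Fourier multiplier $\widehat{\Lambda u}(n)=|n|\hat u(n)$. All functions are real-valued and have zero average (the equation conserves the average). For $\alpha\ge0$ the Wiener space $A^\alpha(\mathbb{T})=\dot A^\alpha(\mathbb{T})$ consists of the zero-average functions $u$ with $$\|u\|_{A^\alpha}=\|u\|_{\dot A^\alpha}=\sum_{k\in\mathbb{Z}}|k|^\alpha|\hat u(k)|<\infty .$$ $\mathcal{M}(\mathbb{R}_+;X)$ denotes the space of measures on $\mathbb{R}_+=[0,\infty)$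 with values in the Banach space $X$. A solution is understood in the sense of distributions (equivalently, through the Duhamel formula $f(t)=e^{-t\Lambda}f_0+\int_0^t e^{-(t-s)\Lambda}[\Lambda(f\Lambda f)+\partial_x(f\partial_x f)](s)\,ds$). *)

(* Defs.v *)
From HB Require Import structures.
From mathcomp Require Import all_boot all_order all_algebra.
From mathcomp Require Import all_classical all_reals all_analysis.
From mathcomp Require Import complex.

Set Implicit Arguments.
Unset Strict Implicit.
Unset Printing Implicit Defensive.

Import Order.TTheory GRing.Theory Num.Theory.
Import numFieldNormedType.Exports.

Local Open Scope classical_set_scope.
Local Open Scope ring_scope.
Local Open Scope complex_scope.

(* Functions on T = R / 2 pi Z are functions R -> R, with periodicity imposed
   in [wiener] below; a periodic distribution is represented by its Fourier
   coefficients, a function int -> R[i]. *)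

Definition expi (R : realType) (x : R) : R[i] := cos x +i* sin x.

Definition cintegral (R : realType) (D : set R) (F : R -> R[i]) : R[i] :=
  Rintegral (@lebesgue_measure R) D (fun x => complex.Re (F x)) +i*
  Rintegral (@lebesgue_measure R) D (fun x => complex.Im (F x)).

Definition fourier (R : realType) (u : R -> R) (n : int) : R[i] :=
  ((Num.sqrt (2 * pi))^-1)%:C *
  cintegral `[0, 2 * pi] (fun x => (u x)%:C * expi (- (n%:~R * x))).

(* Sum of the Fourier series (2 pi)^(-1/2) sum_n U(n) e^(inx), as the limit of
   the partial sums over |n| <= N.  The real part loses nothing: U is always
   Hermitian where this is used. *)
Definition fourier_sum (R : realType) (U : int -> R[i]) (x : R) : R :=
  lim ((fun N : nat => (Num.sqrt (2 * pi))^-1 *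
    (complex.Re (U 0) + \sum_(1 <= k < N.+1)
      complex.Re (U k%:Z * expi (k%:R * x) +
                  U (- k%:Z) * expi (- (k%:R * x))))) @ \oo).

Definition Lambda_dist (R : realType) (U : int -> R[i]) (n : int) : R[i] :=
  (`|n|%:~R)%:C * U n.

Definition dx_dist (R : realType) (U : int -> R[i]) (n : int) : R[i] :=
  (0 +i* n%:~R) * U n.

(* e^(- t Lambda) *)
Definition semigroup (R : realType) (t : R) (U : int -> R[i]) (n : int) : R[i] :=
  (expR (- (t * `|n|%:~R)))%:C * U n.

Definition Lambda (R : realType) (u : R -> R) : R -> R :=
  fourier_sum (Lambda_dist (fourier u)).

(* For u in A^1 the products u Lambda(u) and u u' are continuous functions, but
   the outer operators produce distributions in general. *)
Definition nonlinearity (R : realType) (u : R -> R) (n : int) : R[i] :=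
  Lambda_dist (fourier (fun x => u x * Lambda u x)) n +
  dx_dist (fourier (fun x => u x * derive1 u x)) n.

Definition wiener_norm (R : realType) (a : R) (u : R -> R) : \bar R :=
  \esum_(k in [set: int])
    ((`|k|%:~R `^ a) * ComplexField.Normc.normc (fourier u k))%:E.

(* For a >= 0 every element of A^a has an absolutely convergent Fourier series,
   hence a unique continuous representative, which is the one used here. *)
Definition wiener (R : realType) (a : R) : set (R -> R) :=
  [set u | [/\ periodic u (2 * pi), continuous u,
               Rintegral (@lebesgue_measure R) `[0, 2 * pi] u = 0 &
               (wiener_norm a u < +oo)%E]].

Definition Rplus (R : realType) : set R := [set t | 0 <= t].

Definition simple_in_wiener (R : realType) (a : R) (s : R -> R -> R) : Prop :=
  exists (m : nat) (E : 'I_m -> set R) (v : 'I_m -> R -> R),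
    [/\ forall i, measurable (E i), forall i, wiener a (v i) &
        forall t x, s t x = \sum_(i < m) \1_(E i) t * v i x].

Definition strongly_measurable (R : realType) (a : R) (f : R -> R -> R) : Prop :=
  exists s : nat -> R -> R -> R,
    (forall k, simple_in_wiener a (s k)) /\
    {ae @lebesgue_measure R, forall t, Rplus t ->
      wiener_norm a (fun x => s k t x - f t x) @[k --> \oo] --> 0%E}.

(* L^oo(R_+; A^a), for a representative defined at every time t >= 0 *)
Definition Linfty_wiener (R : realType) (a : R) (f : R -> R -> R) : Prop :=
  [/\ forall t, Rplus t -> wiener a (f t),
      strongly_measurable a f &
      exists C : R, {ae @lebesgue_measure R, forall t, Rplus t ->
        (wiener_norm a (f t) <= C%:E)%E}].

(* A^a-valued measures on R_+: countably additive in norm, with finite total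
   variation *)
Definition wiener_measure (R : realType) (a : R) (mu : set R -> R -> R) : Prop :=
  [/\ forall E, measurable E -> E `<=` @Rplus R -> wiener a (mu E),
      forall F : nat -> set R,
        (forall k, measurable (F k)) -> (forall k, F k `<=` @Rplus R) ->
        trivIset setT F ->
        wiener_norm a (fun x => mu (\bigcup_k F k) x - \sum_(k < n) mu (F k) x)
          @[n --> \oo] --> 0%E &
      exists C : R, forall (n : nat) (E : 'I_n -> set R),
        (forall i, measurable (E i)) -> (forall i, E i `<=` @Rplus R) ->
        trivIset setT E ->
        (\sum_(i < n) wiener_norm a (mu (E i)) <= C%:E)%E].

(* The function f belongs to M(R_+; A^a) when the distribution f(t) dt is an
   A^a-valued measure.  The two are compared on bounded Borel sets: they
   determine mu, and f in L^oo(R_+; A^1) is integrable on them a priori. *)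
Definition M_wiener (R : realType) (a : R) (f : R -> R -> R) : Prop :=
  exists mu : set R -> R -> R, wiener_measure a mu /\
    forall (T : R) (E : set R), measurable E -> E `<=` `[0, T] ->
      forall x, mu E x = Rintegral (@lebesgue_measure R) E (fun t => f t x).

(* f(t) = e^(-t Lambda) f0 + int_0^t e^(-(t-s) Lambda) N(f(s)) ds, an identity
   between periodic distributions, i.e. for each Fourier coefficient *)
Definition duhamel (R : realType) (f0 : R -> R) (f : R -> R -> R) : Prop :=
  forall t, Rplus t -> forall n : int,
    fourier (f t) n = semigroup t (fourier f0) n +
      cintegral `[0, t] (fun s => semigroup (t - s) (nonlinearity (f s)) n).

Definition global_solution (R : realType) (f0 : R -> R) (f : R -> R -> R) : Prop :=
  [/\ Linfty_wiener 1 f, M_wiener 2 f & duhamel f0 f].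

(* Main.v *)
(* Let a_n, n >= 0, be the Fourier coefficients of f and c = (2 pi)^(-1/2).  Since
   Lambda f + i f' only has frequencies of one sign, the nonlinearity has the
   coefficients 2 c n sum_(k >= 1) k conj(a_k) a_(n+k), whose factor n is absorbed
   by the time integral of exp(- n (t - s)).  Hence the sequence
   m_n = sup_t |a_n(t)| obeys the scalar recursion
   m_n <= |a_n(0)| + 2 c sum_k k m_k m_(n+k), under which the ball
   sum_n n m_n <= 2 A is stable when A = sum_n n |a_n(0)| < 1/4, that is when
   |f0|_(A^1) < 1/2: this makes the Picard iteration converge.  The energy
   identity of each scalar Duhamel integral then gives the bounds in A^1 and A^0
   and the integrability in A^2.

   For uniqueness, the A^2-valued measure of another solution g gives a bound on
   sum_n n^2 int_0^T |g_n|, hence on sum_n n M_n with M_n = sup_[0,T] |g_n|.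
   In the weight exp(- lam t) the factor n is replaced by n / (n + lam), so the
   contribution of M to the Lipschitz constant of the Duhamel map tends to 0 as
   lam grows, while that of the constructed solution stays below 2 A < 1/2. *)
Require Import Defs.
From HB Require Import structures.
From mathcomp Require Import all_boot all_order all_algebra.
From mathcomp Require Import all_classical all_reals all_analysis.
From mathcomp Require Import complex ring lra measurable_realfun.
Import Order.TTheory GRing.Theory Num.Theory.
Import numFieldNormedType.Exports.
Local Open Scope classical_set_scope.
Local Open Scope ring_scope.
Local Open Scope complex_scope.
Set Implicit Arguments.
Unset Strict Implicit.
Unset Printing Implicit Defensive.

(** * Absolutely convergent series *)

(** Functions are real with zero mean, so the coefficients n >= 0 carry everything and a Wiener norm
    is twice a sum over n >= 0; hence A is half of |f0|_(A^1), and the rate 1 - 4 A is 1 - 2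
    |f0|_(A^1). The outer derivative is never lost: in sum_k k conj(a_k) a_(n+k) a weight w(n)
    nondecreasing in n can be moved to the higher frequency n + k, after which the double sum
    factors as (sum_k k m_k) (sum_n w(n) m_n). This one inequality, with weights n, n^2 and n^2 / (n
    + lam), closes the fixed point, the energy estimates and uniqueness. The constants come from 2 c
    <= 1: A + 2 c (2 A)^2 <= A + 4 A A <= 2 A. The energy estimates absorb an integral of the
    right-hand side into the left, which requires it to be finite beforehand; this finiteness is
    carried through the iteration. Another solution is not small, and its measurability and uniform
    A^1 bound hold only almost everywhere, whereas its Duhamel formula holds at every time:
    estimates are made off a null set, and the formula transfers the equality to the remaining
    times. *)

Definition tsum (R : realType) (u : nat -> R) : R :=
  limn (fun N => \sum_(k < N) u k).

(** For nonnegative terms this says that the series converges with sum at most S. Estimates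
    circulate in this form because it involves finite sums only and passes to limits termwise. *)
Definition bnd (R : realType) (u : nat -> R) (S : R) : Prop :=
  forall N, \sum_(k < N) u k <= S.

Definition summ (R : realType) (u : nat -> R) : Prop :=
  exists S, bnd (fun k => `|u k|) S.

Section RealSeries.
Variable R : realType.
Implicit Types (u v w : nat -> R) (S : R).

Lemma psum_nd u : (forall k, 0 <= u k) ->
  {homo (fun N => \sum_(k < N) u k) : n m / (n <= m)%N >-> n <= m}.
Proof.
move=> u0; apply/nondecreasing_seqP => n.
by rewrite big_ord_recr /= lerDl.
Qed.

Lemma bnd_cvg u S : (forall k, 0 <= u k) -> bnd u S ->
  cvgn (fun N => \sum_(k < N) u k).
Proof.
move=> u0 uS; apply: nondecreasing_is_cvgn; first exact: psum_nd.
by exists S => _ [N _ <-]; exact: uS.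
Qed.

Lemma summ_le u v S : (forall k, `|u k| <= v k) -> bnd v S -> summ u.
Proof.
move=> uv vS; exists S => N; apply: le_trans (vS N).
exact: ler_sum.
Qed.

(** Both u + |u| and |u| have monotone bounded partial sums, and u is their difference. *)
Lemma summ_cvg u : summ u -> (fun N => \sum_(k < N) u k) @ \oo --> tsum u.
Proof.
move=> [S uS].
have c1 : cvgn (fun N => \sum_(k < N) `|u k|) by apply: bnd_cvg uS.
have c2 : cvgn (fun N => \sum_(k < N) (u k + `|u k|)).
  apply: (@bnd_cvg (fun k => u k + `|u k|) (S + S)) => [k|N].
    by have := ler_norm (- u k); rewrite normrN; lra.
  rewrite big_split /=; apply: lerD; last exact: uS.
  apply: le_trans (uS N).
  by apply: ler_sum => k _; exact: ler_norm.
have c3 : (fun N => \sum_(k < N) u k) =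
    (fun N => \sum_(k < N) (u k + `|u k|) - \sum_(k < N) `|u k|).
  by apply/funext => N; rewrite big_split /= addrK.
have /cvg_ex[l hl] : cvgn (fun N => \sum_(k < N) u k).
  by rewrite c3; exact: is_cvgB.
rewrite /tsum; have /cvg_lim -> := hl => //.
Qed.

Lemma tsum_eq u l : (fun N => \sum_(k < N) u k) @ \oo --> l -> tsum u = l.
Proof. by move=> /cvg_lim; exact. Qed.

Lemma tsum_le u S : summ u -> bnd u S -> tsum u <= S.
Proof.
move=> /summ_cvg cu uS; rewrite /tsum; apply: limr_le.
  by apply/cvg_ex; eexists; exact: cu.
by apply: nearW => N; exact: uS.
Qed.

Lemma summ_nneg u S : (forall k, 0 <= u k) -> bnd u S -> summ u.
Proof. by move=> u0; apply: summ_le => k; rewrite ger0_norm. Qed.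

Lemma bnd_tsum u : (forall k, 0 <= u k) -> summ u -> bnd u (tsum u).
Proof.
move=> u0 [S uS] N.
apply: (nondecreasing_cvgn_le (psum_nd u0)).
apply: (@bnd_cvg _ S) => // n; under eq_bigr => k _ do rewrite -(ger0_norm (u0 k)).
exact: uS.
Qed.

Lemma bnd_term u S k : (forall k, 0 <= u k) -> bnd u S -> u k <= S.
Proof.
move=> u0 /(_ k.+1); rewrite big_ord_recr /=; apply: le_trans.
by rewrite lerDr sumr_ge0.
Qed.

Lemma bnd_ge0 u S : bnd u S -> 0 <= S.
Proof. by move=> /(_ 0%N); rewrite big_ord0. Qed.

Lemma tsum_ge0 u : (forall k, 0 <= u k) -> summ u -> 0 <= tsum u.
Proof. by move=> u0 su; exact: bnd_ge0 (bnd_tsum u0 su). Qed.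

Lemma summN u : summ u -> summ (fun k => - u k).
Proof. by move=> [S uS]; exists S => N; under eq_bigr do rewrite normrN; exact: uS. Qed.

Lemma summD u v : summ u -> summ v -> summ (fun k => u k + v k).
Proof.
move=> [S uS] [T vT]; exists (S + T) => N.
apply: (@le_trans _ _ (\sum_(k < N) (`|u k| + `|v k|))).
  by apply: ler_sum => k _; exact: ler_normD.
by rewrite big_split lerD.
Qed.

Lemma summZ c u : summ u -> summ (fun k => c * u k).
Proof.
move=> [S uS]; exists (`|c| * S) => N.
under eq_bigr do rewrite normrM.
by rewrite -mulr_sumr ler_wpM2l.
Qed.

Lemma tsumD u v : summ u -> summ v ->
  tsum (fun k => u k + v k) = tsum u + tsum v.
Proof.
move=> /summ_cvg cu /summ_cvg cv; apply: tsum_eq.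
under eq_fun do rewrite big_split /=.
exact: cvgD.
Qed.

Lemma tsumZ c u : summ u -> tsum (fun k => c * u k) = c * tsum u.
Proof.
move=> /summ_cvg cu; apply: tsum_eq.
under eq_fun do rewrite -mulr_sumr.
exact: cvgMr.
Qed.

Lemma tsumN u : summ u -> tsum (fun k => - u k) = - tsum u.
Proof.
move=> su; rewrite -mulN1r -tsumZ //; congr tsum; apply/funext => k.
by rewrite mulN1r.
Qed.

Lemma tsumB u v : summ u -> summ v ->
  tsum (fun k => u k - v k) = tsum u - tsum v.
Proof. by move=> su sv; rewrite tsumD ?tsumN //; exact: summN. Qed.

Lemma le_tsum u v : summ u -> summ v -> (forall k, u k <= v k) ->
  tsum u <= tsum v.
Proof.
move=> /summ_cvg cu /summ_cvg cv uv; rewrite /tsum; apply: ler_lim.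
- by apply/cvg_ex; eexists; exact: cu.
- by apply/cvg_ex; eexists; exact: cv.
- by apply: nearW => N; exact: ler_sum.
Qed.

Lemma summ_norm u : summ u -> summ (fun k => `|u k|).
Proof. by move=> [S uS]; exists S => N; under eq_bigr do rewrite normr_id; exact: uS. Qed.

Lemma ler_norm_tsum u : summ u -> `|tsum u| <= tsum (fun k => `|u k|).
Proof.
move=> su; have sn := summ_norm su; rewrite ler_norml lerNl -tsumN //.
apply/andP; split.
  by apply: le_tsum => [||k]; [exact: summN|by []|rewrite -normrN ler_norm].
by apply: le_tsum => // k; exact: ler_norm.
Qed.

Lemma tsum0 : tsum (fun=> 0 : R) = 0.
Proof.
by apply: tsum_eq; under eq_fun do rewrite big1 //; exact: cvg_cst.
Qed.

Lemma bndD u v S T : bnd u S -> bnd v T -> bnd (fun k => u k + v k) (S + T).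
Proof. by move=> uS vT N; rewrite big_split lerD. Qed.

Lemma bndZ c u S : 0 <= c -> bnd u S -> bnd (fun k => c * u k) (c * S).
Proof. by move=> c0 uS N; rewrite -mulr_sumr ler_wpM2l. Qed.

Lemma bnd_le u v S : (forall k, u k <= v k) -> bnd v S -> bnd u S.
Proof. by move=> uv vS N; apply: le_trans (vS N); exact: ler_sum. Qed.

Lemma bnd_leS u S T : S <= T -> bnd u S -> bnd u T.
Proof. by move=> ST uS N; exact: le_trans (uS N) ST. Qed.

Lemma bnd_shift u S n : (forall k, 0 <= u k) -> bnd u S ->
  bnd (fun k => u (n + k)%N) S.
Proof.
move=> u0 uS N; apply: le_trans (uS (n + N)%N).
rewrite big_split_ord /= lerDr; exact: sumr_ge0.
Qed.

Lemma summ_tail u S (e : R) : (forall k, 0 <= u k) -> bnd u S -> 0 < e ->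
  exists N, bnd (fun k => u (N + k)%N) e.
Proof.
move=> u0 uS e0; have su := summ_nneg u0 uS.
have /cvgrPdist_lt /(_ e e0) [N _ /(_ N (leqnn N))] := summ_cvg su.
move=> hN; exists N => K.
have := bnd_tsum u0 su (N + K)%N; rewrite big_split_ord /=.
move: hN => /ltr_normlP[]; lra.
Qed.

Lemma cvg_psum T (F : set_system T) {FF : Filter F} (u : nat -> T -> R)
    (l : nat -> R) N :
  (forall k, u k @ F --> l k) ->
  (fun s => \sum_(k < N) u k s) @ F --> \sum_(k < N) l k.
Proof.
move=> ul; elim: N => [|N IH].
  by under eq_fun do rewrite big_ord0; rewrite big_ord0; exact: cvg_cst.
by under eq_fun do rewrite big_ord_recr /=; rewrite big_ord_recr; exact: cvgD.
Qed.

(** Dominated convergence for series: past some N the tail of the majorant is at most e / 2 for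
    every j, and the N leading terms tend to 0. *)
Lemma tannery (u : nat -> nat -> R) (M : nat -> R) S :
  (forall j k, `|u j k| <= M k) -> bnd M S ->
  (forall k, (fun j => u j k) @ \oo --> (0 : R)) ->
  (fun j => tsum (fun k => `|u j k|)) @ \oo --> (0 : R).
Proof.
move=> uM MS u0.
have M0 k : 0 <= M k by exact: le_trans (normr_ge0 _) (uM 0%N k).
apply/cvgrPdist_le => e e0.
have e2 : 0 < e / 2 by rewrite divr_gt0.
have [N hN] := summ_tail M0 MS e2.
have c1 : (fun j => \sum_(k < N) `|u j k|) @ \oo --> (0 : R).
  have := @cvg_psum _ \oo _ (fun k j => `|u j k|) (fun=> `|0 : R|) N.
  rewrite [X in _ --> X]big1 => [|k _]; last exact: normr0.
  by apply => k; apply: cvg_norm; exact: u0.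
have /cvgrPdist_le /(_ _ e2) := c1; apply: filterS => j.
rewrite !sub0r !normrN => hj.
have sj : summ (fun k => `|u j k|).
  by apply: (@summ_le _ M S) => // k; rewrite normr_id.
rewrite ger0_norm; last by apply: tsum_ge0.
apply: tsum_le => // K.
apply: (@le_trans _ _ (\sum_(k < N + K) `|u j k|)).
  apply: (@psum_nd (fun k => `|u j k|)) => //; exact: leq_addl.
rewrite big_split_ord /= [e]splitr lerD //.
  by apply: le_trans hj; exact: ler_norm.
apply: le_trans (hN K); exact: ler_sum.
Qed.

End RealSeries.

(** * Complex moduli and absolutely convergent complex series *)

Notation nrm := ComplexField.Normc.normc.

Definition ctsum (R : realType) (U : nat -> R[i]) : R[i] :=
  tsum (fun k => complex.Re (U k)) +i* tsum (fun k => complex.Im (U k)).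

Section Complex.
Variable R : realType.
Implicit Types (x y z w : R[i]) (U V : nat -> R[i]) (S : R).

Lemma eq_complexP z w :
  complex.Re z = complex.Re w -> complex.Im z = complex.Im w -> z = w.
Proof. by case: z w => a b [c d] /= -> ->. Qed.

Lemma ReD z w : complex.Re (z + w) = complex.Re z + complex.Re w.
Proof. by case: z w => ? ? []. Qed.
Lemma ImD z w : complex.Im (z + w) = complex.Im z + complex.Im w.
Proof. by case: z w => ? ? []. Qed.
Lemma ReN z : complex.Re (- z) = - complex.Re z.
Proof. by case: z. Qed.
Lemma ImN z : complex.Im (- z) = - complex.Im z.
Proof. by case: z. Qed.
Lemma ReM z w : complex.Re (z * w) =
  complex.Re z * complex.Re w - complex.Im z * complex.Im w.
Proof. by case: z w => ? ? []. Qed.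
Lemma ImM z w : complex.Im (z * w) =
  complex.Re z * complex.Im w + complex.Im z * complex.Re w.
Proof. by case: z w => ? ? []. Qed.
Lemma ReJ z : complex.Re z^*%C = complex.Re z.
Proof. by case: z. Qed.
Lemma ImJ z : complex.Im z^*%C = - complex.Im z.
Proof. by case: z. Qed.
Lemma Re_sum (N : nat) (F : nat -> R[i]) :
  complex.Re (\sum_(k < N) F k) = \sum_(k < N) complex.Re (F k).
Proof. by elim: N => [|N IH]; rewrite ?big_ord0 // !big_ord_recr /= ReD IH. Qed.
Lemma Im_sum (N : nat) (F : nat -> R[i]) :
  complex.Im (\sum_(k < N) F k) = \sum_(k < N) complex.Im (F k).
Proof. by elim: N => [|N IH]; rewrite ?big_ord0 // !big_ord_recr /= ImD IH. Qed.

Definition ReImE := (ReD, ImD, ReN, ImN, ReM, ImM, ReJ, ImJ).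

Lemma conjD z w : (z + w)^*%C = z^*%C + w^*%C.
Proof. by apply: eq_complexP; rewrite !ReImE // opprD. Qed.
Lemma conjB z w : (z - w)^*%C = z^*%C - w^*%C.
Proof. by apply: eq_complexP; rewrite !ReImE // opprD. Qed.
Lemma conjM z w : (z * w)^*%C = z^*%C * w^*%C.
Proof. by apply: eq_complexP; rewrite !ReImE; ring. Qed.

Lemma conjR (r : R) : (r%:C)^*%C = r%:C.
Proof. by rewrite /= oppr0. Qed.

Lemma nrmE z : nrm z = Num.sqrt (complex.Re z ^+ 2 + complex.Im z ^+ 2).
Proof. by case: z. Qed.

Lemma nrm_ge0 z : 0 <= nrm z.
Proof. by rewrite nrmE sqrtr_ge0. Qed.

Lemma nrm_sqr z : nrm z ^+ 2 = complex.Re z ^+ 2 + complex.Im z ^+ 2.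
Proof. by rewrite nrmE sqr_sqrtr // addr_ge0 // sqr_ge0. Qed.

Lemma nrm0 : nrm (0 : R[i]) = 0.
Proof. exact: ComplexField.Normc.normc0. Qed.

Lemma nrm_eq0 z : nrm z = 0 -> z = 0.
Proof. exact: ComplexField.Normc.eq0_normc. Qed.

Lemma nrmM z w : nrm (z * w) = nrm z * nrm w.
Proof. exact: ComplexField.Normc.normcM. Qed.

Lemma nrmJ z : nrm z^*%C = nrm z.
Proof. by rewrite !nrmE ReJ ImJ sqrrN. Qed.

Lemma nrmN z : nrm (- z) = nrm z.
Proof. by rewrite !nrmE ReN ImN !sqrrN. Qed.

Lemma nrm_real (a : R) : nrm a%:C = `|a|.
Proof. by rewrite nrmE /= expr0n /= addr0 sqrtr_sqr. Qed.

Lemma nrm_imag (a : R) : nrm (0 +i* a) = `|a|.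
Proof. by rewrite nrmE /= expr0n /= add0r sqrtr_sqr. Qed.

Lemma Re_le_nrm z : `|complex.Re z| <= nrm z.
Proof.
by rewrite nrmE -sqrtr_sqr ler_sqrt ?lerDl ?sqr_ge0 // addr_ge0 // sqr_ge0.
Qed.

Lemma Im_le_nrm z : `|complex.Im z| <= nrm z.
Proof.
by rewrite nrmE -sqrtr_sqr ler_sqrt ?lerDr ?sqr_ge0 // addr_ge0 // sqr_ge0.
Qed.

Lemma nrm_le_ReIm z : nrm z <= `|complex.Re z| + `|complex.Im z|.
Proof.
rewrite -(@ler_pXn2r _ 2) ?nnegrE ?nrm_ge0 ?addr_ge0 // nrm_sqr.
rewrite sqrrD !real_normK ?num_real //.
have : 0 <= `|complex.Re z| * `|complex.Im z| by rewrite mulr_ge0.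
rewrite mulr2n; lra.
Qed.

(* The norm is the supremum of the real linear forms z |-> Re (w z), |w| <= 1;
   this reduces norm estimates of sums and integrals to real ones. *)
Lemma nrm_dual z S : 0 <= S ->
  (forall w, complex.Re (w * z) <= nrm w * S) -> nrm z <= S.
Proof.
move=> S0 /(_ z^*%C); rewrite ReM ReJ ImJ nrmJ mulNr opprK -!expr2 -nrm_sqr.
have [z0|z0] := eqVneq (nrm z) 0; first by rewrite z0.
by rewrite expr2 ler_pM2l // lt_neqAle eq_sym z0 nrm_ge0.
Qed.

Lemma nrmD z w : nrm (z + w) <= nrm z + nrm w.
Proof.
apply: nrm_dual => [|v]; first by rewrite addr_ge0 ?nrm_ge0.
rewrite mulrDr ReD mulrDr -!nrmM.
by apply: lerD; exact: le_trans (ler_norm _) (Re_le_nrm _).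
Qed.

Lemma nrmB z w : nrm (z - w) <= nrm z + nrm w.
Proof. by rewrite -(nrmN w) nrmD. Qed.

Lemma nrm_distC z w : nrm (z - w) = nrm (w - z).
Proof. by rewrite -nrmN opprB. Qed.

Lemma nrm_sum (N : nat) (F : nat -> R[i]) :
  nrm (\sum_(k < N) F k) <= \sum_(k < N) nrm (F k).
Proof.
elim: N => [|N IH]; first by rewrite !big_ord0 nrm0.
by rewrite !big_ord_recr /=; apply: le_trans (nrmD _ _) _; rewrite lerD.
Qed.

Lemma csumm_Re U : summ (fun k => nrm (U k)) -> summ (fun k => complex.Re (U k)).
Proof.
move=> [S h]; apply: summ_le h => k /=; rewrite (ger0_norm (nrm_ge0 _)).
exact: Re_le_nrm.
Qed.

Lemma csumm_Im U : summ (fun k => nrm (U k)) -> summ (fun k => complex.Im (U k)).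
Proof.
move=> [S h]; apply: summ_le h => k /=; rewrite (ger0_norm (nrm_ge0 _)).
exact: Im_le_nrm.
Qed.

Lemma csumm_le U v S : (forall k, nrm (U k) <= v k) -> bnd v S ->
  summ (fun k => nrm (U k)).
Proof. by move=> h; apply: summ_le => k; rewrite ger0_norm ?nrm_ge0. Qed.

Lemma csummZ w U : summ (fun k => nrm (U k)) -> summ (fun k => nrm (w * U k)).
Proof.
by move=> su; under eq_fun do rewrite nrmM; exact: summZ.
Qed.

Lemma ctsumD U V : summ (fun k => nrm (U k)) -> summ (fun k => nrm (V k)) ->
  ctsum (fun k => U k + V k) = ctsum U + ctsum V.
Proof.
move=> su sv; apply: eq_complexP => /=.
  by under eq_fun do rewrite ReD; rewrite tsumD //; exact: csumm_Re.
by under eq_fun do rewrite ImD; rewrite tsumD //; exact: csumm_Im.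
Qed.

Lemma ctsumZ w U : summ (fun k => nrm (U k)) ->
  ctsum (fun k => w * U k) = w * ctsum U.
Proof.
move=> su; have sr := csumm_Re su; have si := csumm_Im su.
apply: eq_complexP; rewrite ?ReM ?ImM /=.
  under eq_fun do rewrite ReM.
  by rewrite tsumB ?tsumZ //; exact: summZ.
under eq_fun do rewrite ImM.
by rewrite tsumD ?tsumZ //; exact: summZ.
Qed.

Lemma ctsumB U V : summ (fun k => nrm (U k)) -> summ (fun k => nrm (V k)) ->
  ctsum (fun k => U k - V k) = ctsum U - ctsum V.
Proof.
move=> su sv; rewrite -[in RHS]mulN1r -ctsumZ // -ctsumD //; last exact: csummZ.
by congr ctsum; apply/funext => k; rewrite mulN1r.
Qed.

Lemma nrm_ctsum U : summ (fun k => nrm (U k)) ->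
  nrm (ctsum U) <= tsum (fun k => nrm (U k)).
Proof.
move=> su; apply: nrm_dual => [|w].
  by apply: tsum_ge0 => // k; exact: nrm_ge0.
rewrite -ctsumZ // -tsumZ //=; apply: le_tsum => [||k].
- by apply: csumm_Re; exact: csummZ.
- exact: summZ.
- by rewrite -nrmM; exact: le_trans (ler_norm _) (Re_le_nrm _).
Qed.

Lemma eq_ctsum U V : U =1 V -> ctsum U = ctsum V.
Proof. by move=> UV; congr ctsum; exact/funext. Qed.

End Complex.

(** * Integrals of complex functions *)

Notation intg E u :=
  ((@lebesgue_measure _).-integrable E (EFin \o u)).
Notation II E u := (Rintegral (@lebesgue_measure _) E u).

Section Integrals.
Variable R : realType.
Implicit Types (E : set R) (u v F : R -> R) (a b t C : R).
Notation mu := (@lebesgue_measure R).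

Lemma mu_itv_lty a b : (mu `[a, b] < +oo)%E.
Proof. by rewrite lebesgue_measure_itv /=; case: ifPn => // _; rewrite -EFinB ltry. Qed.

Lemma intg_bdd E u a b C : measurable E -> E `<=` `[a, b] ->
  measurable_fun E u -> (forall s, E s -> `|u s| <= C) -> intg E u.
Proof.
move=> mE Eab mu_ uC; apply: measurable_bounded_integrable => //.
  by apply: le_lt_trans (mu_itv_lty a b); apply: le_measure => //; rewrite inE.
exists C; split; first exact: num_real.
by move=> M CM s Es; exact: le_trans (uC _ Es) (ltW CM).
Qed.

Lemma measT_E u E : measurable E -> measurable_fun setT u -> measurable_fun E u.
Proof. by move=> mE; apply: measurable_funS. Qed.

Lemma cont_meas u E : measurable E -> continuous u -> measurable_fun E u.
Proof. by move=> mE cu; apply: measT_E => //; exact: measurable_realfun.continuous_measurable_fun. Qed.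

Definition contI a b u := forall x, a <= x <= b -> {for x, continuous u}.

Lemma contI_within a b u : contI a b u -> {within `[a, b], continuous u}.
Proof.
move=> cu; apply: continuous_in_subspaceT => x; rewrite inE /= in_itv /=.
exact: cu.
Qed.

Lemma intg_contI u a b : contI a b u -> intg `[a, b] u.
Proof.
move=> cu; apply: continuous_compact_integrable; first exact: segment_compact.
exact: contI_within.
Qed.

Lemma contI_cont u a b : continuous u -> contI a b u.
Proof. by move=> cu x _; exact: cu. Qed.

Lemma intg_cont u a b : continuous u -> intg `[a, b] u.
Proof. by move=> cu; apply: intg_contI; exact: contI_cont. Qed.

Lemma intg_contE u a b E : continuous u -> measurable E -> E `<=` `[a, b] ->
  intg E u.
Proof.
by move=> cu mE Eab; apply: integrableS (intg_cont a b cu).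
Qed.

(** The primitive starts at a, so its two-sided derivative is available only to the right of a;
    callers take a strictly to the left of the interval they work on. *)
Lemma prim a u : continuous u ->
  exists F, forall x, a < x -> is_derive x 1 F (u x).
Proof.
move=> cu; exists (fun x => II `[a, x] u) => x ax.
have [df f'] := @continuous_FTC1 R u (BLeft a) x (x + 1) (ltr_pwDr ltr01 (lexx x))
  (intg_cont a (x + 1) cu) ax (cu x).
by rewrite derive1E in f'; apply: DeriveDef.
Qed.

Lemma II_FTC2 a b u F : a <= b -> contI a b u ->
  (forall x, a <= x <= b -> is_derive x 1 F (u x)) -> II `[a, b] u = F b - F a.
Proof.
rewrite le_eqVlt => /predU1P[<- _ _|ab cu dF].
  by rewrite set_itv1 Rintegral_set1 subrr.
rewrite /Rintegral (@continuous_FTC2 R u F) //.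
- exact: contI_within.
- have cF x : a <= x <= b -> {for x, continuous F}.
    move=> /dF h; apply: differentiable_continuous; apply/derivable1_diffP.
    exact: ex_derive.
  split => [x| |].
  + rewrite in_itv /= => /andP[ax xb].
    by have := dF x; rewrite !ltW // => /(_ isT) h; exact: ex_derive.
  + by apply: cvg_at_right_filter; apply: cF; rewrite lexx ltW.
  + by apply: cvg_at_left_filter; apply: cF; rewrite lexx ltW.
- move=> x; rewrite in_itv /= => /andP[ax xb].
  by have := dF x; rewrite !ltW // => /(_ isT) h; rewrite derive1E; exact: derive_val.
Qed.

Lemma II_cst_itv c a b : a <= b -> II `[a, b] (fun=> c) = c * (b - a).
Proof.
move=> ab; rewrite Rintegral_cst //.
rewrite [X in fine X](_ : _ = (@lebesgue_measure R) [set` `[a, b]]) //.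
rewrite lebesgue_measure_itv /= lte_fin.
by case: ltgtP ab => //= ->; rewrite subrr !mulr0.
Qed.

Lemma II_cst c t : 0 <= t -> II `[0, t] (fun=> c) = c * t.
Proof. by move=> t0; rewrite II_cst_itv // subr0. Qed.

Lemma II_le E u v : measurable E -> intg E u -> intg E v ->
  (forall s, E s -> u s <= v s) -> II E u <= II E v.
Proof. by move=> *; exact: le_Rintegral. Qed.

Lemma II_ext E u v : (forall s, E s -> u s = v s) -> II E u = II E v.
Proof. by move=> uv; apply: eq_Rintegral => s; rewrite inE; exact: uv. Qed.

Lemma intg_norm E u : intg E u -> intg E (fun s => `|u s|).
Proof. by move=> h; have := integrable_abse h. Qed.

Lemma II_norm E u : measurable E -> intg E u -> `|II E u| <= II E (fun s => `|u s|).
Proof. by move=> *; exact: le_normr_Rintegral. Qed.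

Lemma II_Z E u c : measurable E -> intg E u ->
  II E (fun s => c * u s) = c * II E u.
Proof. by move=> *; exact: RintegralZl. Qed.

Lemma intg_Z E u c : measurable E -> intg E u -> intg E (fun s => c * u s).
Proof.
move=> mE h; have := @integrableZl _ _ _ (@lebesgue_measure R) E mE c _ h.
by apply: eq_integrable => // s _ /=; rewrite EFinM.
Qed.

Lemma intg_D E u v : measurable E -> intg E u -> intg E v ->
  intg E (fun s => u s + v s).
Proof.
move=> mE hu hv; have := @integrableD _ _ _ (@lebesgue_measure R) E mE _ _ hu hv.
by apply: eq_integrable => // s _ /=; rewrite EFinD.
Qed.

Lemma II_D E u v : measurable E -> intg E u -> intg E v ->
  II E (fun s => u s + v s) = II E u + II E v.
Proof. by move=> *; exact: RintegralD. Qed.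

Lemma intg_0 E : intg E (fun=> 0 : R).
Proof. exact: integrable0. Qed.

Lemma intg_sum E (u : nat -> R -> R) N : measurable E ->
  (forall k, intg E (u k)) -> intg E (fun s => \sum_(k < N) u k s).
Proof.
move=> mE hu; elim: N => [|N IH].
  by under eq_fun do rewrite big_ord0; exact: intg_0.
by under eq_fun do rewrite big_ord_recr /=; exact: intg_D.
Qed.

Lemma II_sum E (u : nat -> R -> R) N : measurable E ->
  (forall k, intg E (u k)) ->
  II E (fun s => \sum_(k < N) u k s) = \sum_(k < N) II E (u k).
Proof.
move=> mE hu; elim: N => [|N IH].
  under eq_fun do rewrite big_ord0.
  by rewrite big_ord0 Rintegral_cst // mul0r.
under eq_fun do rewrite big_ord_recr /=.
by rewrite II_D // ?IH ?big_ord_recr //; exact: intg_sum.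
Qed.

Lemma II_ge0 E u : (forall s, E s -> 0 <= u s) -> 0 <= II E u.
Proof. by move=> u0; apply: Rintegral_ge0. Qed.

Lemma II_sub E1 E2 u : measurable E1 -> measurable E2 -> E1 `<=` E2 ->
  intg E2 u -> (forall s, E2 s -> 0 <= u s) -> II E1 u <= II E2 u.
Proof.
move=> m1 m2 s12 hu u0; rewrite /Rintegral fine_le //.
- by apply: integrable_fin_num => //; exact: integrableS hu.
- exact: integrable_fin_num.
- apply: ge0_subset_integral => //; first exact: measurable_int hu.
Qed.

Lemma meas_sum E (u : nat -> R -> R) N : measurable E ->
  (forall k, measurable_fun E (u k)) ->
  measurable_fun E (fun s => \sum_(k < N) u k s).
Proof.
move=> mE hu; elim: N => [|N IH].
  by under eq_fun do rewrite big_ord0; exact: measurable_cst.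
by under eq_fun do rewrite big_ord_recr /=; exact: measurable_funD.
Qed.

Lemma meas_cvg E (u : nat -> R -> R) v : measurable E ->
  (forall k, measurable_fun E (u k)) ->
  (forall s, E s -> (fun k => u k s) @ \oo --> v s) -> measurable_fun E v.
Proof.
move=> mE mu_ cu; apply/measurable_EFinP.
apply: (measurable_realfun.emeasurable_fun_cvg (fun k => EFin \o u k)).
  by move=> k; apply/measurable_EFinP.
by move=> s Es; apply: cvg_EFin; [exact: nearW|exact: cu].
Qed.

(** Dominated convergence, with the constant C as dominating function, integrable because E lies in
    a bounded interval. Only the sum of the absolute values has to be bounded at each point, not
    each term by a fixed summable sequence: this is what an A^1 bound uniform in time provides. *)
Lemma int_tsum E a b (u : nat -> R -> R) C :
  measurable E -> E `<=` `[a, b] -> (forall k, measurable_fun E (u k)) ->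
  (forall s, E s -> bnd (fun k => `|u k s|) C) ->
  [/\ measurable_fun E (fun s => tsum (u^~ s)),
      summ (fun k => II E (u k)) &
      II E (fun s => tsum (u^~ s)) = tsum (fun k => II E (u k))].
Proof.
move=> mE Eab mu_ uC.
have su s : E s -> summ (u^~ s) by move=> Es; exists C; exact: uC.
have absle s k : E s -> `|u k s| <= C.
  by move=> /uC; apply: (@bnd_term _ (fun k => `|u k s|)).
have iu k : intg E (u k).
  by apply: (intg_bdd (a:=a) (b:=b) (C:=C)) => // s Es; exact: absle.
have mt : measurable_fun E (fun s => tsum (u^~ s)).
  apply: (@meas_cvg _ (fun N s => \sum_(k < N) u k s)) => //.
    by move=> N; exact: meas_sum.
  by move=> s Es; apply: summ_cvg; exact: su.
have leC s N : E s -> `|\sum_(k < N) u k s| <= C.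
  by move=> Es; apply: le_trans (ler_norm_sum _ _ _) _; exact: uC.
have iC : intg E (fun=> C).
  by apply: (intg_bdd (a:=a) (b:=b) (C:=`|C|)).
have it : intg E (fun s => tsum (u^~ s)).
  apply: (intg_bdd (a:=a) (b:=b) (C:=C)) => // s Es.
  apply: le_trans (ler_norm_tsum (su _ Es)) _; apply: tsum_le; last exact: uC.
  by apply: summ_norm; exact: su.
split => //.
  exists (II E (fun=> C)) => N.
  apply: (@le_trans _ _ (\sum_(k < N) II E (fun s => `|u k s|))).
    by apply: ler_sum => k _; exact: II_norm.
  rewrite -(@II_sum E (fun k s => `|u k s|)) //; last by move=> k; exact: intg_norm.
  apply: II_le => // [|s Es]; last exact: uC.
  by apply: (@intg_sum E (fun k s => `|u k s|)) => // k; exact: intg_norm.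
apply/esym/tsum_eq.
have := @dominated_cvg _ _ _ mu E mE (fun N s => (\sum_(k < N) u k s)%:E)
  (fun s => (tsum (u^~ s))%:E) (fun=> C%:E).
have -> : (\int[mu]_(x in E) (tsum (u^~ x))%:E)%E = (II E (fun s => tsum (u^~ s)))%:E.
  by rewrite /Rintegral fineK //; exact: integrable_fin_num.
move=> h; have /fine_cvgP[_] : (\int[mu]_(x in E) (\sum_(k < N) u k x)%:E)%E @[N --> \oo]
     --> (II E (fun s => tsum (u^~ s)))%:E.
  apply: h => // [N|s Es|N s Es].
  - by apply/measurable_EFinP; exact: meas_sum.
  - by apply: cvg_EFin; [exact: nearW|apply: summ_cvg; exact: su].
  - by rewrite lee_fin; exact: leC.
apply: cvg_trans; apply: near_eq_cvg; apply: nearW => N /=.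
by rewrite -II_sum.
Qed.

(** Weierstrass test: the tail of M bounds the remainder of the series by e / 3 at every point, and
    the partial sum is continuous. *)
Lemma cont_tsum (u : nat -> R -> R) (M : nat -> R) S :
  (forall k, continuous (u k)) -> (forall k s, `|u k s| <= M k) -> bnd M S ->
  continuous (fun s => tsum (u^~ s)).
Proof.
move=> cu uM MS x; apply/cvgrPdist_lt => e e0.
have M0 k : 0 <= M k by exact: le_trans (normr_ge0 _) (uM k 0).
have e3 : 0 < e / 3 by rewrite divr_gt0.
have [N hN] := summ_tail M0 MS e3.
have su s : summ (u^~ s) by apply: summ_le MS => k; exact: uM.
have tail s : `|tsum (u^~ s) - \sum_(k < N) u k s| <= e / 3.
  have /summ_cvg := su s => h.
  have h2 : (fun K => `|\sum_(k < N + K) u k s - \sum_(k < N) u k s|) @ \oo -->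
      `|tsum (u^~ s) - \sum_(k < N) u k s|.
    apply: cvg_norm; apply: cvgB; last exact: cvg_cst.
    rewrite -(cvg_shiftn N) in h.
    have -> // : (fun K => \sum_(k < N + K) u k s) =
      [sequence (fun K => \sum_(k < K) u k s) (n + N)%N]_n.
    by apply/funext => K; rewrite addnC.
  move: (h2) => /cvg_lim <- //; apply: limr_le; first by apply/cvg_ex; eexists; exact: h2.
  apply: nearW => K; rewrite big_split_ord /= addrAC subrr add0r.
  apply: le_trans (ler_norm_sum _ _ _) _; apply: le_trans (hN K); exact: ler_sum.
have cN : {for x, continuous (fun s => \sum_(k < N) u k s)}.
  exact: (@cvg_psum _ _ (nbhs x) _ u (fun k => u k x) N (fun k => cu k x)).
have /cvgrPdist_lt /(_ _ e3) := cN; apply: filterS => t ht.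
have h1 := tail x; have h2 := tail t.
have -> : tsum (u^~ x) - tsum (u^~ t) = (tsum (u^~ x) - \sum_(k < N) u k x) +
  (\sum_(k < N) u k x - \sum_(k < N) u k t) - (tsum (u^~ t) - \sum_(k < N) u k t) by ring.
apply: le_lt_trans (ler_normB _ _) _.
apply: (@le_lt_trans _ _ (`|tsum (u^~ x) - \sum_(k < N) u k x| +
  `|\sum_(k < N) u k x - \sum_(k < N) u k t| + `|tsum (u^~ t) - \sum_(k < N) u k t|)).
  by rewrite lerD2r ler_normD.
lra.
Qed.

End Integrals.

Section ComplexIntegrals.
Variable R : realType.
Implicit Types (E : set R) (U V : R -> R[i]) (a b t C : R).

Definition cmeas E U := measurable_fun E (fun s => complex.Re (U s)) /\
  measurable_fun E (fun s => complex.Im (U s)).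

Definition cintg E U := intg E (fun s => complex.Re (U s)) /\
  intg E (fun s => complex.Im (U s)).

Definition ccont U := continuous (fun s => complex.Re (U s)) /\
  continuous (fun s => complex.Im (U s)).

Lemma ccont_cmeas U E : measurable E -> ccont U -> cmeas E U.
Proof. by move=> mE [h1 h2]; split; exact: cont_meas. Qed.

Lemma ccont_cintg U a b : ccont U -> cintg `[a, b] U.
Proof. by move=> [h1 h2]; split; exact: intg_cont. Qed.

Lemma cintg_bdd E U a b C : measurable E -> E `<=` `[a, b] -> cmeas E U ->
  (forall s, E s -> nrm (U s) <= C) -> cintg E U.
Proof.
move=> mE Eab [h1 h2] UC; split.
  apply: (intg_bdd (a:=a) (b:=b) (C:=C)) => // s Es.
  exact: le_trans (Re_le_nrm _) (UC _ Es).
apply: (intg_bdd (a:=a) (b:=b) (C:=C)) => // s Es.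
exact: le_trans (Im_le_nrm _) (UC _ Es).
Qed.

Lemma ccontD U V : ccont U -> ccont V -> ccont (fun s => U s + V s).
Proof.
move=> [h1 h2] [h3 h4]; split => x.
  by under eq_fun do rewrite ReD; apply: cvgD; [exact: h1|exact: h3].
by under eq_fun do rewrite ImD; apply: cvgD; [exact: h2|exact: h4].
Qed.

Lemma ccontM U V : ccont U -> ccont V -> ccont (fun s => U s * V s).
Proof.
move=> [h1 h2] [h3 h4]; split => x.
  under eq_fun do rewrite ReM; apply: cvgB; apply: cvgM.
  + exact: h1. + exact: h3. + exact: h2. + exact: h4.
under eq_fun do rewrite ImM; apply: cvgD; apply: cvgM.
+ exact: h1. + exact: h4. + exact: h2. + exact: h3.
Qed.

Lemma ccontJ U : ccont U -> ccont (fun s => (U s)^*%C).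
Proof.
move=> [h1 h2]; split => x; first by under eq_fun do rewrite ReJ; exact: h1.
by under eq_fun do rewrite ImJ; apply: cvgN; exact: h2.
Qed.

Lemma ccont_cst (z : R[i]) : ccont (fun=> z).
Proof. by split => x; exact: cvg_cst. Qed.

Lemma ccont_real (u : R -> R) : continuous u -> ccont (fun s => (u s)%:C).
Proof. by move=> cu; split => // x; exact: cvg_cst. Qed.

Lemma ccont_nrm U : ccont U -> continuous (fun s => nrm (U s)).
Proof.
move=> [h1 h2] x; under eq_fun do rewrite nrmE.
apply: (@continuous_comp _ _ _ (fun s => complex.Re (U s) ^+ 2 + complex.Im (U s) ^+ 2)
  (@Num.sqrt R)); last exact: sqrt_continuous.
have E (v : R -> R) : continuous v -> v s ^+ 2 @[s --> x] --> v x ^+ 2.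
  by move=> cv; apply: cvgM; exact: cv.
by apply: cvgD; apply: E.
Qed.

Lemma cmeas_mul E U V : measurable E -> cmeas E U -> cmeas E V ->
  cmeas E (fun s => U s * V s).
Proof.
move=> mE [h1 h2] [h3 h4]; split.
  by under eq_fun do rewrite ReM; apply: measurable_funB; apply: measurable_funM.
by under eq_fun do rewrite ImM; apply: measurable_funD; apply: measurable_funM.
Qed.

Lemma cmeasD E U V : measurable E -> cmeas E U -> cmeas E V ->
  cmeas E (fun s => U s + V s).
Proof.
move=> mE [h1 h2] [h3 h4]; split.
  by under eq_fun do rewrite ReD; apply: measurable_funD.
by under eq_fun do rewrite ImD; apply: measurable_funD.
Qed.

Lemma cmeasJ E U : measurable E -> cmeas E U -> cmeas E (fun s => (U s)^*%C).
Proof.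
move=> mE [h1 h2]; split; first by under eq_fun do rewrite ReJ.
by under eq_fun do rewrite ImJ; apply: measurable_funN.
Qed.

Lemma cmeas_nrm E U : measurable E -> cmeas E U ->
  measurable_fun E (fun s => nrm (U s)).
Proof.
move=> mE [h1 h2]; under eq_fun do rewrite nrmE.
apply: (@measurableT_comp _ _ _ _ _ _ (@Num.sqrt R)).
  exact: measurable_realfun.continuous_measurable_fun (@sqrt_continuous R).
by apply: measurable_funD; apply: measurable_funX.
Qed.

Lemma cintgZ E U z : measurable E -> cintg E U -> cintg E (fun s => z * U s).
Proof.
move=> mE [h1 h2]; split.
  under eq_fun do rewrite ReM -mulNr; by apply: intg_D => //; exact: intg_Z.
by under eq_fun do rewrite ImM; apply: intg_D => //; exact: intg_Z.
Qed.

Lemma cint_ext E U V : (forall s, E s -> U s = V s) -> cintegral E U = cintegral E V.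
Proof.
by move=> UV; rewrite /cintegral; congr (_ +i* _); apply: II_ext => s Es; rewrite UV.
Qed.

Lemma cintD E U V : measurable E -> cintg E U -> cintg E V ->
  cintegral E (fun s => U s + V s) = cintegral E U + cintegral E V.
Proof.
move=> mE [h1 h2] [h3 h4]; apply: eq_complexP => /=.
  by under eq_fun do rewrite ReD; exact: II_D.
by under eq_fun do rewrite ImD; exact: II_D.
Qed.

Lemma cintZ E U z : measurable E -> cintg E U ->
  cintegral E (fun s => z * U s) = z * cintegral E U.
Proof.
move=> mE [h1 h2]; apply: eq_complexP; rewrite ?ReM ?ImM /=.
  under eq_fun do rewrite ReM -mulNr.
  by rewrite II_D ?II_Z ?mulNr //; exact: intg_Z.
under eq_fun do rewrite ImM.
by rewrite II_D ?II_Z //; exact: intg_Z.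
Qed.

Lemma cintB E U V : measurable E -> cintg E U -> cintg E V ->
  cintegral E (fun s => U s - V s) = cintegral E U - cintegral E V.
Proof.
move=> mE hU hV; rewrite -[in RHS]mulN1r -cintZ // -cintD //; last exact: cintgZ.
by congr cintegral; apply/funext => s; rewrite mulN1r.
Qed.

Lemma cintJ E U : measurable E -> cintg E U ->
  cintegral E (fun s => (U s)^*%C) = (cintegral E U)^*%C.
Proof.
move=> mE [h1 h2]; apply: eq_complexP; rewrite ?ReJ ?ImJ /=.
  by under eq_fun do rewrite ReJ.
under eq_fun do rewrite ImJ -mulN1r.
by rewrite II_Z // mulN1r.
Qed.

(** Multiplication by w commutes with the integral, so [nrm_dual] reduces the claim to the real
    parts of w U. *)
Lemma nrm_cint_le E U (v : R -> R) : measurable E -> cintg E U -> intg E v ->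
  (forall s, E s -> nrm (U s) <= v s) -> nrm (cintegral E U) <= II E v.
Proof.
move=> mE hU hv Uv; apply: nrm_dual => [|w].
  by apply: II_ge0 => s Es; exact: le_trans (nrm_ge0 _) (Uv _ Es).
rewrite -cintZ // -II_Z //=; apply: II_le => //.
- by have [] := cintgZ w mE hU.
- exact: intg_Z.
- move=> s Es; apply: le_trans (ler_norm _) _; apply: le_trans (Re_le_nrm _) _.
  by rewrite nrmM ler_wpM2l ?nrm_ge0 // Uv.
Qed.

Lemma cmeas_cvg E (U : nat -> R -> R[i]) (V : R -> R[i]) : measurable E ->
  (forall k, cmeas E (U k)) ->
  (forall s, E s -> (fun k => nrm (U k s - V s)) @ \oo --> (0 : R)) -> cmeas E V.
Proof.
move=> mE mU UV.
have cv (p : R[i] -> R) : (forall z w, `|p z - p w| <= nrm (z - w)) ->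
    forall s, E s -> (fun k => p (U k s)) @ \oo --> p (V s).
  move=> pl s Es; apply/cvgrPdist_le => e e0; have /cvgrPdist_le/(_ _ e0) := UV _ Es.
  apply: filterS => k; rewrite sub0r normrN ger0_norm ?nrm_ge0 //; apply: le_trans.
  by rewrite nrm_distC; exact: pl.
split.
  apply: (@meas_cvg _ _ (fun k s => complex.Re (U k s))) => // [k|]; first by have [] := mU k.
  by apply: (cv (@complex.Re R)) => z w; rewrite -ReN -ReD Re_le_nrm.
apply: (@meas_cvg _ _ (fun k s => complex.Im (U k s))) => // [k|]; first by have [] := mU k.
by apply: (cv (@complex.Im R)) => z w; rewrite -ImN -ImD Im_le_nrm.
Qed.

Lemma cint_ctsum E a b (U : nat -> R -> R[i]) C :
  measurable E -> E `<=` `[a, b] -> (forall k, cmeas E (U k)) ->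
  (forall s, E s -> bnd (fun k => nrm (U k s)) C) ->
  cmeas E (fun s => ctsum (U^~ s)) /\
  cintegral E (fun s => ctsum (U^~ s)) = ctsum (fun k => cintegral E (U k)).
Proof.
move=> mE Eab mU UC.
have [m1 _ e1] : [/\ measurable_fun E (fun s => tsum (fun k => complex.Re (U k s))),
   summ (fun k => II E (fun s => complex.Re (U k s))) &
   II E (fun s => tsum (fun k => complex.Re (U k s))) =
   tsum (fun k => II E (fun s => complex.Re (U k s)))].
  apply: (@int_tsum _ E a b (fun k s => complex.Re (U k s)) C) => //.
    by move=> k; case: (mU k).
  by move=> s Es; apply: bnd_le (UC _ Es) => k; exact: Re_le_nrm.
have [m2 _ e2] : [/\ measurable_fun E (fun s => tsum (fun k => complex.Im (U k s))),
   summ (fun k => II E (fun s => complex.Im (U k s))) &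
   II E (fun s => tsum (fun k => complex.Im (U k s))) =
   tsum (fun k => II E (fun s => complex.Im (U k s)))].
  apply: (@int_tsum _ E a b (fun k s => complex.Im (U k s)) C) => //.
    by move=> k; case: (mU k).
  by move=> s Es; apply: bnd_le (UC _ Es) => k; exact: Im_le_nrm.
by split => //; apply: eq_complexP.
Qed.

Lemma ccont_ctsum (U : nat -> R -> R[i]) (M : nat -> R) S :
  (forall k, ccont (U k)) -> (forall k s, nrm (U k s) <= M k) -> bnd M S ->
  ccont (fun s => ctsum (U^~ s)).
Proof.
move=> cU UM MS; split; apply: (@cont_tsum _ _ M S) => //.
- by move=> k; case: (cU k).
- by move=> k s; exact: le_trans (Re_le_nrm _) (UM _ _).
- by move=> k; case: (cU k).
- by move=> k s; exact: le_trans (Im_le_nrm _) (UM _ _).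
Qed.

End ComplexIntegrals.

(** * Fourier series on the torus *)

Definition nc (R : realType) : R := (Num.sqrt (2 * pi))^-1.

(** Fourier series with Hermitian coefficients: the terms n and -n are conjugate and add up to twice
    a real part. The zeroth term would be counted twice, so coefficients are recovered from this sum
    under the assumption a 0 = 0. *)
Definition synth (R : realType) (a : nat -> R[i]) (x : R) : R :=
  2 * nc R * tsum (fun k => complex.Re (a k * expi (k%:R * x))).

Section FourierBasics.
Variable R : realType.
Implicit Types (u v : R -> R) (x y t : R) (a b : nat -> R[i]).
Notation c := (nc R).
Notation D := (`[0, 2 * pi]%classic : set R).

Lemma pi2_ge0 : 0 <= 2 * pi :> R.
Proof. by rewrite mulr_ge0 // pi_ge0. Qed.

Lemma nc_gt0 : 0 < c.
Proof. by rewrite invr_gt0 sqrtr_gt0 mulr_gt0 // pi_gt0. Qed.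

Lemma nc_sqr : c * c * (2 * pi) = 1.
Proof.
have h := nc_gt0; rewrite /nc -expr2 exprVn sqr_sqrtr ?pi2_ge0 // mulVf //.
by rewrite mulf_neq0 // gt_eqF // pi_gt0.
Qed.

(** Since pi >= 2, c^2 = 1 / (2 pi) is at most 1 / 4. The resulting 2 c <= 1 is the only upper bound
    on the normalisation that enters the estimates. *)
Lemma nc_le : c <= 1 / 2.
Proof.
rewrite leNgt; apply/negP => h.
have h2 := nc_sqr; have p2 := @pi_ge2 R; have h3 := nc_gt0.
have : 1 / 4 < c * c by nra.
by move=> h4; nra.
Qed.

Lemma expiD x y : expi (x + y) = expi x * expi y.
Proof. by apply: eq_complexP; rewrite ?ReM ?ImM /= ?cosD ?sinD //; ring. Qed.

Lemma expi0 : expi (0 : R) = 1.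
Proof. by rewrite /expi cos0 sin0. Qed.

Lemma expiN x : expi (- x) = (expi x)^*%C.
Proof. by rewrite /expi cosN sinN. Qed.

Lemma nrm_expi x : nrm (expi x) = 1.
Proof. by rewrite nrmE /= cos2Dsin2 sqrtr1. Qed.

Lemma expi2pi : expi (2 * pi) = 1 :> R[i].
Proof. by rewrite /expi mulrC mulr_natr cos2pi sin2pi. Qed.

Lemma expi_nat2pi (k : nat) : expi (k%:R * (2 * pi)) = 1 :> R[i].
Proof.
elim: k => [|k IH]; first by rewrite mul0r expi0.
by rewrite -natr1 mulrDl mul1r expiD IH expi2pi mul1r.
Qed.

Lemma expi_int2pi (k : int) : expi (k%:~R * (2 * pi)) = 1 :> R[i].
Proof.
case: k => k; first by rewrite -pmulrn expi_nat2pi.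
by rewrite NegzE mulrNz mulNr expiN -pmulrn expi_nat2pi /= oppr0.
Qed.

Lemma ccont_expi (r : R) : ccont (fun x => expi (r * x)).
Proof.
have h x : (fun y : R => r * y) @ x --> r * x by exact: cvgMr.
split => x /=; apply: (@continuous_comp _ _ _ (fun y => r * y)).
- exact: h. - exact: continuous_cos. - exact: h. - exact: continuous_sin.
Qed.

Lemma mD : measurable D.
Proof. exact: measurable_itv. Qed.

Lemma is_derive_lin (k x : R) : is_derive x 1 (fun y => k * y) k.
Proof.
have := is_deriveZ k (is_derive_id x (1 : R)).
by rewrite /GRing.scale /= mulr1.
Qed.

Lemma is_derive_sinl (k x : R) :
  is_derive x 1 (fun y => sin (k * y)) (cos (k * x) * k).
Proof.
exact: (@is_derive1_comp R sin (fun y => k * y) x _ _ (is_derive_sin _) (is_derive_lin k x)).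
Qed.

Lemma is_derive_cosl (k x : R) :
  is_derive x 1 (fun y => cos (k * y)) (- sin (k * x) * k).
Proof.
exact: (@is_derive1_comp R cos (fun y => k * y) x _ _ (is_derive_cos _) (is_derive_lin k x)).
Qed.

Lemma cint_expi (k : R) t : k != 0 -> 0 <= t ->
  cintegral `[0, t] (fun x => expi (k * x)) =
  (sin (k * t) / k) +i* ((1 - cos (k * t)) / k).
Proof.
move=> k0 t0; have [h1 h2] := ccont_expi k.
rewrite /cintegral /=; congr (_ +i* _).
  apply: etrans (@II_FTC2 R 0 t _ (fun x => k^-1 * sin (k * x)) t0 _ _) _.
  - exact: contI_cont.
  - move=> x _; have := is_deriveZ k^-1 (is_derive_sinl k x).
    by rewrite /GRing.scale /= mulrCA mulVf // mulr1.
  - by rewrite mulr0 sin0 mulr0 subr0 mulrC.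
apply: etrans (@II_FTC2 R 0 t _ (fun x => (- k^-1) * cos (k * x)) t0 _ _) _.
- exact: contI_cont.
- move=> x _; have := is_deriveZ (- k^-1) (is_derive_cosl k x).
  by rewrite /GRing.scale /= !mulNr mulrN opprK mulrCA mulVf // mulr1.
- by rewrite mulr0 cos0; field.
Qed.

Lemma cint_cst (z : R[i]) : cintegral D (fun=> z) = (2 * pi)%:C * z.
Proof.
rewrite /cintegral !II_cst ?pi2_ge0 //.
by apply: eq_complexP; rewrite ?ReM ?ImM /=; ring.
Qed.

Lemma cint_expi_int (k : int) :
  cintegral D (fun x => expi (k%:~R * x)) = if k == 0 then (2 * pi)%:C else 0.
Proof.
case: eqP => [->|/eqP k0].
  rewrite (_ : (fun x => _) = fun=> 1); last first.
    by apply/funext => x; rewrite mulr0z mul0r expi0.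
  by rewrite cint_cst mulr1.
rewrite cint_expi ?pi2_ge0 ?intr_eq0 //.
have := expi_int2pi k; rewrite /expi => -[-> ->].
by rewrite subrr !mul0r.
Qed.

Definition fker u (n : int) x : R[i] := (u x)%:C * expi (- (n%:~R * x)).

Lemma fourierE u n : fourier u n = c%:C * cintegral D (fker u n).
Proof. by []. Qed.

Lemma ccont_fker u n : continuous u -> ccont (fker u n).
Proof.
move=> cu; apply: ccontM; first exact: ccont_real.
by under eq_fun do rewrite -mulNr; exact: ccont_expi.
Qed.

Lemma cintg_fker u n : continuous u -> cintg D (fker u n).
Proof. by move=> cu; apply: ccont_cintg; exact: ccont_fker. Qed.

Lemma fourier_ext u v n : (forall x, 0 <= x <= 2 * pi -> u x = v x) ->
  fourier u n = fourier v n.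
Proof.
move=> uv; rewrite !fourierE; congr (_ * _); apply: cint_ext => x /=.
by rewrite in_itv /= => /uv; rewrite /fker => ->.
Qed.

Lemma fourierD u v n : continuous u -> continuous v ->
  fourier (fun x => u x + v x) n = fourier u n + fourier v n.
Proof.
move=> cu cv; rewrite !fourierE -mulrDr -cintD; [|exact: mD|exact: cintg_fker..].
by congr (_ * _); apply: cint_ext => x _; rewrite /fker rmorphD /= mulrDl.
Qed.

Lemma fourierZ u (r : R) n : continuous u ->
  fourier (fun x => r * u x) n = r%:C * fourier u n.
Proof.
move=> cu; rewrite !fourierE mulrCA -(@cintZ _ D (fker u n));
  [|exact: mD|exact: cintg_fker].
by congr (_ * _); apply: cint_ext => x _; rewrite /fker rmorphM /= mulrA.
Qed.

Lemma fourierN u n : continuous u ->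
  fourier u (- n) = (fourier u n)^*%C.
Proof.
move=> cu; rewrite !fourierE conjM -cintJ; [|exact: mD|exact: cintg_fker].
congr (_ * _); first by rewrite /= oppr0.
apply: cint_ext => x _; rewrite /fker conjM mulrNz mulNr opprK expiN.
congr (_ * _); first by rewrite /= oppr0.
by case: (expi _) => p q /=; rewrite opprK.
Qed.

Lemma ctsum_single (n : nat) (z : R[i]) :
  ctsum (fun k => if k == n then z else 0) = z.
Proof.
have h (r : R) : tsum (fun k => if k == n then r else 0) = r.
  apply: tsum_eq; apply: cvg_near_cst; exists n.+1 => // N /= nN.
  have hn : (n < N)%N by [].
  rewrite (bigD1 (Ordinal hn)) //= eqxx big1 ?addr0 // => i /eqP hi.
  by case: eqP => // ei; case: hi; exact/val_inj.
apply: eq_complexP => /=; rewrite -[RHS]h; congr tsum; apply/funext => k;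
  by case: eqP.
Qed.

Lemma cont_bounded u (p q : R) : continuous u ->
  exists B : R, 0 <= B /\ forall x, p <= x <= q -> `|u x| <= B.
Proof.
move=> cu; have [qp|pq] := ltP q p.
  by exists 0; split => // x /andP[h1 h2]; have := le_trans h1 h2; rewrite leNgt qp.
have [x _ hx] : exists2 x, x \in `[p, q] & forall t, t \in `[p, q] -> `|u t| <= `|u x|.
  apply: EVT_max => //; apply: continuous_subspaceT => y.
  by apply: cvg_norm; exact: cu.
by exists `|u x|; split => // y hy; apply: hx; rewrite in_itv.
Qed.

(** Termwise integration: on one period the k-th integrand is at most B M_k, where B bounds |u|
    there. *)
Lemma fourier_mul_tsum u (v : nat -> R -> R) (M : nat -> R) S n :
  continuous u -> (forall k, continuous (v k)) ->
  (forall k x, `|v k x| <= M k) -> bnd M S ->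
  fourier (fun x => u x * tsum (v^~ x)) n =
  ctsum (fun k => fourier (fun x => u x * v k x) n) /\
  summ (fun k => nrm (fourier (fun x => u x * v k x) n)).
Proof.
move=> cu cv vM MS.
have [B [B0 uB]] := cont_bounded 0 (2 * pi) cu.
have cuv k : continuous (fun x => u x * v k x).
  by move=> x; apply: cvgM; [exact: cu|exact: cv].
have fb k x : D x -> nrm (fker (fun x => u x * v k x) n x) <= B * M k.
  move=> Dx; have hx : 0 <= x <= 2 * pi by move: Dx; rewrite /= in_itv.
  have -> : fker (fun x => u x * v k x) n x =
    (u x * v k x)%:C * expi (- (n%:~R * x)) by [].
  rewrite nrmM nrm_expi mulr1 nrm_real normrM.
  by apply: ler_pM => //; exact: uB.
have su : summ (fun k => nrm (cintegral D (fker (fun x => u x * v k x) n))).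
  apply: (@csumm_le _ _ (fun k => (B * M k) * (2 * pi)) (B * S * (2 * pi))).
    move=> k; rewrite -(II_cst (B * M k) pi2_ge0); apply: nrm_cint_le.
    - exact: mD.
    - exact: cintg_fker.
    - by apply: intg_cont => x; exact: cvg_cst.
    - by move=> x; exact: fb.
  under eq_fun do rewrite mulrC mulrA; rewrite [_ * (2 * pi)]mulrC mulrA.
  by apply: bndZ => //; rewrite mulr_ge0 // pi2_ge0.
split; last by under eq_fun do rewrite fourierE; exact: csummZ.
rewrite fourierE -[RHS]/(ctsum (fun k => c%:C * cintegral D (fker (fun x => u x * v k x) n))).
rewrite ctsumZ //; congr (_ * _).
have sv x : summ (v^~ x) by apply: summ_le MS => k; exact: vM.
have -> : cintegral D (fker (fun x => u x * tsum (v^~ x)) n) =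
    cintegral D (fun x => ctsum (fun k => fker (fun x => u x * v k x) n x)).
  apply: cint_ext => x _; rewrite /fker.
  have -> : (fun k => (u x * v k x)%:C * expi (- (n%:~R * x))) =
     (fun k => ((u x)%:C * expi (- (n%:~R * x))) * (v k x)%:C).
    by apply/funext => k; rewrite rmorphM /=; ring.
  rewrite ctsumZ; last first.
    apply: (csumm_le _ MS) => k; rewrite nrm_real; exact: vM.
  rewrite rmorphM /= mulrAC; congr (_ * _).
  by rewrite /ctsum /= tsum0.
have [] // := @cint_ctsum R D 0 (2 * pi) (fun k => fker (fun x => u x * v k x) n) (B * S).
- by move=> k; apply: ccont_cmeas; [exact: mD|exact: ccont_fker].
- move=> x Dx; apply: (@bnd_le _ _ (fun k => B * M k)); first by move=> k; exact: fb.
  exact: bndZ.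
Qed.

Definition mode (z : R[i]) (k : nat) x : R := complex.Re (z * expi (k%:R * x)).

Lemma ccont_mode z k : ccont (fun x => z * expi (k%:R * x)).
Proof. by apply: ccontM; [exact: ccont_cst|exact: ccont_expi]. Qed.

Lemma cont_mode z k : continuous (mode z k).
Proof. by have [] := ccont_mode z k. Qed.

Lemma mode_le z k x : `|mode z k x| <= nrm z.
Proof. by apply: le_trans (Re_le_nrm _) _; rewrite nrmM nrm_expi mulr1. Qed.

(** Re (z e^(ikx)) has the frequencies k and -k; against e^(-inx) with n >= 0 the second one
    integrates to 0 because k + n > 0. The factor 1 / (2 c) cancels the 2 c in [synth]. *)
Lemma fourier_mode z (k n : nat) : (0 < k)%N ->
  fourier (mode z k) n = if k == n then ((2 * c)^-1)%:C * z else 0.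
Proof.
move=> k0; rewrite fourierE.
have -> : cintegral D (fker (mode z k) n) = cintegral D (fun x =>
   (2^-1%:C * z) * expi ((k%:Z - n%:Z)%:~R * x) +
   (2^-1%:C * z^*%C) * expi ((- (k%:Z + n%:Z))%:~R * x)).
  apply: cint_ext => x _; rewrite /fker /mode.
  have -> : ((k%:Z - n%:Z)%:~R * x : R) = k%:R * x + - (n%:~R * x).
    by rewrite rmorphB /= mulrBl.
  have -> : ((- (k%:Z + n%:Z))%:~R * x : R) = - (k%:R * x) + - (n%:~R * x).
    by rewrite mulrNz rmorphD /= mulNr mulrDl opprD.
  rewrite !expiD (expiN (k%:R * x)) !mulrA -mulrDl; congr (_ * _).
  case: z => p q; case: (expi _) => p' q'.
  by apply: eq_complexP; rewrite !ReImE /=; field.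
have ce (m : int) : cintg D (fun x => expi (m%:~R * x) : R[i]).
  by apply: ccont_cintg; exact: ccont_expi.
rewrite cintD; [|exact: mD|apply: cintgZ => //; exact: mD..].
rewrite !cintZ //; [|exact: mD..].
rewrite !cint_expi_int.
have -> : (- (k%:Z + n%:Z) == 0) = false.
  by rewrite oppr_eq0 -PoszD eqz_nat; case: (k) k0.
rewrite subr_eq0 eqz_nat mulr0 addr0; case: eqP => _; last by rewrite !mulr0.
have h := nc_sqr; have h1 := nc_gt0.
have -> : (2 * c)^-1 = c * (2^-1 * (2 * pi)).
  have hc : 2 * c != 0 by rewrite mulf_neq0 // gt_eqF.
  by apply: (mulfI hc); rewrite divff // -[LHS]h; field.
by rewrite !rmorphM /=; ring.
Qed.

Section Synth.
Variables (a : nat -> R[i]) (S : R).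
Hypothesis aS : bnd (fun k => nrm (a k)) S.

Lemma summ_mode x : summ (fun k => mode (a k) k x).
Proof. by apply: (summ_le _ aS) => k; exact: mode_le. Qed.

Lemma synthE x : synth a x = 2 * c * tsum (fun k => mode (a k) k x).
Proof. by []. Qed.

Lemma cont_synth : continuous (synth a).
Proof.
move=> x; apply: cvgMr; apply: (@cont_tsum _ (fun k => mode (a k) k) (fun k => nrm (a k)) S) => //.
- by move=> k; exact: cont_mode.
- by move=> k s; exact: mode_le.
Qed.

Lemma periodic_synth : periodic (synth a) (2 * pi).
Proof.
move=> x; rewrite !synthE; congr (_ * tsum _); apply/funext => k.
by rewrite /mode mulrDr expiD expi_nat2pi mulr1.
Qed.

Hypothesis a0 : a 0%N = 0.

Lemma fourier_synth (n : nat) : fourier (synth a) n = a n.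
Proof.
have -> : fourier (synth a) n = fourier (fun x => (fun=> 2 * c) x * tsum (fun k => mode (a k) k x)) n.
  by [].
have [-> _] := @fourier_mul_tsum (fun=> 2 * c) (fun k => mode (a k) k) (fun k => nrm (a k)) S n
  (fun x => cvg_cst _) (fun k => @cont_mode (a k) k) (fun k x => mode_le _ _ _) aS.
rewrite -[RHS](ctsum_single n); apply: eq_ctsum => k.
rewrite fourierZ; last exact: cont_mode.
have h1 := nc_gt0.
have [k0|k0] := posnP k.
  rewrite k0 a0 (_ : mode 0 0 = (fun x => 0 * (fun=> 0) x)); last first.
    by apply/funext => x; rewrite /mode !mul0r.
  rewrite fourierZ; last by move=> x; exact: cvg_cst.
  by rewrite mul0r mulr0; case: eqP => // <-; rewrite a0.
rewrite fourier_mode //; case: eqP => [<-|]; last by rewrite mulr0.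
rewrite mulrA -rmorphM /= divff ?mul1r //.
by rewrite mulf_neq0 // gt_eqF.
Qed.

Lemma synth_mean0 : II D (synth a) = 0.
Proof.
have := fourier_synth 0; rewrite a0 fourierE => /(congr1 (@complex.Re R)).
rewrite ReM /= mul0r subr0 => /eqP; rewrite mulf_eq0 gt_eqF ?nc_gt0 //= => /eqP h.
rewrite -[RHS]h; apply: II_ext => x _.
by rewrite mulr0z !mul0r oppr0 cos0 mulr1 addr0.
Qed.

Lemma fourier_sum_synth (U : int -> R[i]) x :
  (forall k : nat, U k = a k) -> (forall k : nat, U (- k%:Z) = (a k)^*%C) ->
  fourier_sum U x = synth a x.
Proof.
move=> Ua UN; rewrite /fourier_sum.
suff h : (fun N : nat => (Num.sqrt (2 * pi))^-1 *
    (complex.Re (U 0) + \sum_(1 <= k < N.+1)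
      complex.Re (U k%:Z * expi (k%:R * x) +
                  U (- k%:Z) * expi (- (k%:R * x))))) @ \oo --> synth a x.
  by apply/cvg_lim.
have -> : (fun N : nat => (Num.sqrt (2 * pi))^-1 *
    (complex.Re (U 0) + \sum_(1 <= k < N.+1)
      complex.Re (U k%:Z * expi (k%:R * x) +
                  U (- k%:Z) * expi (- (k%:R * x))))) =
  (fun N : nat => 2 * c * (\sum_(k < N.+1) mode (a k) k x)).
  apply/funext => N; rewrite (Ua 0%N) a0 add0r big_ord_recl /= {1}/mode a0 mul0r add0r.
  rewrite big_add1 big_mkord mulr_sumr mulr_sumr; apply: eq_bigr => k _.
  rewrite Ua UN /mode !ReImE expiN /bump /= add1n.
  by rewrite /= /nc; ring.
apply: cvgMr; have := summ_cvg (summ_mode x).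
by rewrite -(cvg_shiftS (fun N => \sum_(k < N) mode (a k) k x)).
Qed.

End Synth.
End FourierBasics.

(** * Inversion, nonlinearity and Wiener norms *)

Section FourierInversion.
Variable R : realType.
Implicit Types (u v : R -> R) (x y t : R) (a b : nat -> R[i]).
Notation c := (nc R).
Notation D := (`[0, 2 * pi]%classic : set R).

(** Multiplication by cos (x - x0) shifts frequencies by one in each direction, so it preserves the
    vanishing of all Fourier coefficients. *)
Lemma fourier_mul_cos u (x0 : R) : continuous u -> (forall n, fourier u n = 0) ->
  forall n, fourier (fun x => u x * cos (x - x0)) n = 0.
Proof.
move=> cu u0 n.
have nc0 : c%:C != 0 :> R[i].
  by apply/negP => /eqP [] h; have := nc_gt0 R; rewrite h ltxx.
have I0 m : cintegral D (fker u m) = 0.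
  by have /eqP := u0 m; rewrite fourierE mulf_eq0 (negbTE nc0) /= => /eqP.
rewrite fourierE.
have -> : cintegral D (fker (fun x => u x * cos (x - x0)) n) =
  cintegral D (fun x => (2^-1%:C * expi (- x0)) * fker u (n - 1) x +
                        (2^-1%:C * expi x0) * fker u (n + 1) x).
  apply: cint_ext => x _; rewrite /fker.
  have -> : - ((n - 1)%:~R * x) = - (n%:~R * x) + x by rewrite rmorphB /=; ring.
  have -> : - ((n + 1)%:~R * x) = - (n%:~R * x) + - x by rewrite rmorphD /=; ring.
  rewrite !expiD !expiN.
  by apply: eq_complexP; rewrite !ReImE /= cosB; field.
rewrite cintD; [|exact: mD|apply: cintgZ; [exact: mD|exact: cintg_fker]..].
rewrite (cintZ _ (@mD R) (cintg_fker (n - 1) cu)).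
by rewrite (cintZ _ (@mD R) (cintg_fker (n + 1) cu)) !I0 !mulr0 addr0 mulr0.
Qed.

(** The factor is a localising trigonometric polynomial: its base exceeds 1 within distance d of x0
    and lies in [-1, 1] on the rest of the period. *)
Lemma fourier_kernel u (x0 d : R) N : continuous u -> (forall n, fourier u n = 0) ->
  continuous (fun x => u x * (1 + cos (x - x0) - cos d) ^+ N) /\
  forall n, fourier (fun x => u x * (1 + cos (x - x0) - cos d) ^+ N) n = 0.
Proof.
move=> cu u0.
have cc : continuous (fun x : R => cos (x - x0)).
  move=> x; apply: (@continuous_comp _ _ _ (fun y : R => y - x0) cos); last exact: continuous_cos.
  by apply: cvgB; [exact: cvg_id|exact: cvg_cst].
elim: N => [|N [cN IH]].
  by under eq_fun do rewrite expr0 mulr1.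
have cp : continuous (fun x => u x * (1 + cos (x - x0) - cos d) ^+ N * cos (x - x0)).
  by move=> x; apply: cvgM; [exact: cN|exact: cc].
have cz : continuous (fun x => (1 - cos d) * (u x * (1 + cos (x - x0) - cos d) ^+ N)).
  by move=> x; apply: cvgMr; exact: cN.
have -> : (fun x => u x * (1 + cos (x - x0) - cos d) ^+ N.+1) =
  (fun x => (1 - cos d) * (u x * (1 + cos (x - x0) - cos d) ^+ N) +
            u x * (1 + cos (x - x0) - cos d) ^+ N * cos (x - x0)).
  by apply/funext => x; rewrite exprS; ring.
split; first by move=> x; apply: cvgD; [exact: cz|exact: cp].
by move=> n; rewrite fourierD // fourierZ // IH mulr0 add0r fourier_mul_cos.
Qed.

Lemma bernoulli_ineq (r : R) N : 0 <= r -> 1 + N%:R * r <= (1 + r) ^+ N.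
Proof.
move=> r0; elim: N => [|N IH]; first by rewrite mul0r addr0 expr0.
rewrite exprS -natr1; have hn : 0 <= N%:R * (r * r) by rewrite !mulr_ge0.
have : (1 + r) * (1 + N%:R * r) <= (1 + r) * (1 + r) ^+ N by rewrite ler_wpM2l ?addr_ge0.
by apply: le_trans; lra.
Qed.

Lemma cos_norm x : cos `|x| = cos x.
Proof. by case: (ler0P x) => // _; rewrite cosN. Qed.

Lemma le_cos x y : 0 <= x -> x <= y -> y <= pi -> cos y <= cos x.
Proof.
move=> x0 xy yp; rewrite leNgt ltr_cos ?in_itv /= -?leNgt //.
  by rewrite yp (le_trans x0).
by rewrite x0 (le_trans xy).
Qed.

(** If u x0 > 0, the integral of u q^N over a period vanishes for every N, although its part near x0
    grows like (1 + r)^N and its part away from x0 stays bounded. *)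
Lemma fourier_inj_pos u x0 : continuous u -> (forall n, fourier u n = 0) ->
  0 < x0 < 2 * pi -> u x0 <= 0.
Proof.
move=> cu u0 /andP[x00 x02]; rewrite leNgt; apply/negP => ux0.
have e0 : 0 < u x0 / 2 by rewrite divr_gt0.
set e := u x0 / 2 in e0.
have /cvgrPdist_lt /(_ e e0) [d1 /= d10 hd1] := cu x0.
(* The bound d1 / 2 keeps u >= e within distance d of x0; the other two keep that interval inside
   the period and force d <= pi. *)
pose d := Num.min (d1 / 2) (Num.min x0 (2 * pi - x0)).
have d0 : 0 < d by rewrite !lt_min divr_gt0 //= x00 /= subr_gt0.
have dd1 : d <= d1 / 2 by rewrite ge_min lexx.
have dx0 : d <= x0 by rewrite !ge_min lexx !orbT.
have d2x : d <= 2 * pi - x0 by rewrite !ge_min lexx !orbT.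
have ue x : `|x - x0| <= d -> e <= u x.
  move=> hx; have : `|x0 - x| < d1 by rewrite distrC; lra.
  by move=> /hd1 /ltr_normlP[]; rewrite /e; lra.
have dpi : d <= pi by lra.
have p0 : 0 < (pi : R) by exact: pi_gt0.
pose q x := 1 + cos (x - x0) - cos d.
have q_in x : `|x - x0| <= d / 2 -> 1 + (cos (d / 2) - cos d) <= q x.
  move=> hx; rewrite /q.
  have : cos (d / 2) <= cos (x - x0); last by lra.
  rewrite -(cos_norm (x - x0)); apply: le_cos => //; lra.
have q_mid x : `|x - x0| <= d -> 0 <= q x.
  move=> hx; have : -1 <= cos (x - x0) := cos_geN1 _.
  have := cos_le1 d; rewrite /q.
  have : cos d <= cos (x - x0); last by lra.
  by rewrite -(cos_norm (x - x0)); apply: le_cos.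
have q_out x : 0 <= x <= 2 * pi -> d <= `|x - x0| -> `|q x| <= 1.
  move=> /andP[h1 h2] hx.
  have : cos (x - x0) <= cos d.
    rewrite -(cos_norm (x - x0)).
    have h3 : `|x - x0| <= 2 * pi - d by rewrite ler_norml; apply/andP; split; lra.
    have [hp|hp] := lerP `|x - x0| pi; first by apply: le_cos => //; exact: ltW.
    have -> : cos `|x - x0| = cos (2 * pi - `|x - x0|).
      by rewrite cosB (_ : 2 * pi = pi *+ 2) ?mulr_natl // cos2pi sin2pi; ring.
    by apply: le_cos; [exact: ltW|lra|lra].
  have := cos_geN1 (x - x0); have := cos_le1 d; rewrite /q ler_norml => *.
  by apply/andP; split; lra.
have r0 : 0 < cos (d / 2) - cos d.
  by rewrite subr_gt0 ltr_cos ?in_itv /=; [lra|apply/andP; split; lra..].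
have [B [B0 uB]] := cont_bounded 0 (2 * pi) cu.
set r := cos (d / 2) - cos d in r0 q_in.
have key N : e * (1 + r) ^+ N * d <= B * (2 * pi).
  have [cN fN] := fourier_kernel x0 d N cu u0.
  have I0 : II D (fun x => u x * q x ^+ N) = 0.
    have := fN 0; rewrite fourierE => /(congr1 (@complex.Re R)).
    rewrite ReM /= mul0r subr0 => /eqP; rewrite mulf_eq0 gt_eqF ?nc_gt0 //= => /eqP h.
    rewrite -[RHS]h; apply: II_ext => x _.
    by rewrite mulr0z !mul0r oppr0 cos0 mulr1 addr0.
  have cB : continuous (fun _ : R => B) by move=> x; exact: cvg_cst.
  (* Adding the constant B makes the integrand nonnegative on the whole period: beyond distance d,
     |u q^N| <= B. The total then dominates the integral over the half-size interval around x0. *)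
  have -> : B * (2 * pi) = II D (fun x => u x * q x ^+ N + B).
    rewrite II_D; [|exact: mD|exact: intg_cont|exact: intg_cont].
    by rewrite I0 add0r II_cst // pi2_ge0.
  have ms : measurable (`[x0 - d / 2, x0 + d / 2]%classic : set R) by exact: measurable_itv.
  have -> : e * (1 + r) ^+ N * d = II `[x0 - d / 2, x0 + d / 2] (fun=> e * (1 + r) ^+ N).
    by rewrite II_cst_itv; [congr (_ * _)|]; lra.
  have cF : continuous (fun x => u x * q x ^+ N + B).
    by move=> x; apply: cvgD; [exact: cN|exact: cB].
  apply: (@le_trans _ _ (II `[x0 - d / 2, x0 + d / 2] (fun x => u x * q x ^+ N + B))).
    apply: II_le => //.
    - by apply: intg_cont => x; exact: cvg_cst.
    - exact: intg_cont.
    - move=> x /=; rewrite in_itv /= => /andP[h1 h2].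
      have h3 : `|x - x0| <= d / 2 by rewrite ler_norml; apply/andP; split; lra.
      have h4 : e <= u x by apply: ue; lra.
      have : e * (1 + r) ^+ N <= u x * q x ^+ N; last by lra.
      apply: ler_pM => //; [exact: ltW|by rewrite exprn_ge0 //; lra|].
      by apply: lerXn2r; rewrite ?nnegrE; [lra|have := q_in _ h3; lra|exact: q_in].
  apply: II_sub => //; [|exact: intg_cont|].
    by move=> x /=; rewrite !in_itv /= => /andP[h1 h2]; apply/andP; split; lra.
  move=> x /=; rewrite in_itv /= => hx.
  have [h|h] := lerP `|x - x0| d.
    by rewrite addr_ge0 // mulr_ge0 //; [have := ue _ h; lra|rewrite exprn_ge0 ?q_mid].
  have h1 := q_out _ hx (ltW h).
  have : `|u x * q x ^+ N| <= B * 1.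
    rewrite normrM; apply: ler_pM => //; first exact: uB.
    by rewrite normrX exprn_ile1.
  by rewrite mulr1 ler_norml => /andP[]; lra.
have ed : 0 < e * r * d by rewrite !mulr_gt0.
(* With N above this ratio, the linear lower bound of (1 + r)^N from Bernoulli's inequality already
   contradicts [key]. *)
have /archi_boundP : 0 <= B * (2 * pi) / (e * r * d).
  by rewrite divr_ge0 ?mulr_ge0 // ?pi_ge0 // ltW.
set N := Num.Def.archi_bound _; rewrite ltr_pdivrMr // => hN.
have := key N; have := @bernoulli_ineq r N (ltW r0) => h1.
have h2 : e * (1 + N%:R * r) * d <= e * (1 + r) ^+ N * d.
  by rewrite ler_pM2r // ler_pM2l.
have h3 : 0 < e * d by rewrite mulr_gt0.
by move=> h4; have := le_trans h2 h4; lra.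
Qed.

Lemma periodic_int u (k : int) x : periodic u (2 * pi) ->
  u (x + k%:~R * (2 * pi)) = u x.
Proof.
move=> pu; case: k => k.
  by rewrite -[RHS](periodicn pu k) -pmulrn -(mulr_natl (2 * pi) k).
rewrite NegzE mulrNz mulNr -pmulrn.
by rewrite -(periodicn pu k.+1) -(mulr_natl (2 * pi) k.+1) subrK.
Qed.

(** The one-sided result, applied to u and to -u, covers the open period; the endpoint follows by
    continuity from the right and all other points by periodicity. *)
Lemma fourier_inj u : continuous u -> periodic u (2 * pi) ->
  (forall n, fourier u n = 0) -> forall x, u x = 0.
Proof.
move=> cu pu u0.
have h1 x : 0 < x < 2 * pi -> u x = 0.
  move=> hx; apply/eqP; rewrite eq_le fourier_inj_pos //= -oppr_le0.
  apply: (@fourier_inj_pos (fun x => - u x)) => //.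
    by move=> y; apply: cvgN; exact: cu.
  move=> n; have -> : (fun x => - u x) = (fun x => -1 * u x).
    by apply/funext => y; rewrite mulN1r.
  by rewrite fourierZ // u0 mulr0.
have p0 : 0 < 2 * pi :> R by rewrite mulr_gt0 // pi_gt0.
have h0 : u 0 = 0.
  have c0 : u x @[x --> 0^'+] --> u 0 by apply: cvg_at_right_filter; exact: cu.
  have c1 : u x @[x --> 0^'+] --> (0 : R).
    apply: cvg_near_cst; near=> x; apply: h1; apply/andP; split => //.
  by have := cvg_unique _ c0 c1; apply.
move=> x.
pose k := Num.floor (x / (2 * pi)).
have -> : u x = u (x - k%:~R * (2 * pi)).
  by rewrite -[in RHS](periodic_int k) // subrK.
have h2 : k%:~R <= x / (2 * pi) by exact: floor_le_tmp.
have h3 : x / (2 * pi) < (k + 1)%:~R by exact: floorD1_gt.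
have : 0 <= x - k%:~R * (2 * pi) by rewrite subr_ge0 -ler_pdivlMr.
have h4 : x - k%:~R * (2 * pi) < 2 * pi.
  by move: h3; rewrite ltr_pdivrMr // rmorphD /=; lra.
rewrite le_eqVlt => /predU1P[<- //|h5]; apply: h1; exact/andP.
Unshelve. all: by end_near.
Qed.

(** The difference of the two sides is continuous and periodic with vanishing Fourier
    coefficients. *)
Lemma fourier_expand u S : continuous u -> periodic u (2 * pi) -> fourier u 0 = 0 ->
  bnd (fun k => nrm (fourier u k)) S ->
  forall x, u x = synth (fun k => fourier u k) x.
Proof.
move=> cu pu u0 uS x; have cs := cont_synth uS.
apply/eqP; rewrite -subr_eq0; apply/eqP.
apply: (@fourier_inj (fun x => u x - synth (fun k => fourier u k) x)).
- by move=> y; apply: cvgB; [exact: cu|exact: cs].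
- by move=> y; rewrite pu periodic_synth.
- have h (n : nat) : fourier (fun x => u x - synth (fun k => fourier u k) x) n = 0.
    have -> : (fun x => u x - synth (fun k => fourier u k) x) =
      (fun x => u x + -1 * synth (fun k => fourier u k) x).
      by apply/funext => y; rewrite mulN1r.
    rewrite fourierD //; last by move=> y; apply: cvgMr; exact: cs.
    by rewrite fourierZ // (fourier_synth uS) // rmorphN1 mulN1r subrr.
  case=> n //; rewrite NegzE fourierN ?h //; first by rewrite /= oppr0.
  by move=> y; apply: cvgB; [exact: cu|exact: cs].
Qed.

End FourierInversion.

(** * The nonlinearity in Fourier coefficients *)

Section Nonlinearity.
Variable R : realType.
Implicit Types (u v : R -> R) (x y t : R) (a b : nat -> R[i]).
Notation c := (nc R).
Notation D := (`[0, 2 * pi]%classic : set R).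

Lemma is_derive_mode (z : R[i]) (k : nat) x :
  is_derive x 1 (mode z k) (mode ((0 +i* k%:R) * z) k x).
Proof.
have := is_deriveB (is_deriveZ (complex.Re z) (is_derive_cosl k%:R x))
  (is_deriveZ (complex.Im z) (is_derive_sinl k%:R x)).
have -> : (complex.Re z \*: (fun y => cos (k%:R * y)) -
   complex.Im z \*: (fun y => sin (k%:R * y))) = mode z k.
  by apply/funext => y; rewrite /mode ReM.
have -> : mode ((0 +i* k%:R) * z) k x = complex.Re z *: (- sin (k%:R * x) * k%:R) -
    complex.Im z *: (cos (k%:R * x) * k%:R).
  by rewrite /mode !ReImE /= /GRing.scale /=; ring.
exact.
Qed.

(** The series of derivatives converges uniformly and may be integrated term by term; this gives
    back the original series up to a constant, which is therefore a primitive of a continuous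
    function. *)
Lemma is_derive_synth a S x : bnd (fun k => nrm (a k)) S ->
  bnd (fun k => nrm ((0 +i* k%:R) * a k)) S ->
  is_derive x 1 (synth a) (synth (fun k => (0 +i* k%:R) * a k) x).
Proof.
move=> aS bS; set b := fun k => (0 +i* k%:R) * a k.
have cb := cont_synth bS.
(* Starting at x - 2 makes F differentiable on the closed interval from x - 1, including its left
   end. *)
have [F hF] := prim (x - 2) cb.
have tw y : x - 1 <= y -> II `[x - 1, y] (synth b) = synth a y - synth a (x - 1).
  move=> xy.
  have mE : measurable (`[x - 1, y]%classic : set R) by exact: measurable_itv.
  have [_ _ h] := @int_tsum R `[x - 1, y] (x - 1) y (fun k => mode (b k) k) S mE
     (fun _ => id) (fun k => cont_meas mE (@cont_mode R (b k) k))
     (fun s _ => bnd_le (fun k => @mode_le R (b k) k s) bS).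
  have it : intg `[x - 1, y] (fun s => tsum (fun k => mode (b k) k s)).
    apply: intg_cont; apply: (@cont_tsum _ (fun k => mode (b k) k) (fun k => nrm (b k)) S) => //.
    - by move=> k; exact: cont_mode.
    - by move=> k s; exact: mode_le.
  rewrite !synthE -mulrBr.
  rewrite -(tsumB (@summ_mode R a S aS y) (@summ_mode R a S aS (x - 1))).
  rewrite II_Z // h; congr (_ * tsum _); apply/funext => k.
  apply: II_FTC2 => //; first by apply: contI_cont; exact: cont_mode.
  by move=> s _; exact: is_derive_mode.
have eF y : x - 1 <= y -> synth a y = F y + (synth a (x - 1) - F (x - 1)).
  move=> xy; have e : II `[x - 1, y] (synth b) = F y - F (x - 1).
    apply: II_FTC2 => //; first exact: contI_cont.
    by move=> s /andP[h1 _]; apply: hF; lra.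
  by have := tw y xy; rewrite e; lra.
have dF : is_derive x 1 (F + cst (synth a (x - 1) - F (x - 1))) (synth b x + 0).
  by apply: is_deriveD; apply: hF; lra.
rewrite addr0 in dF.
apply: (near_eq_is_derive _ dF).
apply/nbhs_ballP; exists 1 => //= y; rewrite /ball /= ltr_norml => /andP[h1 h2].
transitivity (F y + (synth a (x - 1) - F (x - 1))) => //.
by rewrite (eF y) //; lra.
Qed.

(* The nth coefficient of the nonlinearity, 0 <= n, for a real function with
   coefficients a.  The factor 2 c, with c = (2 pi)^(-1/2), is the normalisation
   of the product; only the interactions conj(a_k) a_(n+k) with k >= 1 survive,
   by [fourier_mul_mode]. *)
Definition nl a (n : nat) : R[i] :=
  (2 * c * n%:R)%:C * ctsum (fun k => (k%:R)%:C * (a k)^*%C * a (n + k)%N).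

Lemma fourier_mul_synth u b S n : continuous u -> bnd (fun k => nrm (b k)) S ->
  fourier (fun x => u x * synth b x) n =
    (2 * c)%:C * ctsum (fun k => fourier (fun x => u x * mode (b k) k x) n) /\
  summ (fun k => nrm (fourier (fun x => u x * mode (b k) k x) n)).
Proof.
move=> cu bS.
have [h1 h2] := @fourier_mul_tsum R u (fun k => mode (b k) k) (fun k => nrm (b k)) S n cu
  (fun k => @cont_mode R (b k) k) (fun k x => mode_le _ _ _) bS.
split => //; rewrite (_ : (fun x => u x * synth b x) =
   (fun x => (2 * c) * (u x * tsum (fun k => mode (b k) k x)))); last first.
  by apply/funext => x; rewrite synthE mulrCA.
rewrite fourierZ ?h1 // => x; apply: cvgM; first exact: cu.
apply: (@cont_tsum _ (fun k => mode (b k) k) (fun k => nrm (b k)) S) => //.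
- by move=> k; exact: cont_mode.
- by move=> k s; exact: mode_le.
Qed.

(* The k-th modes of Lambda u and i u' add up to a single exponential, of negative
   frequency; the other one cancels. *)
Lemma fourier_mul_mode u (z : R[i]) (k n : nat) : continuous u ->
  fourier (fun x => u x * mode z k x) n +
  'i * fourier (fun x => u x * mode ('i * z) k x) n = z^*%C * fourier u (n + k)%N.
Proof.
move=> cu.
have cm w : continuous (fun x => u x * mode w k x).
  by move=> x; apply: cvgM; [exact: cu|exact: cont_mode].
rewrite !fourierE mulrCA -mulrDr [RHS]mulrCA; congr (_ * _).
have mD' := @mD R.
rewrite -cintZ //; last exact: cintg_fker.
rewrite -cintD //; [|exact: cintg_fker|by apply: cintgZ => //; exact: cintg_fker].
rewrite -cintZ //; last exact: cintg_fker.
apply: cint_ext => x _; rewrite /fker.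
have -> : - ((n + k)%N%:~R * x) = - (n%:~R * x) + - (k%:R * x) :> R.
  by rewrite -pmulrn natrD -pmulrn; ring.
rewrite expiD (expiN (k%:R * x)) /mode.
by apply: eq_complexP; rewrite !ReImE /=; ring.
Qed.

Section OfSynth.
Variables (u : R -> R) (S : R).
Let a (k : nat) := fourier u k.
Hypotheses (cu : continuous u) (pu : periodic u (2 * pi)) (u0 : fourier u 0 = 0).
Hypothesis aS : bnd (fun k => k%:R * nrm (a k)) S.

Lemma a_bnd : bnd (fun k => nrm (a k)) S.
Proof.
apply: bnd_le aS => -[|k]; first by rewrite /a u0 nrm0 mul0r.
by rewrite ler_peMl ?nrm_ge0 // ler1n.
Qed.

Let ka_bnd : bnd (fun k => nrm ((k%:R)%:C * a k)) S.
Proof. by apply: bnd_le aS => k; rewrite nrmM nrm_real normr_nat. Qed.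

Let ika_bnd : bnd (fun k => nrm ((0 +i* k%:R) * a k)) S.
Proof. by apply: bnd_le aS => k; rewrite nrmM nrm_imag normr_nat. Qed.

Lemma LambdaE x : Lambda u x = synth (fun k => (k%:R)%:C * a k) x.
Proof.
apply: (fourier_sum_synth ka_bnd) => [|k|k]; first by rewrite mul0r.
  by rewrite /Lambda_dist ger0_norm // -pmulrn.
rewrite /Lambda_dist fourierN // normrN ger0_norm // -pmulrn.
by rewrite (conjM (k%:R)%:C (a k)) conjR.
Qed.

Lemma derive1E_synth x : derive1 u x = synth (fun k => (0 +i* k%:R) * a k) x.
Proof.
have -> : u = synth a by apply/funext => y; exact: (fourier_expand cu pu u0 a_bnd).
rewrite derive1E; apply: derive_val; exact: is_derive_synth a_bnd ika_bnd.
Qed.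

Lemma cont_uLambda : continuous (fun x => u x * Lambda u x).
Proof.
move=> x; apply: cvgM; first exact: cu.
by rewrite (_ : Lambda u = synth (fun k => (k%:R)%:C * a k));
  [exact: (cont_synth ka_bnd)|apply/funext => y; exact: LambdaE].
Qed.

Lemma cont_uderive : continuous (fun x => u x * derive1 u x).
Proof.
move=> x; apply: cvgM; first exact: cu.
by rewrite (_ : derive1 u = synth (fun k => (0 +i* k%:R) * a k));
  [exact: (cont_synth ika_bnd)|apply/funext => y; exact: derive1E_synth].
Qed.

Lemma nonlinearity_nl (n : nat) : nonlinearity u n = nl a n.
Proof.
rewrite /nonlinearity /Lambda_dist /dx_dist ger0_norm // -pmulrn.
rewrite (@fourier_ext _ (fun x => u x * Lambda u x) (fun x => u x * synth (fun k => (k%:R)%:C * a k) x)) => [|x _]; last by rewrite LambdaE.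
rewrite (@fourier_ext _ (fun x => u x * derive1 u x) (fun x => u x * synth (fun k => (0 +i* k%:R) * a k) x)) => [|x _]; last by rewrite derive1E_synth.
have [-> s1] := fourier_mul_synth n cu ka_bnd.
have [-> s2] := fourier_mul_synth n cu ika_bnd.
have -> : (0 +i* n%:R) = 'i * (n%:R)%:C :> R[i].
  by apply: eq_complexP; rewrite !ReImE /=; ring.
rewrite /nl; set X := ctsum _; set Y := ctsum _.
have -> : (n%:R)%:C * ((2 * c)%:C * X) + 'i * (n%:R)%:C * ((2 * c)%:C * Y) =
   (2 * c * n%:R)%:C * (X + 'i * Y) by rewrite !rmorphM /=; ring.
congr (_ * _); rewrite /X /Y -ctsumZ // -ctsumD //; last exact: csummZ.
apply: eq_ctsum => k.
have -> : (0 +i* k%:R) * a k = 'i * ((k%:R)%:C * a k).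
  by apply: eq_complexP; rewrite !ReImE /=; ring.
by rewrite fourier_mul_mode // conjM conjR.
Qed.

Lemma nonlinearityN (n : nat) : nonlinearity u (- n%:Z) = (nonlinearity u n)^*%C.
Proof.
rewrite /nonlinearity /Lambda_dist /dx_dist normrN.
rewrite !fourierN; [|exact: cont_uderive|exact: cont_uLambda].
rewrite mulrNz; set X := fourier _ _; set Y := fourier _ _; clearbody X Y.
by apply: eq_complexP; rewrite !ReImE /=; ring.
Qed.

End OfSynth.
End Nonlinearity.

(** * Wiener norms as sums over nonnegative frequencies *)

Section WienerNorm.
Variable R : realType.
Implicit Types (u : R -> R) (w : nat -> R).

Lemma nneseries_bnd w S : (forall k, 0 <= w k) ->
  ((\sum_(0 <= k <oo) (w k)%:E <= S%:E)%E <-> bnd w S).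
Proof.
move=> w0; split => [h N|h].
  rewrite -lee_fin; apply: le_trans h; rewrite -sumEFin -(big_mkord xpredT (fun k => (w k)%:E)).
  by apply: nneseries_lim_ge => k _ _; rewrite lee_fin.
apply: lime_le; first by apply: is_cvg_nneseries => k _ _; rewrite lee_fin.
by apply: nearW => N; rewrite big_mkord sumEFin lee_fin.
Qed.

Lemma esum_int (v : int -> R) : (forall k, 0 <= v k) ->
  (\esum_(k in [set: int]) (v k)%:E = \sum_(0 <= k <oo) (v k%:Z + v (Negz k))%:E)%E.
Proof.
move=> v0; have v0' k : (0 <= (v k)%:E)%E by rewrite lee_fin.
rewrite (esumID (range Posz)) // !setTI.
have -> : ~` (range Posz) = range Negz.
  apply/seteqP; split => [[k|k]|_ [k _ <-]] /=.
  - by move=> h; exfalso; apply: h; exists k.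
  - by exists k.
  - by move=> [m _].
rewrite !esum_image //; [|by move=> ? ? _ _ []..].
rewrite -!nneseries_esumT // -nneseriesD //.
Qed.

(** Hermitian symmetry folds the sum over Z onto k >= 0, which produces the factor 2. *)
Lemma wiener_normP (p : nat) u S : continuous u -> fourier u 0 = 0 ->
  ((wiener_norm p%:R u <= S%:E)%E <->
   bnd (fun k => 2 * (k%:R ^+ p * nrm (fourier u k))) S).
Proof.
move=> cu u0; rewrite /wiener_norm.
pose w (k : nat) := k%:R ^+ p * nrm (fourier u k).
have w0 k : 0 <= w k by rewrite mulr_ge0 ?nrm_ge0 // exprn_ge0.
have wz : w 0%N = 0 by rewrite /w u0 nrm0 mulr0.
have -> : (\esum_(k in [set: int]) (`|k|%:~R `^ p%:R * nrm (fourier u k))%:E =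
    \sum_(0 <= k <oo) (w k + w k.+1)%:E)%E.
  rewrite esum_int => [|k]; last by rewrite mulr_ge0 ?nrm_ge0 // powR_ge0.
  apply: eq_eseriesr => k _; congr ((_ + _)%:E).
    by rewrite ger0_norm // -pmulrn powR_mulrn.
  by rewrite NegzE normrN ger0_norm // -pmulrn powR_mulrn // fourierN // nrmJ.
rewrite nneseries_bnd => [|k]; last by rewrite addr_ge0.
(* [Negz k] is -(k + 1), so the folded series pairs w k with w k.+1. As w 0 = 0, its partial sums
   differ from those of 2 w by the single term w N. *)
have e N : \sum_(k < N) (w k + w k.+1) = \sum_(k < N) 2 * w k + w N.
  elim: N => [|N IH]; first by rewrite !big_ord0 wz addr0.
  by rewrite !big_ord_recr /= IH; ring.
split => h N.
  by have := h N; rewrite e; apply: le_trans; rewrite lerDl.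
have e2 : \sum_(k < N.+1) 2 * w k = \sum_(k < N) 2 * w k + 2 * w N by rewrite big_ord_recr.
have h1 : \sum_(k < N.+1) 2 * w k <= S := h N.+1.
by have := w0 N; move: h1; rewrite e e2; lra.
Qed.

Lemma fourier0_mean u : Rintegral (@lebesgue_measure R) `[0, 2 * pi] u = 0 ->
  fourier u 0 = 0.
Proof.
move=> u0; rewrite fourierE (_ : cintegral _ _ = 0) ?mulr0 //.
apply: eq_complexP => /=.
  rewrite -[RHS]u0; apply: II_ext => x _.
  by rewrite mulr0z !mul0r oppr0 cos0 mulr1 addr0.
rewrite -[RHS](mul0r (2 * pi)) -(II_cst 0 (pi2_ge0 R)); apply: II_ext => x _.
by rewrite mulr0z !mul0r oppr0 sin0 mulr0 addr0.
Qed.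

Lemma wiener_bnd (p : nat) u : wiener p%:R u -> exists2 S : R,
  wiener_norm p%:R u = S%:E & bnd (fun k => 2 * (k%:R ^+ p * nrm (fourier u k))) S.
Proof.
move=> [pu cu mu0 nu].
have n0 : (0 <= wiener_norm p%:R u)%E.
  by apply: esum_ge0 => k _; rewrite lee_fin mulr_ge0 ?nrm_ge0 // powR_ge0.
have e : wiener_norm p%:R u = (fine (wiener_norm p%:R u))%:E.
  by rewrite fineK // ge0_fin_numE.
exists (fine (wiener_norm p%:R u)) => //.
by apply/wiener_normP => //; [exact: fourier0_mean|rewrite -e].
Qed.

Lemma synth_wiener (p : nat) (a : nat -> R[i]) S : a 0%N = 0 ->
  bnd (fun k => k%:R ^+ p * nrm (a k)) S -> wiener p%:R (synth a).
Proof.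
move=> a0 aS.
have aS' : bnd (fun k => nrm (a k)) S.
  apply: bnd_le aS => -[|k]; first by rewrite a0 nrm0 mulr0.
  by rewrite ler_peMl ?nrm_ge0 // exprn_ege1 // ler1n.
split.
- exact: periodic_synth.
- exact: cont_synth aS'.
- exact: synth_mean0 aS' a0.
- apply: (@le_lt_trans _ _ ((2 * S)%:E)); last exact: ltry.
  apply/wiener_normP; [exact: cont_synth aS'|by rewrite (fourier_synth aS')|].
  by apply: bnd_le (bndZ (ler0n R 2) aS) => k; rewrite (fourier_synth aS' a0).
Qed.

End WienerNorm.


(** * Duhamel integrals and the bilinear term *)

Section RealDuhamel.
Variable R : realType.
Implicit Types (u v : R -> R) (n b t T h lam q : R).

(** The solution at time t of y' + n y = u with y(0) = h. *)
Definition rduh n h u t : R :=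
  expR (- (t * n)) * h + II `[0, t] (fun s => expR (- ((t - s) * n)) * u s).

Lemma is_derive_expl (k x : R) : is_derive x 1 (fun y : R => expR (k * y)) (expR (k * x) * k).
Proof.
exact: (@is_derive1_comp R expR (fun y => k * y) x _ _ (is_derive_expR _) (is_derive_lin k x)).
Qed.

Lemma cont_expl k : continuous (fun y : R => expR (k * y)).
Proof.
move=> x; apply: (@continuous_comp _ _ _ (fun y => k * y)); last exact: continuous_expR.
exact: cvgMr.
Qed.

Lemma cont_mulf u v : continuous u -> continuous v -> continuous (fun s => u s * v s).
Proof. by move=> cu cv x; apply: cvgM; [exact: cu|exact: cv]. Qed.

Lemma cont_addf u v : continuous u -> continuous v -> continuous (fun s => u s + v s).
Proof. by move=> cu cv x; apply: cvgD; [exact: cu|exact: cv]. Qed.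

Lemma cont_cst (k : R) : continuous (fun _ : R => k).
Proof. by move=> x; exact: cvg_cst. Qed.

Lemma exp_shift t s n : expR (- ((t - s) * n)) = expR (- (t * n)) * expR (n * s).
Proof. by rewrite -expRD; congr expR; ring. Qed.

Lemma cont_exp_shift t n : continuous (fun s => expR (- ((t - s) * n))).
Proof.
under eq_fun do rewrite exp_shift.
by apply: cont_mulf; [exact: cont_cst|exact: cont_expl].
Qed.

Lemma cont_max0 : continuous (fun t : R => Num.max t 0).
Proof.
have -> : (fun t : R => Num.max t 0) = (fun t => 2^-1 * (t + `|t|)).
  by apply/funext => t; case: (ler0P t) => t0; lra.
move=> x; apply: cvgMr; apply: cvgD; first exact: cvg_id.
exact: norm_continuous.
Qed.

(** Integrating factor: exp (- (t - s) n) splits, and G is a primitive of exp (n s) u(s). It starts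
    at -1 so as to be differentiable at time 0. *)
Lemma rduh_prim n u : continuous u ->
  exists G : R -> R, (forall x : R, -1 < x -> is_derive x 1 G (expR (n * x) * u x)) /\
  forall h t, 0 <= t -> rduh n h u t = expR (- (t * n)) * (h + (G t - G 0)).
Proof.
move=> cu; have ce : continuous (fun x => expR (n * x) * u x).
  by apply: cont_mulf => //; exact: cont_expl.
have [G hG] := prim (-1) ce; exists G; split => // h t t0.
rewrite /rduh mulrDr; congr (_ + _).
have -> : (fun s => expR (- ((t - s) * n)) * u s) =
    (fun s => expR (- (t * n)) * (expR (n * s) * u s)).
  by apply/funext => s; rewrite exp_shift mulrA.
rewrite II_Z //; last exact: intg_cont.
congr (_ * _); apply: II_FTC2 => //; first exact: contI_cont.
by move=> x /andP[x0 _]; apply: hG; apply: lt_le_trans x0; rewrite ltrN10.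
Qed.

Lemma is_derive_cont u (d x : R) : is_derive x 1 u d -> {for x, continuous u}.
Proof.
move=> h; apply: differentiable_continuous; apply/derivable1_diffP; exact: ex_derive.
Qed.

Lemma max0_gt (t : R) : -1 < Num.max t 0.
Proof. by rewrite lt_max ltrN10 orbT. Qed.

Lemma max0_ge (t : R) : 0 <= Num.max t 0.
Proof. by rewrite le_max lexx orbT. Qed.

Lemma max0E (t : R) : 0 <= t -> Num.max t 0 = t.
Proof. by move=> t0; apply/max_idPl. Qed.

(** Replacing t by [Num.max t 0] freezes the function at negative times, so that continuity holds on
    the whole line and no subspace topology on [0, T] is involved. *)
Lemma rduh_cont n h u : continuous u -> continuous (fun t => rduh n h u (Num.max t 0)).
Proof.
move=> cu; have [G [hG eG]] := rduh_prim n cu.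
have -> : (fun t => rduh n h u (Num.max t 0)) =
  (fun t => expR (- n * Num.max t 0) * (h + (G (Num.max t 0) - G 0))).
  by apply/funext => t; rewrite eG ?max0_ge // mulNr [n * _]mulrC.
apply: cont_mulf.
  move=> x; apply: (@continuous_comp _ _ _ (fun t : R => Num.max t 0) (fun y => expR (- n * y))).
    exact: cont_max0.
  exact: cont_expl.
apply: cont_addf; first exact: cont_cst.
apply: cont_addf; last exact: cont_cst.
move=> x; apply: (@continuous_comp _ _ _ (fun t : R => Num.max t 0) G).
  exact: cont_max0.
exact: is_derive_cont (hG _ (max0_gt x)).
Qed.

(* For b = 0 the integral term gives the bound in L^1(A^2); b = 1 - 4 A gives the
   exponential decay in A^0. *)
Lemma rduh_energy n b h u T : continuous u -> 0 <= T ->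
  expR (b * T) * rduh n h u T +
    (n - b) * II `[0, T] (fun t => expR (b * t) * rduh n h u (Num.max t 0)) =
  h + II `[0, T] (fun t => expR (b * t) * u t).
Proof.
move=> cu T0; have [G [hG eG]] := rduh_prim n cu.
have cr := @rduh_cont n h u cu.
pose F t := expR ((b - n) * t) * (h + (G t - G 0)).
have eF t : 0 <= t -> F t = expR (b * t) * rduh n h u t.
  by move=> t0; rewrite eG // mulrA -expRD /F; congr (expR _ * _); ring.
pose w t := (b - n) * (expR (b * t) * rduh n h u (Num.max t 0)) + expR (b * t) * u t.
have c1 : continuous (fun t => expR (b * t) * rduh n h u (Num.max t 0)).
  by apply: cont_mulf => //; exact: cont_expl.
have c2 : continuous (fun t => expR (b * t) * u t).
  by apply: cont_mulf => //; exact: cont_expl.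
have cw : continuous w.
  by apply: cont_addf => //; apply: cont_mulf => //; exact: cont_cst.
have e : II `[0, T] w = F T - F 0.
  apply: II_FTC2 => //; first exact: contI_cont.
  move=> x /andP[x0 _].
  have xN : -1 < x by apply: lt_le_trans x0; rewrite ltrN10.
  have d1 : is_derive x 1 (fun y => h + (G y - G 0)) (expR (n * x) * u x).
    have := is_deriveD (is_derive_cst h x 1) (is_deriveB (hG x xN) (is_derive_cst (G 0) x 1)).
    by rewrite subr0 add0r.
  have := is_deriveM (is_derive_expl (b - n) x) d1.
  rewrite /w max0E // -eF // /F /GRing.scale /=.
  have -> : expR ((b - n) * x) * (expR (n * x) * u x) +
    (h + (G x - G 0)) * (expR ((b - n) * x) * (b - n)) =
    (b - n) * (expR ((b - n) * x) * (h + (G x - G 0))) + expR (b * x) * u x.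
    by rewrite mulrA -expRD -mulrDl subrK; ring.
  exact.
move: e; rewrite eF // /F mulr0 expR0 mul1r subrr addr0 /w.
rewrite II_D //; [|by apply: intg_Z => //; exact: intg_cont|exact: intg_cont].
rewrite II_Z //; last exact: intg_cont.
by move=> e; lra.
Qed.

(** Direct integration of n exp (- n (t - s) + lam s). At lam = 0 the smoothing exactly compensates
    the derivative n; at lam > 0 there is an additional gain at frequencies below lam. *)
Lemma rduh_exp_le n h q lam t : 0 <= t -> 0 <= n -> 0 <= lam -> 0 <= h -> 0 <= q ->
  rduh n h (fun s => n * q * expR (lam * s)) t <= h + n / (n + lam) * q * expR (lam * t).
Proof.
move=> t0 n0 l0 h0 q0; apply: lerD.
  by rewrite ler_piMl // -expR0 ler_expR oppr_le0 mulr_ge0.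
(* Both numbers are nonnegative, so n = 0: the source vanishes, in agreement with 0 / 0 = 0. *)
have [nl0|nl0] := eqVneq (n + lam) 0.
  have -> : n = 0 by lra.
  rewrite (_ : (fun s => _) = fun=> 0) ?II_cst // ?mul0r //.
  by apply/funext => s; rewrite !mul0r mulr0.
have e : II `[0, t] (fun s => expR (- ((t - s) * n)) * (n * q * expR (lam * s))) =
   expR (- (t * n)) * (n / (n + lam) * q * expR ((n + lam) * t)) -
   expR (- (t * n)) * (n / (n + lam) * q * expR ((n + lam) * 0)).
  rewrite -mulrBr -mulrBr.
  have -> : (fun s => expR (- ((t - s) * n)) * (n * q * expR (lam * s))) =
    (fun s => (expR (- (t * n)) * (n * q)) * expR ((n + lam) * s)).
    by apply/funext => s; rewrite exp_shift mulrDl expRD; ring.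
  rewrite II_Z //; last by apply: intg_cont; exact: cont_expl.
  have -> : II `[0, t] (fun s => expR ((n + lam) * s)) =
    (n + lam)^-1 * expR ((n + lam) * t) - (n + lam)^-1 * expR ((n + lam) * 0).
    apply: (@II_FTC2 R 0 t _ (fun s => (n + lam)^-1 * expR ((n + lam) * s))) => //.
      by apply: contI_cont; exact: cont_expl.
    move=> x _; have := is_deriveZ (n + lam)^-1 (is_derive_expl (n + lam) x).
    by rewrite /GRing.scale /= mulrCA mulVf // mulr1.
  by field.
rewrite e; apply: (@le_trans _ _ (expR (- (t * n)) * (n / (n + lam) * q * expR ((n + lam) * t)))).
  rewrite lerBlDr lerDl !mulr_ge0 ?expR_ge0 // invr_ge0 addr_ge0 //.
rewrite mulrCA -expRD le_eqVlt; apply/orP; left; apply/eqP.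
by congr (_ * expR _); ring.
Qed.

End RealDuhamel.

Section ComplexDuhamel.
Variable R : realType.
Implicit Types (u v : R -> R) (n b t T h lam q : R) (N M : R -> R[i]) (z w : R[i]).

Definition cduh n z N t : R[i] :=
  (expR (- (t * n)))%:C * z +
  cintegral `[0, t] (fun s => (expR (- ((t - s) * n)))%:C * N s).

Lemma Re_realM (r : R) z : complex.Re (r%:C * z) = r * complex.Re z.
Proof. by rewrite ReM /= mul0r subr0. Qed.

Lemma Im_realM (r : R) z : complex.Im (r%:C * z) = r * complex.Im z.
Proof. by rewrite ImM /= mul0r addr0. Qed.

Lemma cduhE n z N t : cduh n z N t =
  rduh n (complex.Re z) (fun s => complex.Re (N s)) t +i*
  rduh n (complex.Im z) (fun s => complex.Im (N s)) t.
Proof.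
apply: eq_complexP.
  rewrite /cduh ReD Re_realM /rduh; congr (_ + _).
  by apply: II_ext => s _; rewrite Re_realM.
rewrite /cduh ImD Im_realM /rduh; congr (_ + _).
by apply: II_ext => s _; rewrite Im_realM.
Qed.

Lemma cduh_cont n z N : ccont N -> ccont (fun t => cduh n z N (Num.max t 0)).
Proof.
move=> [h1 h2]; split.
  by under eq_fun do rewrite cduhE /=; exact: rduh_cont.
by under eq_fun do rewrite cduhE /=; exact: rduh_cont.
Qed.

Let mE t : measurable (`[0, t]%classic : set R).
Proof. exact: measurable_itv. Qed.

Lemma cduh_meas t n N : cmeas `[0, t] N ->
  cmeas `[0, t] (fun s => (expR (- ((t - s) * n)))%:C * N s).
Proof.
move=> mN; apply: cmeas_mul => //; apply: ccont_cmeas => //.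
by apply: ccont_real; exact: cont_exp_shift.
Qed.

Lemma cduh_intg t n N C : 0 <= n -> cmeas `[0, t] N ->
  (forall s, 0 <= s <= t -> nrm (N s) <= C) ->
  cintg `[0, t] (fun s => (expR (- ((t - s) * n)))%:C * N s).
Proof.
move=> n0 mN NC; apply: (@cintg_bdd _ _ _ 0 t C) => //; first exact: cduh_meas.
move=> s /=; rewrite in_itv /= => hs; rewrite nrmM nrm_real ger0_norm ?expR_ge0 //.
apply: le_trans (NC _ hs); rewrite ler_piMl ?nrm_ge0 // -expR0 ler_expR.
by rewrite oppr_le0 mulr_ge0 // subr_ge0; case/andP: hs.
Qed.

Lemma cduh_nrm n z N u t : 0 <= n -> 0 <= t -> cmeas `[0, t] N -> continuous u ->
  (forall s, 0 <= s <= t -> nrm (N s) <= u s) ->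
  nrm (cduh n z N t) <= rduh n (nrm z) u t.
Proof.
move=> n0 t0 mN cu Nu; apply: le_trans (nrmD _ _) _.
have [B [B0 uB]] := cont_bounded 0 t cu.
rewrite nrmM nrm_real ger0_norm ?expR_ge0 //; apply: lerD => //.
apply: nrm_cint_le => //.
- apply: (@cduh_intg _ _ _ B) => // s hs.
  exact: le_trans (Nu _ hs) (le_trans (ler_norm _) (uB _ hs)).
- by apply: intg_cont; apply: cont_mulf => //; exact: cont_exp_shift.
- move=> s /=; rewrite in_itv /= => hs.
  by rewrite nrmM nrm_real ger0_norm ?expR_ge0 // ler_wpM2l ?expR_ge0 // Nu.
Qed.

Lemma cduhB n z w N M C t : 0 <= n -> 0 <= t ->
  cmeas `[0, t] N -> cmeas `[0, t] M ->
  (forall s, 0 <= s <= t -> nrm (N s) <= C) ->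
  (forall s, 0 <= s <= t -> nrm (M s) <= C) ->
  cduh n z N t - cduh n w M t = cduh n (z - w) (fun s => N s - M s) t.
Proof.
move=> n0 t0 mN mM NC MC; rewrite /cduh.
have -> : (fun s => (expR (- ((t - s) * n)))%:C * (N s - M s)) =
  (fun s => (expR (- ((t - s) * n)))%:C * N s - (expR (- ((t - s) * n)))%:C * M s).
  by apply/funext => s; rewrite mulrBr.
rewrite cintB //; [ring|exact: (@cduh_intg _ _ _ C)|exact: (@cduh_intg _ _ _ C)].
Qed.

End ComplexDuhamel.

(** * The bilinear majorant of the nonlinearity *)

Section Bilinear.
Variable R : realType.
Implicit Types (x y d m M w v : nat -> R) (a b : nat -> R[i]) (X Y B : R).
Notation c := (nc R).

(** Majorant of the series in [nl]: x bounds the conjugated, differentiated factor and y the other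
    one. The two slots are kept apart because difference and energy estimates fill them
    differently. *)
Definition Q x y (n : nat) : R := tsum (fun k => k%:R * x k * y (n + k)%N).

Definition pos x := forall k : nat, 0 <= x k.

Lemma kpos x : pos x -> pos (fun k => k%:R * x k).
Proof. by move=> x0 k; rewrite mulr_ge0. Qed.

Lemma Q_summ x y n X B : pos x -> pos y -> bnd (fun k => k%:R * x k) X ->
  (forall k, y k <= B) -> summ (fun k => k%:R * x k * y (n + k)%N).
Proof.
move=> x0 y0 xX yB; apply: (@summ_le _ _ (fun k => B * (k%:R * x k)) (B * X)).
  move=> k; have h := kpos x0 k; rewrite ger0_norm ?mulr_ge0 //.
  by rewrite mulrC ler_wpM2r.
by apply: bndZ => //; exact: le_trans (y0 0%N) (yB 0%N).
Qed.

Lemma Q_ge0 x y n X B : pos x -> pos y -> bnd (fun k => k%:R * x k) X ->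
  (forall k, y k <= B) -> 0 <= Q x y n.
Proof.
move=> x0 y0 xX yB; apply: tsum_ge0; last exact: Q_summ xX yB.
by move=> k; rewrite !mulr_ge0.
Qed.

(** After exchanging the sums, the weight w n is moved to the frequency n + k. The inner sum over n
    is then a shifted part of v, at most Y for every k, and sum_k k x_k <= X remains. *)
Lemma Q_bnd x y w v X Y B : pos x -> pos y -> pos w ->
  bnd (fun k => k%:R * x k) X -> (forall k, y k <= B) ->
  (forall n k, w n * y (n + k)%N <= v (n + k)%N) -> pos v -> bnd v Y ->
  bnd (fun n => w n * Q x y n) (X * Y).
Proof.
move=> x0 y0 w0 xX yB wyv v0 vY N.
have s n : summ (fun k => k%:R * x k * y (n + k)%N) by exact: Q_summ xX yB.
have h : (fun K => \sum_(n < N) w n * \sum_(k < K) k%:R * x k * y (n + k)%N) @ \oo -->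
    \sum_(n < N) w n * Q x y n.
  have := @cvg_psum R nat \oo _ (fun n K => w n * \sum_(k < K) k%:R * x k * y (n + k)%N)
    (fun n => w n * Q x y n) N.
  by apply => n; apply: cvgMr; exact: summ_cvg.
have Y0 := bnd_ge0 vY; move: (h) => /cvg_lim <- //; apply: limr_le.
  by apply/cvg_ex; eexists; exact: h.
apply: nearW => K.
have -> : \sum_(n < N) w n * \sum_(k < K) k%:R * x k * y (n + k)%N =
   \sum_(k < K) k%:R * x k * \sum_(n < N) w n * y (n + k)%N.
  under eq_bigr do rewrite mulr_sumr.
  rewrite exchange_big /=; apply: eq_bigr => k _; rewrite mulr_sumr.
  by apply: eq_bigr => n _; rewrite mulrCA.
apply: (@le_trans _ _ (\sum_(k < K) k%:R * x k * Y)).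
  apply: ler_sum => k _; rewrite ler_wpM2l ?mulr_ge0 //.
  apply: (@le_trans _ _ (\sum_(n < N) v (k + n)%N)).
    by apply: ler_sum => n _; rewrite [(k + n)%N]addnC.
  exact: (@bnd_shift R v Y k v0 vY N).
by rewrite -mulr_suml ler_wpM2r.
Qed.

Lemma k_bound m X : pos m -> m 0%N = 0 -> bnd (fun k => k%:R * m k) X ->
  forall k, m k <= X.
Proof.
move=> m0 mz mX k; have X0 := bnd_ge0 mX.
case: k => [|k]; first by rewrite mz.
apply: le_trans (bnd_term k.+1 (kpos m0) mX).
by rewrite ler_peMl // ler1n.
Qed.

Lemma Q_le x y x' y' n X B : pos x -> pos y -> (forall k, x k <= x' k) ->
  (forall k, y k <= y' k) -> bnd (fun k => k%:R * x' k) X -> (forall k, y' k <= B) ->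
  Q x y n <= Q x' y' n.
Proof.
move=> x0 y0 xx yy xX yB.
have x0' : pos x' by move=> k; exact: le_trans (x0 k) (xx k).
have y0' : pos y' by move=> k; exact: le_trans (y0 k) (yy k).
apply: le_tsum.
- apply: (Q_summ n x0 y0 _ (B := B)); first by apply: bnd_le xX => k; rewrite ler_wpM2l.
  by move=> k; exact: le_trans (yy k) (yB k).
- exact: Q_summ xX yB.
- by move=> k; apply: ler_pM; rewrite ?mulr_ge0 // ler_wpM2l.
Qed.

Definition nlt a (n k : nat) : R[i] := (k%:R)%:C * (a k)^*%C * a (n + k)%N.

Lemma nrm_nlt a m n k : (forall j, nrm (a j) <= m j) ->
  nrm (nlt a n k) <= k%:R * m k * m (n + k)%N.
Proof.
move=> am; rewrite /nlt !nrmM nrm_real normr_nat nrmJ.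
by apply: ler_pM; rewrite ?mulr_ge0 ?nrm_ge0 // ler_wpM2l.
Qed.

Lemma nlt_summ a m n X B : (forall j, nrm (a j) <= m j) ->
  bnd (fun k => k%:R * m k) X -> (forall k, m k <= B) ->
  summ (fun k => nrm (nlt a n k)).
Proof.
move=> am mX mB.
have m0 : pos m by move=> k; exact: le_trans (nrm_ge0 _) (am k).
have [S hS] := Q_summ n m0 m0 mX mB.
apply: (csumm_le _ hS) => k; apply: le_trans (nrm_nlt n k am) (ler_norm _).
Qed.

Lemma nc2n_ge0 (n : nat) : 0 <= 2 * c * n%:R.
Proof. by rewrite !mulr_ge0 // ltW // nc_gt0. Qed.

Lemma nrm_nl a x y n X B : pos x -> pos y -> (forall j, nrm (a j) <= x j) ->
  (forall j, nrm (a j) <= y j) ->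
  bnd (fun k => k%:R * x k) X -> (forall k, y k <= B) ->
  nrm (nl a n) <= 2 * c * n%:R * Q x y n.
Proof.
move=> x0 y0 ax ay xX yB; rewrite /nl nrmM nrm_real ger0_norm ?nc2n_ge0 //.
rewrite ler_wpM2l ?nc2n_ge0 //.
have le k : nrm (nlt a n k) <= k%:R * x k * y (n + k)%N.
  rewrite /nlt !nrmM nrm_real normr_nat nrmJ.
  by apply: ler_pM; rewrite ?mulr_ge0 ?nrm_ge0 // ler_wpM2l.
have s := Q_summ n x0 y0 xX yB.
have [S hS] := s; have sn : summ (fun k => nrm (nlt a n k)).
  by apply: (csumm_le _ hS) => k; apply: le_trans (le k) (ler_norm _).
by apply: le_trans (nrm_ctsum sn) _; exact: le_tsum.
Qed.

(** Product rule for differences: the error is multiplied once by a in the first slot and once by b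
    in the second, so m and M each appear only once. *)
Lemma nl_diff a b m M d n X B : pos d ->
  (forall j, nrm (a j) <= m j) -> (forall j, nrm (b j) <= M j) ->
  (forall j, nrm (a j - b j) <= d j) ->
  bnd (fun k => k%:R * m k) X -> bnd (fun k => k%:R * M k) X ->
  bnd (fun k => k%:R * d k) X ->
  (forall k, m k <= B) -> (forall k, M k <= B) -> (forall k, d k <= B) ->
  nrm (nl a n - nl b n) <= 2 * c * n%:R * (Q m d n + Q d M n).
Proof.
move=> d0 am bM abd mX MX dX mB MB dB.
have m0 : pos m by move=> k; exact: le_trans (nrm_ge0 _) (am k).
have M0 : pos M by move=> k; exact: le_trans (nrm_ge0 _) (bM k).
have sa := nlt_summ n am mX mB; have sb := nlt_summ n bM MX MB.
rewrite /nl -mulrBr nrmM nrm_real ger0_norm ?nc2n_ge0 // ler_wpM2l ?nc2n_ge0 //.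
have s1 := Q_summ n m0 d0 mX dB; have s2 := Q_summ n d0 M0 dX MB.
rewrite -ctsumB // /Q -tsumD //.
have le k : nrm (nlt a n k - nlt b n k) <=
    k%:R * m k * d (n + k)%N + k%:R * d k * M (n + k)%N.
  have -> : nlt a n k - nlt b n k = (k%:R)%:C * (a k)^*%C * (a (n + k)%N - b (n + k)%N) +
      (k%:R)%:C * (a k - b k)^*%C * b (n + k)%N by rewrite /nlt conjB; ring.
  apply: le_trans (nrmD _ _) _; rewrite !nrmM nrm_real normr_nat !nrmJ.
  by apply: lerD; apply: ler_pM; rewrite ?mulr_ge0 ?nrm_ge0 // ler_wpM2l.
have [S hS] := summD s1 s2.
have sn : summ (fun k => nrm (nlt a n k - nlt b n k)).
  by apply: (csumm_le _ hS) => k; apply: le_trans (le k) (ler_norm _).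
apply: le_trans (nrm_ctsum sn) _; apply: le_tsum => //; exact: summD.
Qed.

Lemma nl_ccont (a : nat -> R -> R[i]) m n X B : (forall k, ccont (a k)) ->
  (forall k t, nrm (a k t) <= m k) -> bnd (fun k => k%:R * m k) X ->
  (forall k, m k <= B) -> ccont (fun t => nl (a^~ t) n).
Proof.
move=> ca am mX mB; apply: ccontM; first exact: ccont_cst.
have m0 : pos m by move=> k; exact: le_trans (nrm_ge0 _) (am k 0).
have [S hS] := Q_summ n m0 m0 mX mB.
apply: (@ccont_ctsum _ (fun k t => nlt (a^~ t) n k) (fun k => `|k%:R * m k * m (n + k)%N|) S) => //.
  move=> k; apply: ccontM; last exact: ca.
  by apply: ccontM; [exact: ccont_cst|apply: ccontJ; exact: ca].
move=> k t; apply: le_trans (ler_norm _); apply: (@nrm_nlt (a^~ t)) => j; exact: am.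
Qed.

End Bilinear.

Section Limits.
Variable R : realType.

(** The sequences x + mu and mu - x are both nondecreasing, which yields the convergence and, by
    comparing each with its limit, the rate. *)
Lemma cvg_dominated_increments (x mu : nat -> R) (ml : R) :
  (forall j, `|x j.+1 - x j| <= mu j.+1 - mu j) -> mu @ \oo --> ml ->
  x @ \oo --> limn x /\ forall j, `|x j - limn x| <= ml - mu j.
Proof.
move=> dx cmu.
have mond : {homo mu : n m / (n <= m)%N >-> n <= m}.
  by apply/nondecreasing_seqP => j; rewrite -subr_ge0; exact: le_trans (dx j).
have mule j : mu j <= ml.
  have cm : cvgn mu by apply/cvg_ex; exists ml.
  by have := nondecreasing_cvgn_le mond cm j; rewrite (cvg_lim _ cmu).
have ynd : {homo (fun j => x j + mu j) : n m / (n <= m)%N >-> n <= m}.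
  by apply/nondecreasing_seqP => j; have /ler_normlP[] := dx j; lra.
have znd : {homo (fun j => mu j - x j) : n m / (n <= m)%N >-> n <= m}.
  by apply/nondecreasing_seqP => j; have /ler_normlP[] := dx j; lra.
have cy : cvgn (fun j => x j + mu j).
  apply: nondecreasing_is_cvgn => //.
  (* x + mu = 2 mu - (mu - x), and mu - x is at least its initial value. *)
  exists (2 * ml - (mu 0%N - x 0%N)) => _ [j _ <-].
  by have := znd _ _ (leq0n j); have := mule j; lra.
have /cvg_ex[l hl] : cvgn x.
  have -> : x = (fun j => (x j + mu j) - mu j) by apply/funext => j; rewrite addrK.
  by apply: is_cvgB => //; apply/cvg_ex; exists ml.
have -> : limn x = l by apply/cvg_lim.
split => // j.
have c1 : (fun j => x j + mu j) @ \oo --> l + ml by apply: cvgD.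
have c2 : (fun j => mu j - x j) @ \oo --> ml - l by apply: cvgB.
have h1 : x j + mu j <= l + ml.
  by have := nondecreasing_cvgn_le ynd cy j; rewrite (cvg_lim _ c1).
have h2 : mu j - x j <= ml - l.
  have cz : cvgn (fun j => mu j - x j) by apply/cvg_ex; eexists; exact: c2.
  by have := nondecreasing_cvgn_le znd cz j; rewrite (cvg_lim _ c2).
by rewrite ler_norml; apply/andP; split; lra.
Qed.

Lemma uniform_cont (u : nat -> R -> R) (v : R -> R) (e : nat -> R) :
  (forall j, continuous (u j)) -> (forall j t, `|u j t - v t| <= e j) ->
  e @ \oo --> (0 : R) -> continuous v.
Proof.
move=> cu uv ce x; apply/cvgrPdist_lt => d d0.
have d3 : 0 < d / 3 by rewrite divr_gt0.
have /cvgrPdist_lt /(_ _ d3) [j _ /(_ j (leqnn j))] := ce.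
rewrite sub0r normrN => ej.
have /cvgrPdist_lt /(_ _ d3) := cu j x; apply: filterS => y.
have h1 := uv j x; have h2 := uv j y; have h3 := ler_norm (e j).
move: h1 h2 => /ler_normlP[? ?] /ler_normlP[? ?] /ltr_normlP[? ?].
by apply/ltr_normlP; split; lra.
Qed.

Lemma cvg0_le (x e : nat -> R) : (forall j, 0 <= x j <= e j) ->
  e @ \oo --> (0 : R) -> x @ \oo --> (0 : R).
Proof.
move=> xe ce; apply: (@squeeze_cvgr _ _ _ _ (fun=> 0) e) => //; last exact: cvg_cst.
by apply: nearW => j; exact: xe.
Qed.

Lemma le0_cvg (r : R) (e : nat -> R) : (forall j, r <= e j) ->
  e @ \oo --> (0 : R) -> r <= 0.
Proof.
move=> re ce; have <- : limn e = 0 by apply/cvg_lim.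
apply: limr_ge; first by apply/cvg_ex; exists 0.
exact: nearW.
Qed.

End Limits.

(** * Lipschitz and energy estimates for one Duhamel step *)

Section Estimates.
Variable R : realType.
Implicit Types (m M d : nat -> R) (x y : nat -> R -> R[i]) (lam b t T X B : R).
Notation c := (nc R).

Lemma Q_cvg0_r m (d : nat -> nat -> R) D n X B : pos m -> (forall j, pos (d j)) ->
  (forall j k, d j k <= D k) -> bnd (fun k => k%:R * m k) X -> (forall k, D k <= B) ->
  (forall k, (fun j => d j k) @ \oo --> (0 : R)) ->
  (fun j => Q m (d j) n) @ \oo --> (0 : R).
Proof.
move=> m0 d0 dD mX DB dc.
have D0 : pos D by move=> k; exact: le_trans (d0 0%N k) (dD 0%N k).
have [S hS] := Q_summ n m0 D0 mX DB.
have h := @tannery R (fun j k => k%:R * m k * d j (n + k)%N)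
  (fun k => `|k%:R * m k * D (n + k)%N|) S.
have p j k : 0 <= k%:R * m k * d j (n + k)%N by rewrite !mulr_ge0 //; exact: d0.
have -> : (fun j => Q m (d j) n) = (fun j => tsum (fun k => `|k%:R * m k * d j (n + k)%N|)).
  by apply/funext => j; congr tsum; apply/funext => k; rewrite ger0_norm.
apply: h => // [j k|k].
  by rewrite [leLHS]ger0_norm // ger0_norm ?mulr_ge0 // ler_wpM2l ?mulr_ge0.
by rewrite -[X in _ --> X](mulr0 (k%:R * m k)); apply: cvgMr.
Qed.

Lemma Q_cvg0_l m (d : nat -> nat -> R) D n X B : pos m -> (forall j, pos (d j)) ->
  (forall j k, d j k <= D k) -> bnd (fun k => k%:R * D k) X -> (forall k, m k <= B) ->
  (forall k, (fun j => d j k) @ \oo --> (0 : R)) ->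
  (fun j => Q (d j) m n) @ \oo --> (0 : R).
Proof.
move=> m0 d0 dD DX mB dc.
have D0 : pos D by move=> k; exact: le_trans (d0 0%N k) (dD 0%N k).
have [S hS] := Q_summ n D0 m0 DX mB.
have h := @tannery R (fun j k => k%:R * d j k * m (n + k)%N)
  (fun k => `|k%:R * D k * m (n + k)%N|) S.
have p j k : 0 <= k%:R * d j k * m (n + k)%N by rewrite !mulr_ge0 //; exact: d0.
have -> : (fun j => Q (d j) m n) = (fun j => tsum (fun k => `|k%:R * d j k * m (n + k)%N|)).
  by apply/funext => j; congr tsum; apply/funext => k; rewrite ger0_norm.
apply: h => // [j k|k].
  by rewrite [leLHS]ger0_norm // ger0_norm ?mulr_ge0 // ler_wpM2r // ler_wpM2l.
rewrite (_ : (fun j => _) = (fun j => (k%:R * m (n + k)%N) * d j k)).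
  by rewrite -[X in _ --> X](mulr0 (k%:R * m (n + k)%N)); apply: cvgMr.
by apply/funext => j; rewrite mulrAC.
Qed.

Lemma QZr m d r n X B : pos m -> pos d -> bnd (fun k => k%:R * m k) X ->
  (forall k, d k <= B) -> Q m (fun k => r * d k) n = r * Q m d n.
Proof.
move=> m0 d0 mX dB; rewrite /Q -tsumZ; last exact: Q_summ mX dB.
by congr tsum; apply/funext => k; rewrite mulrCA.
Qed.

Lemma QZl m d r n X B : pos m -> pos d -> bnd (fun k => k%:R * d k) X ->
  (forall k, m k <= B) -> Q (fun k => r * d k) m n = r * Q d m n.
Proof.
move=> m0 d0 dX mB; rewrite /Q -tsumZ; last exact: Q_summ dX mB.
by congr tsum; apply/funext => k; rewrite mulrCA !mulrA.
Qed.

(** The Picard map on sequences of coefficients, frozen at negative times so that all iterates are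
    continuous on the line. *)
Definition step (al : nat -> R[i]) x (n : nat) t : R[i] :=
  cduh n%:R (al n) (fun s => nl (x^~ s) n) (Num.max t 0).

(** With lam = 0 this controls the iterates and their limit; with lam large it gives uniqueness.
    Bounds are assumed on [0, T] only, because an arbitrary solution is controlled by constants that
    depend on T. *)
Lemma duh_diff al lam T m M d x y n t X B : 0 <= lam -> pos d ->
  cmeas `[0, t] (fun s => nl (x^~ s) n) -> cmeas `[0, t] (fun s => nl (y^~ s) n) ->
  (forall k s, 0 <= s <= T -> nrm (x k s) <= m k) ->
  (forall k s, 0 <= s <= T -> nrm (y k s) <= M k) ->
  (forall k s, 0 <= s <= T -> nrm (x k s - y k s) <= expR (lam * s) * d k) ->
  bnd (fun k => k%:R * m k) X -> bnd (fun k => k%:R * M k) X ->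
  bnd (fun k => k%:R * d k) X ->
  (forall k, m k <= B) -> (forall k, M k <= B) -> (forall k, d k <= B) ->
  0 <= t <= T ->
  nrm (cduh n%:R (al n) (fun s => nl (x^~ s) n) t -
       cduh n%:R (al n) (fun s => nl (y^~ s) n) t) <=
  n%:R / (n%:R + lam) * (2 * c * (Q m d n + Q d M n)) * expR (lam * t).
Proof.
move=> l0 d0 mx my xm yM xyd mX MX dX mB MB dB /andP[t0 tT].
have T0 : 0 <= T by exact: le_trans tT.
have m0 : pos m by move=> k; apply: le_trans (nrm_ge0 _) (xm k 0 _); rewrite lexx.
have M0 : pos M by move=> k; apply: le_trans (nrm_ge0 _) (yM k 0 _); rewrite lexx.
have sT s : 0 <= s <= t -> 0 <= s <= T.
  by move=> /andP[-> st] /=; exact: le_trans tT.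
have n0 : 0 <= (n%:R : R) by [].
pose C := 2 * c * n%:R * Q m m n + 2 * c * n%:R * Q M M n.
have Qm0 : 0 <= 2 * c * n%:R * Q m m n.
  by rewrite mulr_ge0 ?nc2n_ge0 // (@Q_ge0 _ m m n X B).
have QM0 : 0 <= 2 * c * n%:R * Q M M n.
  by rewrite mulr_ge0 ?nc2n_ge0 // (@Q_ge0 _ M M n X B).
have Cx s : 0 <= s <= t -> nrm (nl (x^~ s) n) <= C.
  move=> hs; apply: (@le_trans _ _ (2 * c * n%:R * Q m m n)); last by rewrite lerDl.
  by apply: (@nrm_nl _ (x^~ s) m m n X B) => // j; apply: xm; exact: sT.
have Cy s : 0 <= s <= t -> nrm (nl (y^~ s) n) <= C.
  move=> hs; apply: (@le_trans _ _ (2 * c * n%:R * Q M M n)); last by rewrite lerDr.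
  by apply: (@nrm_nl _ (y^~ s) M M n X B) => // j; apply: yM; exact: sT.
rewrite (@cduhB _ _ _ _ _ _ C) // subrr.
set q := 2 * c * (Q m d n + Q d M n).
have q0 : 0 <= q.
  rewrite !mulr_ge0 ?addr_ge0 //; first exact/ltW/nc_gt0.
    exact: (@Q_ge0 _ m d n X B).
  exact: (@Q_ge0 _ d M n X B).
have mE : measurable (`[0, t]%classic : set R) by exact: measurable_itv.
have h := @cduh_nrm R n%:R 0 (fun s => nl (x^~ s) n - nl (y^~ s) n)
  (fun s => n%:R * q * expR (lam * s)) t n0 t0.
apply: le_trans (h _ _ _) _.
- rewrite (_ : (fun s => _) = (fun s => nl (x^~ s) n + -1 * nl (y^~ s) n)); last first.
    by apply/funext => s; rewrite mulN1r.
  apply: cmeasD => //; apply: cmeas_mul => //.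
- by apply: cont_mulf; [exact: cont_cst|exact: cont_expl].
- move=> s hs.
  have e0 := expR_gt0 (lam * s).
  have p1 : pos (fun k => expR (lam * s) * d k) by move=> k; rewrite mulr_ge0 // ltW.
  (* [nl_diff] takes a single X and a single B for its three sequences; these sums dominate both the
     unweighted bounds and those of d weighted by exp (lam s). *)
  apply: le_trans (@nl_diff _ (x^~ s) (y^~ s) m M (fun k => expR (lam * s) * d k) n
     (X + expR (lam * s) * X) (B + expR (lam * s) * B) p1 _ _ _ _ _ _ _ _ _) _.
  + by move=> j; apply: xm; exact: sT.
  + by move=> j; apply: yM; exact: sT.
  + by move=> j; apply: xyd; exact: sT.
  + by apply: (bnd_leS _ mX); rewrite lerDl mulr_ge0 ?(ltW e0) // (bnd_ge0 mX).
  + by apply: (bnd_leS _ MX); rewrite lerDl mulr_ge0 ?(ltW e0) // (bnd_ge0 mX).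
  + under eq_fun do rewrite mulrCA.
    apply: bnd_leS (bndZ (ltW e0) dX).
    by rewrite lerDr (bnd_ge0 mX).
  + move=> k; apply: le_trans (mB k) _; rewrite lerDl mulr_ge0 ?(ltW e0) //.
    exact: le_trans (m0 0%N) (mB 0%N).
  + move=> k; apply: le_trans (MB k) _; rewrite lerDl mulr_ge0 ?(ltW e0) //.
    exact: le_trans (m0 0%N) (mB 0%N).
  + move=> k; apply: (@le_trans _ _ (expR (lam * s) * B)); first by rewrite ler_wpM2l ?(ltW e0).
    rewrite lerDr; exact: le_trans (m0 0%N) (mB 0%N).
  + rewrite (@QZr m d _ n X B) // (@QZl M d _ n X B) // /q le_eqVlt; apply/orP; left; apply/eqP.
    ring.
- rewrite nrm0; apply: le_trans (@rduh_exp_le R n%:R 0 q lam t t0 n0 l0 (lexx 0) q0) _.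
  by rewrite add0r.
Qed.

Lemma step_nrm al m x n t X B : (forall k s, nrm (x k s) <= m k) ->
  cmeas `[0, Num.max t 0] (fun s => nl (x^~ s) n) ->
  bnd (fun k => k%:R * m k) X -> (forall k, m k <= B) ->
  nrm (step al x n t) <= nrm (al n) + n%:R / n%:R * (2 * c * Q m m n).
Proof.
move=> xm mx mX mB.
have m0 : pos m by move=> k; exact: le_trans (nrm_ge0 _) (xm k 0).
have t0 := max0_ge t.
have n0 : 0 <= (n%:R : R) by [].
have q0 : 0 <= 2 * c * Q m m n.
  rewrite !mulr_ge0 //; first exact/ltW/nc_gt0.
  exact: (@Q_ge0 _ m m n X B).
apply: le_trans (@cduh_nrm R n%:R (al n) _ (fun s => n%:R * (2 * c * Q m m n) * expR (0 * s)) _ n0 t0 mx _ _) _.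
- by apply: cont_mulf; [exact: cont_cst|exact: cont_expl].
- move=> s _; rewrite mul0r expR0 mulr1 mulrA [n%:R * _]mulrC.
  exact: (@nrm_nl _ (x^~ s) m m n X B).
- apply: le_trans (@rduh_exp_le R n%:R (nrm (al n)) (2 * c * Q m m n) 0 _ t0 n0 (lexx 0) (nrm_ge0 _) q0) _.
  by rewrite addr0 mul0r expR0 mulr1.
Qed.

(** One factor of the nonlinearity is bounded by m uniformly in time, so the time integral falls on
    the other factor and the right-hand side is linear in the integrated moduli. *)
Lemma energy_Q al m x n b T X B : (forall k, ccont (x k)) ->
  (forall k s, nrm (x k s) <= m k) -> bnd (fun k => k%:R * m k) X ->
  (forall k, m k <= B) -> 0 <= T -> b <= n%:R ->
  expR (b * T) * nrm (step al x n T) +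
    (n%:R - b) * II `[0, T] (fun t => expR (b * t) * nrm (step al x n t)) <=
  nrm (al n) + 2 * c * n%:R *
     Q m (fun k => II `[0, T] (fun t => expR (b * t) * nrm (x k t))) n.
Proof.
move=> cx xm mX mB T0 bn.
have m0 : pos m by move=> k; exact: le_trans (nrm_ge0 _) (xm k 0).
have n0 : 0 <= (n%:R : R) by [].
have mE : measurable (`[0, T]%classic : set R) by exact: measurable_itv.
have [S hS] := Q_summ n m0 m0 mX mB.
have cN : ccont (fun s => nl (x^~ s) n) by exact: (@nl_ccont _ x m n X B).
pose v k s := k%:R * m k * nrm (x (n + k)%N s).
have v0 k s : 0 <= v k s by rewrite !mulr_ge0 ?nrm_ge0.
have vle k s : `|v k s| <= `|k%:R * m k * m (n + k)%N|.
  by rewrite !ger0_norm ?v0 // ?mulr_ge0 // ler_wpM2l ?mulr_ge0.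
have cv k : continuous (v k) by apply: cont_mulf; [exact: cont_cst|exact: ccont_nrm].
pose u s := 2 * c * n%:R * tsum (v^~ s).
have cu : continuous u.
  by apply: cont_mulf; [exact: cont_cst|exact: cont_tsum vle hS].
have Nu s : nrm (nl (x^~ s) n) <= u s.
  exact: (@nrm_nl _ (x^~ s) m (fun k => nrm (x k s)) n X B m0 (fun k => nrm_ge0 _)
    (fun k => xm k s) (fun k => lexx _) mX (fun k => le_trans (xm k s) (mB k))).
have le t : 0 <= t -> nrm (step al x n t) <= rduh n%:R (nrm (al n)) u t.
  move=> t0; rewrite /step max0E //; apply: cduh_nrm => //.
  apply: ccont_cmeas => //; exact: measurable_itv.
have cs : continuous (fun t => nrm (step al x n t)).
  by apply: ccont_nrm; exact: cduh_cont.
have cr := @rduh_cont R n%:R (nrm (al n)) u cu.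
have := @rduh_energy R n%:R b (nrm (al n)) u T cu T0.
have -> : II `[0, T] (fun t => expR (b * t) * u t) =
    2 * c * n%:R * Q m (fun k => II `[0, T] (fun t => expR (b * t) * nrm (x k t))) n.
  have -> : (fun t => expR (b * t) * u t) =
     (fun t => 2 * c * n%:R * tsum (fun k => expR (b * t) * v k t)).
    apply/funext => t; rewrite tsumZ; first by rewrite /u mulrCA.
    by apply: summ_le hS => k; exact: vle.
  have [E0 [E00 hE]] := @cont_bounded R (fun t => expR (b * t)) 0 T (@cont_expl R b).
  have hb s : `[0, T]%classic s -> bnd (fun k => `|expR (b * s) * v k s|) (E0 * S).
    move=> Es; apply: (@bnd_le _ _ (fun k => E0 * `|k%:R * m k * m (n + k)%N|)).
      move=> k; rewrite normrM; apply: ler_pM => //.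
      by apply: hE; move: Es; rewrite /= in_itv.
    exact: bndZ.
  have [_ _ eI] := @int_tsum R `[0, T] 0 T (fun k t => expR (b * t) * v k t) (E0 * S) mE
    (fun _ => id) (fun k => cont_meas mE (cont_mulf (@cont_expl R b) (cv k))) hb.
  rewrite II_Z //; last first.
    apply: intg_cont.
    rewrite (_ : (fun t => tsum _) = (fun t => expR (b * t) * tsum (v^~ t))).
      by apply: cont_mulf; [exact: cont_expl|exact: cont_tsum vle hS].
    apply/funext => t; rewrite tsumZ //.
    by apply: summ_le hS => k; exact: vle.
  rewrite eI; congr (_ * tsum _); apply/funext => k; rewrite -II_Z //.
    by apply: II_ext => t _; rewrite /v mulrCA.
  by apply: intg_cont; apply: cont_mulf; [exact: cont_expl|exact: ccont_nrm].
move=> <-; apply: lerD.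
  by rewrite ler_wpM2l ?expR_ge0 // le.
rewrite ler_wpM2l ?subr_ge0 //; apply: II_le => //.
- by apply: intg_cont; apply: cont_mulf; [exact: cont_expl|].
- by apply: intg_cont; apply: cont_mulf; [exact: cont_expl|].
- move=> t /=; rewrite in_itv /= => /andP[t0 _].
  by rewrite ler_wpM2l ?expR_ge0 // max0E // le.
Qed.

End Estimates.

(** * Picard iteration on Fourier coefficients *)

Section Picard.
Variable R : realType.
Notation c := (nc R).
Variables (al : nat -> R[i]) (A : R).
Hypotheses (al0 : al 0%N = 0) (alA : bnd (fun k => k%:R * nrm (al k)) A) (A4 : 4 * A < 1).
Implicit Types (m : nat -> R) (x : nat -> R -> R[i]).

Let A0 : 0 <= A. Proof. exact: bnd_ge0 alA. Qed.
Let c0 : 0 <= c. Proof. exact/ltW/nc_gt0. Qed.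
Let c2 : 2 * c <= 1. Proof. by have := nc_le R; lra. Qed.
(** The smallness assumption in the form used: A plus this quantity is at most 2 A, so the ball of
    radius 2 A is stable. It also closes the integrated A^2 bound of the iterates. *)
Let cA : 2 * c * (2 * A * (2 * A)) <= A.
Proof.
have h : 2 * c * (2 * A * (2 * A)) <= 1 * (2 * A * (2 * A)).
  by rewrite ler_wpM2r // !mulr_ge0.
apply: le_trans h _; rewrite mul1r.
have : 4 * A * A <= 1 * A by rewrite ler_wpM2r // ltW.
by rewrite mul1r => h; apply: le_trans h; rewrite le_eqVlt; apply/orP; left; apply/eqP; ring.
Qed.

(** The quotient n / n comes from [rduh_exp_le] at lam = 0: it is 1 for n >= 1 and 0 for n = 0,
    where the nonlinearity has no coefficient. *)
Definition maj m (n : nat) : R := nrm (al n) + n%:R / n%:R * (2 * c * Q m m n).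

Definition ok m := [/\ pos m, m 0%N = 0 & bnd (fun k => k%:R * m k) (2 * A)].

Lemma ok_le m : ok m -> forall k, m k <= 2 * A.
Proof. by move=> [m0 mz mX]; exact: k_bound. Qed.

Let nnn (n : nat) : n%:R * (n%:R / n%:R) = n%:R :> R.
Proof. by have [->|n0] := eqVneq n 0%N; [rewrite mul0r|rewrite divff ?mulr1 // pnatr_eq0]. Qed.

Lemma maj_ok m : ok m -> ok (maj m).
Proof.
move=> om; have [m0 mz mX] := om; have mB := ok_le om.
have Q0 n : 0 <= 2 * c * Q m m n.
  by rewrite !mulr_ge0 // (@Q_ge0 _ m m n (2 * A) (2 * A)).
split.
- by move=> n; rewrite addr_ge0 ?nrm_ge0 // mulr_ge0.
- by rewrite /maj al0 nrm0 mul0r mul0r addr0.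
- have h : bnd (fun n => n%:R * Q m m n) (2 * A * (2 * A)).
    apply: (@Q_bnd _ m m (fun n => n%:R) (fun n => n%:R * m n) (2 * A) (2 * A) (2 * A)) => //.
      by move=> n k; rewrite ler_wpM2r // ler_nat leq_addr.
    exact: kpos.
  have c20 : 0 <= 2 * c by rewrite mulr_ge0.
  have := bndD alA (bndZ c20 h) => hD.
  apply: (@bnd_leS _ _ (A + 2 * c * (2 * A * (2 * A)))); first by have := cA; lra.
  apply: bnd_le hD => n; rewrite /maj mulrDr mulrA nnn.
  by rewrite lerD2l mulrCA.
Qed.

Lemma maj_mono m m' : pos m -> ok m' -> (forall k, m k <= m' k) ->
  forall n, maj m n <= maj m' n.
Proof.
move=> m0 om' mm n; have [_ _ mX] := om'; rewrite lerD2l ler_wpM2l // ler_wpM2l ?mulr_ge0 //.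
exact: (@Q_le _ m m m' m' n (2 * A) (2 * A)) (ok_le om').
Qed.

Definition Mj j : nat -> R := iter j maj (fun=> 0).

Lemma Mj_ok j : ok (Mj j).
Proof.
elim: j => [|j IH]; last exact: maj_ok.
by split => // N; rewrite big1 ?mulr_ge0 // => k _; rewrite mulr0.
Qed.

Lemma Mj_nd j n : Mj j n <= Mj j.+1 n.
Proof.
elim: j n => [|j IH] n; first by have [h _ _] := Mj_ok 1; exact: h.
by have [m0 _ _] := Mj_ok j; exact: (maj_mono m0 (Mj_ok j.+1) IH n).
Qed.

(* The limit Ml dominates the iterates uniformly in time, and its increments
   dominate theirs: this replaces a contraction argument. *)
Definition Ml (n : nat) : R := limn (fun j => Mj j n).

Lemma Mj_cvg n : (fun j => Mj j n) @ \oo --> Ml n.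
Proof.
have : cvgn (fun j => Mj j n); last by move=> h; exact: h.
apply: nondecreasing_is_cvgn; first by apply/nondecreasing_seqP => j; exact: Mj_nd.
by exists (2 * A) => _ [j _ <-]; apply: ok_le; exact: Mj_ok.
Qed.

Lemma Mj_le j n : Mj j n <= Ml n.
Proof.
apply: (@nondecreasing_cvgn_le _ (fun j => Mj j n)).
  by apply/nondecreasing_seqP => i; exact: Mj_nd.
by apply/cvg_ex; eexists; exact: Mj_cvg.
Qed.

Lemma Ml_ok : ok Ml.
Proof.
split.
- by move=> n; apply: le_trans (Mj_le 0 n).
- apply/cvg_lim => //; rewrite (_ : (fun j => _) = fun=> 0); first exact: cvg_cst.
  by apply/funext => j; case: (Mj_ok j).
- move=> N; have h : (fun j => \sum_(k < N) k%:R * Mj j k) @ \oo --> \sum_(k < N) k%:R * Ml k.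
    have := @cvg_psum R nat \oo _ (fun k j => k%:R * Mj j k) (fun k => k%:R * Ml k) N.
    by apply => k; apply: cvgMr; exact: Mj_cvg.
  move: (h) => /cvg_lim <- //; apply: limr_le; first by apply/cvg_ex; eexists; exact: h.
  by apply: nearW => j; case: (Mj_ok j).
Qed.

Let Ml0 : pos Ml. Proof. by case: Ml_ok. Qed.
Let MlX : bnd (fun k => k%:R * Ml k) (2 * A). Proof. by case: Ml_ok. Qed.
Let MlB k : Ml k <= 2 * A. Proof. exact: ok_le Ml_ok k. Qed.

Definition Pj j : nat -> R -> R[i] := iter j (step al) (fun _ _ => 0).

Lemma Pj_inv j : (forall n, ccont (Pj j n)) /\ (forall n t, nrm (Pj j n t) <= Mj j n).
Proof.
elim: j => [|j [cP nP]].
  by split => [n|n t]; [exact: ccont_cst|rewrite nrm0].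
have [m0 mz mX] := Mj_ok j; have mB := ok_le (Mj_ok j).
have cN n : ccont (fun s => nl ((Pj j)^~ s) n) by exact: nl_ccont nP mX mB.
split => [n|n t]; first exact: cduh_cont.
apply: (@step_nrm _ al (Mj j) (Pj j) n t (2 * A) (2 * A)) => //.
by apply: ccont_cmeas => //; exact: measurable_itv.
Qed.

Let Pj_cont j n : ccont (Pj j n). Proof. by case: (Pj_inv j). Qed.
Let Pj_nrm j n t : nrm (Pj j n t) <= Mj j n. Proof. by case: (Pj_inv j). Qed.

Let nl_meas x n t : (forall k, ccont (x k)) -> (forall k t, nrm (x k t) <= Ml k) ->
  cmeas `[0, t] (fun s => nl (x^~ s) n).
Proof.
move=> cx xm; apply: ccont_cmeas; first exact: measurable_itv.
exact: nl_ccont xm MlX MlB.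
Qed.

Let Pj_Ml j n t : nrm (Pj j n t) <= Ml n.
Proof. exact: le_trans (Pj_nrm j n t) (Mj_le j n). Qed.

(** The increments of the majorants reproduce themselves: for d = M' - M, bilinearity gives Q(M', d)
    + Q(d, M) = Q(M', M') - Q(M, M), which is what the next majorant increment contains. *)
Lemma Pj_diff j n t : nrm (Pj j.+1 n t - Pj j n t) <= Mj j.+1 n - Mj j n.
Proof.
elim: j n t => [|j IH] n t; first by rewrite /= subr0 subr0; exact: Pj_nrm 1 n t.
have [m0 mz mX] := Mj_ok j; have mB := ok_le (Mj_ok j).
have [M0 Mz MX] := Mj_ok j.+1; have MB := ok_le (Mj_ok j.+1).
have t0 := max0_ge t; have n0 : 0 <= (n%:R : R) by [].
pose d k := Mj j.+1 k - Mj j k.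
have d0 : pos d by move=> k; rewrite subr_ge0 Mj_nd.
have dM k : d k <= Mj j.+1 k by rewrite gerBl m0.
have dX : bnd (fun k => k%:R * d k) (2 * A) by apply: bnd_le MX => k; rewrite ler_wpM2l.
have dB k : d k <= 2 * A by exact: le_trans (dM k) (MB k).
have h := @duh_diff R al 0 (Num.max t 0) (Mj j.+1) (Mj j) d (Pj j.+1) (Pj j) n (Num.max t 0)
   (2 * A) (2 * A) (lexx 0) d0 (nl_meas _ _ (Pj_cont _) (Pj_Ml _)) (nl_meas _ _ (Pj_cont _) (Pj_Ml _)).
apply: le_trans (h _ _ _ _ _ _ _ _ _ _) _ => //.
- by move=> k s _; rewrite mul0r expR0 mul1r; exact: IH.
- by rewrite max0_ge lexx.
rewrite mul0r expR0 mulr1 addr0.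
have e : Q (Mj j.+1) d n + Q d (Mj j) n = Q (Mj j.+1) (Mj j.+1) n - Q (Mj j) (Mj j) n.
  rewrite /Q -(tsumD (Q_summ n M0 d0 MX dB) (Q_summ n d0 m0 dX mB)).
  rewrite -(tsumB (Q_summ n M0 M0 MX MB) (Q_summ n m0 m0 mX mB)).
  by congr tsum; apply/funext => k; rewrite /d; ring.
rewrite e -[Mj j.+2 n]/(maj (Mj j.+1) n) -[Mj j.+1 n]/(maj (Mj j) n) /maj.
by rewrite le_eqVlt; apply/orP; left; apply/eqP; ring.
Qed.

Definition sol (n : nat) (t : R) : R[i] :=
  limn (fun j => complex.Re (Pj j n t)) +i* limn (fun j => complex.Im (Pj j n t)).

(** Real and imaginary parts converge separately, each within Ml - Mj; hence the factor 2. *)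
Lemma sol_dist j n t : nrm (Pj j n t - sol n t) <= 2 * (Ml n - Mj j n).
Proof.
have h1 := @cvg_dominated_increments R (fun j => complex.Re (Pj j n t)) (fun j => Mj j n) (Ml n).
have h2 := @cvg_dominated_increments R (fun j => complex.Im (Pj j n t)) (fun j => Mj j n) (Ml n).
have [_ r1] : (fun j => complex.Re (Pj j n t)) @ \oo --> limn (fun j => complex.Re (Pj j n t)) /\
    forall j, `|complex.Re (Pj j n t) - limn (fun j => complex.Re (Pj j n t))| <= Ml n - Mj j n.
  apply: h1 => [i|]; last exact: Mj_cvg.
  by rewrite -ReN -ReD; apply: le_trans (Re_le_nrm _) (Pj_diff _ _ _).
have [_ r2] : (fun j => complex.Im (Pj j n t)) @ \oo --> limn (fun j => complex.Im (Pj j n t)) /\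
    forall j, `|complex.Im (Pj j n t) - limn (fun j => complex.Im (Pj j n t))| <= Ml n - Mj j n.
  apply: h2 => [i|]; last exact: Mj_cvg.
  by rewrite -ImN -ImD; apply: le_trans (Im_le_nrm _) (Pj_diff _ _ _).
apply: le_trans (nrm_le_ReIm _) _; rewrite !ReImE /=.
by have := r1 j; have := r2 j; lra.
Qed.

Let gap_cvg n : (fun j => 2 * (Ml n - Mj j n)) @ \oo --> (0 : R).
Proof.
have : (fun j => 2 * (Ml n - Mj j n)) @ \oo --> 2 * (Ml n - Ml n).
  by apply: cvgMr; apply: cvgB; [exact: cvg_cst|exact: Mj_cvg].
by rewrite subrr mulr0.
Qed.

Lemma sol_cont n : ccont (sol n).
Proof.
split.
  apply: (@uniform_cont _ (fun j t => complex.Re (Pj j n t)) _ _ _ _ (gap_cvg n)).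
    by move=> j; case: (Pj_cont j n).
  by move=> j t; rewrite -ReN -ReD; apply: le_trans (Re_le_nrm _) (sol_dist _ _ _).
apply: (@uniform_cont _ (fun j t => complex.Im (Pj j n t)) _ _ _ _ (gap_cvg n)).
  by move=> j; case: (Pj_cont j n).
by move=> j t; rewrite -ImN -ImD; apply: le_trans (Im_le_nrm _) (sol_dist _ _ _).
Qed.

Lemma sol_nrm n t : nrm (sol n t) <= Ml n.
Proof.
rewrite -subr_le0; apply: (le0_cvg _ (gap_cvg n)) => j.
have := nrmB (Pj j n t) (Pj j n t - sol n t).
rewrite opprB addrC subrK => h.
by have := sol_dist j n t; have := Pj_Ml j n t; lra.
Qed.

(** Compare both sides with the iterate j + 1. The gaps 2 (Ml - Mj) tend to 0 coefficient by
    coefficient and stay below 2 Ml, so the two Q terms of the Lipschitz bound tend to 0 by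
    dominated convergence. *)
Lemma sol_fixed n t : sol n t = step al sol n t.
Proof.
apply/eqP; rewrite -subr_eq0; apply/eqP; apply: nrm_eq0.
apply/eqP; rewrite eq_le nrm_ge0 andbT.
pose d j k := 2 * (Ml k - Mj j k).
have d0 j : pos (d j) by move=> k; rewrite mulr_ge0 // subr_ge0 Mj_le.
have dM j k : d j k <= 2 * Ml k.
  by rewrite ler_wpM2l // gerBl; case: (Mj_ok j) => h _ _; exact: h.
have MX2 : bnd (fun k => k%:R * (2 * Ml k)) (2 * (2 * A)).
  by apply: bnd_le (bndZ (ler0n R 2) MlX) => k; rewrite mulrCA.
have MB2 k : 2 * Ml k <= 2 * (2 * A) by rewrite ler_wpM2l.
have A22 : 2 * A <= 2 * (2 * A) by have := A0; lra.
have dX j : bnd (fun k => k%:R * d j k) (2 * (2 * A)).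
  by apply: bnd_le MX2 => k; rewrite ler_wpM2l.
have dB j k : d j k <= 2 * (2 * A) by exact: le_trans (dM j k) (MB2 k).
have MX' : bnd (fun k => k%:R * Ml k) (2 * (2 * A)) by exact: bnd_leS MlX.
have MB' k : Ml k <= 2 * (2 * A) by exact: le_trans (MlB k) A22.
apply: (@le0_cvg _ _ (fun j => d j.+1 n + n%:R / n%:R * (2 * c * (Q Ml (d j) n + Q (d j) Ml n)))).
  move=> j.
  have e3 (p q r : R[i]) : p - q = - (r - p) + (r - q) by ring.
  rewrite (e3 _ _ (Pj j.+1 n t)).
  apply: le_trans (nrmD _ _) _; rewrite nrmN; apply: lerD; first exact: sol_dist.
  have h := @duh_diff R al 0 (Num.max t 0) Ml Ml (d j) (Pj j) sol n (Num.max t 0)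
     (2 * (2 * A)) (2 * (2 * A)) (lexx 0) (d0 j) (nl_meas _ _ (Pj_cont _) (Pj_Ml _))
     (nl_meas _ _ sol_cont sol_nrm).
  apply: le_trans (h _ _ _ _ _ _ _ _ _ _) _ => //.
  - by move=> k s _; exact: sol_nrm.
  - by move=> k s _; rewrite mul0r expR0 mul1r; exact: sol_dist.
  - by rewrite max0_ge lexx.
  - by rewrite mul0r expR0 mulr1 addr0.
rewrite -[X in _ --> X](addr0 (0 : R)); apply: cvgD.
  have := gap_cvg n; rewrite -(cvg_shiftS (fun j => 2 * (Ml n - Mj j n))).
  exact.
have dc k : (fun j => d j k) @ \oo --> (0 : R) := gap_cvg k.
rewrite -[X in _ --> X](mulr0 (n%:R / n%:R)); apply: cvgMr.
rewrite -[X in _ --> X](mulr0 (2 * c)); apply: cvgMr.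
rewrite -[X in _ --> X](addr0 (0 : R)); apply: cvgD.
  exact: (@Q_cvg0_r _ Ml d (fun k => 2 * Ml k) n _ _ Ml0 d0 dM MX' MB2 dc).
exact: (@Q_cvg0_l _ Ml d (fun k => 2 * Ml k) n _ _ Ml0 d0 dM MX2 MB' dc).
Qed.

Lemma sol00 t : sol 0 t = 0.
Proof.
apply: nrm_eq0; apply/eqP; rewrite eq_le nrm_ge0 andbT.
by apply: le_trans (sol_nrm _ _) _; case: Ml_ok => _ ->.
Qed.

Section Energy.
Variable T : R.
Hypothesis T0 : 0 <= T.

Let mE : measurable (`[0, T]%classic : set R). Proof. exact: measurable_itv. Qed.

Definition zint x (k : nat) := II `[0, T] (fun t => nrm (x k t)).

Let z0 x : pos (zint x).
Proof. by move=> k; apply: II_ge0 => s _; exact: nrm_ge0. Qed.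

Let zB x : (forall k, ccont (x k)) -> (forall k t, nrm (x k t) <= Ml k) ->
  forall k, zint x k <= 2 * A * T.
Proof.
move=> cx xm k; rewrite -II_cst //; apply: II_le => //.
- by apply: intg_cont; exact: ccont_nrm.
- by apply: intg_cont; exact: cont_cst.
- by move=> s _; apply: le_trans (xm k s) (MlB k).
Qed.

Let energy0 x : (forall k, ccont (x k)) -> (forall k t, nrm (x k t) <= Ml k) ->
  forall n, nrm (step al x n T) + n%:R * II `[0, T] (fun t => nrm (step al x n t)) <=
    nrm (al n) + 2 * c * n%:R * Q Ml (zint x) n.
Proof.
move=> cx xm n.
have := @energy_Q R al Ml x n 0 T (2 * A) (2 * A) cx xm MlX MlB T0 (ler0n R n).
rewrite mul0r expR0 mul1r subr0.
have e (f : R -> R) : (fun t => expR (0 * t) * f t) = f.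
  by apply/funext => t; rewrite mul0r expR0 mul1r.
rewrite e (_ : (fun k => II _ _) = zint x) //.
by apply/funext => k; rewrite e.
Qed.

Let z_Q x Z : (forall k, ccont (x k)) -> (forall k t, nrm (x k t) <= Ml k) ->
  bnd (fun k => k%:R ^+ 2 * zint x k) Z ->
  bnd (fun n => n%:R ^+ 2 * Q Ml (zint x) n) (2 * A * Z).
Proof.
move=> cx xm zZ.
apply: (@Q_bnd _ Ml (zint x) (fun n => n%:R ^+ 2) (fun n => n%:R ^+ 2 * zint x n)
   (2 * A) Z (2 * A * T)) => //.
- exact: zB.
- by move=> n k; rewrite ler_wpM2r ?z0 // lerXn2r ?nnegrE // ler_nat leq_addr.
- by move=> k; rewrite mulr_ge0 ?exprn_ge0 ?z0.
Qed.

(** Multiply the energy inequality with b = 0 by n and sum; the induction closes with the same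
    numbers as the ball. The bound does not depend on T, which later yields integrability on the
    half-line, and it supplies the finiteness that absorption requires. *)
Lemma Pj_z j : bnd (fun k => k%:R ^+ 2 * zint (Pj j) k) (2 * A).
Proof.
elim: j => [|j IH].
  move=> N; rewrite big1 ?mulr_ge0 // => k _.
  rewrite /zint (_ : (fun t => _) = fun=> 0); first by rewrite II_cst // mul0r mulr0.
  by apply/funext => t; exact: (nrm0 R).
have h := energy0 (Pj_cont j) (Pj_Ml j).
have hQ := z_Q (Pj_cont j) (Pj_Ml j) IH.
have c20 : 0 <= 2 * c by rewrite mulr_ge0.
apply: (@bnd_leS _ _ (A + 2 * c * (2 * A * (2 * A)))); first by have := cA; lra.
apply: bnd_le (bndD alA (bndZ c20 hQ)) => n.
have n0 : 0 <= (n%:R : R) by [].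
have e : n%:R * (n%:R * zint (Pj j.+1) n) <= n%:R * (nrm (al n) + 2 * c * n%:R * Q Ml (zint (Pj j)) n).
  by rewrite ler_wpM2l //; apply: le_trans (h n); rewrite lerDr nrm_ge0.
by move: e; rewrite expr2; lra.
Qed.

(** For N fixed modes the iterates converge uniformly on [0, T], with an error proportional to T; j
    tends to infinity while N and T are fixed. *)
Lemma sol_z : bnd (fun k => k%:R ^+ 2 * zint sol k) (2 * A).
Proof.
move=> N; rewrite -subr_le0.
apply: (@le0_cvg _ _ (fun j => \sum_(k < N) k%:R ^+ 2 * (2 * (Ml k - Mj j k) * T))).
  move=> j; rewrite lerBlDl.
  apply: (@le_trans _ _ (\sum_(k < N) (k%:R ^+ 2 * zint (Pj j) k +
     k%:R ^+ 2 * (2 * (Ml k - Mj j k) * T)))).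
    apply: ler_sum => k _; rewrite -mulrDr ler_wpM2l ?exprn_ge0 //.
    have cP : intg `[0, T] (fun t => nrm (Pj j k t)) by apply: intg_cont; exact: ccont_nrm.
    have cC : intg `[0, T] (fun _ : R => 2 * (Ml k - Mj j k)) by apply: intg_cont; exact: cont_cst.
    rewrite -II_cst // -II_D //; apply: II_le => //.
    - by apply: intg_cont; apply: ccont_nrm; exact: sol_cont.
    - exact: intg_D.
    - move=> s _; have := nrmB (Pj j k s) (Pj j k s - sol k s).
      by rewrite opprB addrC subrK; have := sol_dist j k s; lra.
  by rewrite big_split /= lerD2r; exact: Pj_z.
have := @cvg_psum R nat \oo _ (fun k j => k%:R ^+ 2 * (2 * (Ml k - Mj j k) * T)) (fun=> 0) N.
have -> : \sum_(k < N) (fun=> 0 : R) k = 0 by rewrite big1.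
apply => k; rewrite -[X in _ --> X](mulr0 (k%:R ^+ 2)); apply: cvgMr.
by rewrite -[X in _ --> X](mul0r T); apply: cvgMl; exact: gap_cvg.
Qed.

(** With Z the exact value of sum_n n^2 int |x_n|, the interaction is at most 2 c (2 A) Z <= Z.
    Since Z is finite by [sol_z], it cancels against the dissipation and leaves A without any loss
    of constant. *)
Lemma sol_A1 : bnd (fun n => n%:R * nrm (sol n T)) A.
Proof.
have h := energy0 sol_cont sol_nrm.
have sz : summ (fun k => k%:R ^+ 2 * zint sol k).
  by apply: (summ_nneg _ sol_z) => k; rewrite mulr_ge0 ?exprn_ge0 ?z0.
set Z := tsum (fun k => k%:R ^+ 2 * zint sol k).
have zZ : bnd (fun k => k%:R ^+ 2 * zint sol k) Z.
  by apply: bnd_tsum => // k; rewrite mulr_ge0 ?exprn_ge0 ?z0.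
have Z0 : 0 <= Z := bnd_ge0 zZ.
have hQ := z_Q sol_cont sol_nrm zZ.
have c20 : 0 <= 2 * c by rewrite mulr_ge0.
have hb : bnd (fun n => n%:R * nrm (sol n T) + n%:R ^+ 2 * zint sol n) (A + Z).
  have hD := bndD alA (bndZ c20 hQ).
  apply: (@bnd_leS _ _ (A + 2 * c * (2 * A * Z))).
    rewrite lerD2l mulrA -[leRHS]mul1r ler_wpM2r //.
    have : 2 * c * (2 * A) <= 1 * (2 * A) by rewrite ler_wpM2r // mulr_ge0.
    have := A0; have := A4; lra.
  apply: bnd_le hD => n.
  have := h n; rewrite -sol_fixed (_ : (fun t => nrm (step al sol n t)) = (fun t => nrm (sol n t))); last first.
    by apply/funext => t; rewrite -sol_fixed.
  rewrite -/(zint sol n) => hn.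
  have n0 : 0 <= (n%:R : R) by [].
  by have := ler_wpM2l n0 hn; rewrite expr2; lra.
have p0 n : 0 <= n%:R * nrm (sol n T) by rewrite mulr_ge0 ?nrm_ge0.
have sp : summ (fun n => n%:R * nrm (sol n T)).
  apply: (summ_nneg p0 (S := A + Z)); apply: bnd_le hb => n.
  by rewrite lerDl mulr_ge0 ?exprn_ge0 ?z0.
move=> N; apply: le_trans (bnd_tsum p0 sp N) _.
have : tsum (fun n => n%:R * nrm (sol n T) + n%:R ^+ 2 * zint sol n) <= A + Z.
  by apply: tsum_le hb; exact: summD.
by rewrite tsumD // lerD2r.
Qed.

(** For n >= 1 and b >= 0, n - b >= (1 - b) n. With b = 1 - 4 A the dissipation is thus at least 4 A
    W, where W = sum_n n int exp (b t) |x_n|, and it absorbs the interaction 2 c (2 A) W. *)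
Lemma sol_A0 (S0 : R) : bnd (fun n => nrm (al n)) S0 ->
  bnd (fun n => nrm (sol n T)) (S0 * expR (- ((1 - 4 * A) * T))).
Proof.
move=> hS0; pose b := 1 - 4 * A.
have b0 : 0 <= b by rewrite subr_ge0 ltW.
have b1 : b <= 1 by rewrite gerBl mulr_ge0.
pose ze k := II `[0, T] (fun t => expR (b * t) * nrm (sol k t)).
have ze0 : pos ze by move=> k; apply: II_ge0 => s _; rewrite mulr_ge0 ?expR_ge0 ?nrm_ge0.
have zez : ze 0%N = 0.
  rewrite /ze (_ : (fun t => _) = fun=> 0); first by rewrite II_cst // mul0r.
  by apply/funext => t; rewrite sol00 nrm0 mulr0.
have ce k : continuous (fun t => expR (b * t) * nrm (sol k t)).
  by apply: cont_mulf; [exact: cont_expl|apply: ccont_nrm; exact: sol_cont].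
have E0 := expR_ge0 (b * T).
(* Growth in T is harmless: this bound ensures that W is finite, and W cancels at the end. *)
have zeM k : ze k <= expR (b * T) * T * Ml k.
  rewrite mulrAC -II_cst //; apply: II_le => //.
  - exact: intg_cont.
  - by apply: intg_cont; exact: cont_cst.
  - move=> s /=; rewrite in_itv /= => /andP[s0 sT].
    by apply: ler_pM; rewrite ?expR_ge0 ?nrm_ge0 ?sol_nrm // ler_expR ler_wpM2l.
have eT0 : 0 <= expR (b * T) * T by rewrite mulr_ge0.
have zeB : bnd (fun k => k%:R * ze k) (expR (b * T) * T * (2 * A)).
  by apply: bnd_le (bndZ eT0 MlX) => k; rewrite mulrCA ler_wpM2l.
have sze := summ_nneg (kpos ze0) zeB.
set W := tsum (fun k => k%:R * ze k).
have zeW : bnd (fun k => k%:R * ze k) W by apply: bnd_tsum => //; exact: kpos.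
have W0 := bnd_ge0 zeW.
have hQ : bnd (fun n => n%:R * Q Ml ze n) (2 * A * W).
  apply: (@Q_bnd _ Ml ze (fun n => n%:R) (fun n => n%:R * ze n) (2 * A) W (expR (b * T) * T * (2 * A))) => //.
  - by move=> k; apply: le_trans (zeM k) _; rewrite ler_wpM2l.
  - by move=> n k; rewrite ler_wpM2r // ler_nat leq_addr.
  - exact: kpos.
have c20 : 0 <= 2 * c by rewrite mulr_ge0.
have e0 n : 0 <= expR (b * T) * nrm (sol n T) by rewrite mulr_ge0 ?nrm_ge0.
have hb : bnd (fun n => expR (b * T) * nrm (sol n T) + (1 - b) * (n%:R * ze n)) (S0 + (1 - b) * W).
  have hD := bndD hS0 (bndZ c20 hQ).
  apply: (@bnd_leS _ _ (S0 + 2 * c * (2 * A * W))).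
    rewrite lerD2l mulrA ler_wpM2r // /b.
    have : 2 * c * (2 * A) <= 1 * (2 * A) by rewrite ler_wpM2r // mulr_ge0.
    have := A0; lra.
  apply: bnd_le hD => -[|n].
    by rewrite sol00 zez nrm0 !mulr0 !mul0r !mulr0 !addr0 nrm_ge0.
  have bn : b <= n.+1%:R by apply: le_trans b1 _; rewrite ler1n.
  have := @energy_Q R al Ml sol n.+1 b T (2 * A) (2 * A) sol_cont sol_nrm MlX MlB T0 bn.
  rewrite -sol_fixed (_ : (fun t => _ * nrm (step al sol n.+1 t)) =
     (fun t => expR (b * t) * nrm (sol n.+1 t))); last first.
    by apply/funext => t; rewrite -sol_fixed.
  rewrite -/(ze n.+1) -/ze => hn.
  have : (1 - b) * (n.+1%:R * ze n.+1) <= (n.+1%:R - b) * ze n.+1.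
    rewrite mulrA ler_wpM2r ?ze0 //.
    have : 0 <= b * (n.+1%:R - 1) by rewrite mulr_ge0 // subr_ge0 ler1n.
    lra.
  by move: hn; rewrite -[2 * c * n.+1%:R * _]mulrA; lra.
have sq : summ (fun n => (1 - b) * (n%:R * ze n)) by exact: summZ.
have sp : summ (fun n => expR (b * T) * nrm (sol n T)).
  apply: (summ_nneg e0 (S := S0 + (1 - b) * W)); apply: bnd_le hb => n.
  by rewrite lerDl !mulr_ge0 ?ze0 // subr_ge0.
have hp : tsum (fun n => expR (b * T) * nrm (sol n T)) <= S0.
  have : tsum (fun n => expR (b * T) * nrm (sol n T) + (1 - b) * (n%:R * ze n)) <= S0 + (1 - b) * W.
    by apply: tsum_le hb; exact: summD.
  by rewrite tsumD // (tsumZ (1 - b) sze) lerD2r.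
move=> N; have := le_trans (bnd_tsum e0 sp N) hp.
rewrite -mulr_sumr => hN.
rewrite expRN -/b ler_pdivlMr ?expR_gt0 // mulrC; exact: hN.
Qed.

End Energy.
End Picard.

Lemma cvg_seqsum (R : realType) (I : Type) (s : seq I) (u : I -> nat -> R) (l : I -> R) :
  (forall i, u i @ \oo --> l i) ->
  (fun j => \sum_(i <- s) u i j) @ \oo --> \sum_(i <- s) l i.
Proof.
move=> ul; elim: s => [|i s IH].
  by under eq_fun do rewrite big_nil; rewrite big_nil; exact: cvg_cst.
by under eq_fun do rewrite big_cons; rewrite big_cons; exact: cvgD.
Qed.

(** * Additivity of integrals over sets, and integrals over the half-line *)

Section SetIntegrals.
Variable R : realType.
Implicit Types (U : set R) (g : R -> R) (F : nat -> set R).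
Notation mu := (@lebesgue_measure R).

Lemma II_EFin U g : measurable U -> intg U g ->
  (II U g)%:E = (\int[mu]_(x in U) (g x)%:E)%E.
Proof. by move=> mU ig; rewrite /Rintegral fineK //; exact: integrable_fin_num. Qed.

Lemma intg_sub U V g : measurable U -> measurable V -> V `<=` U -> intg U g -> intg V g.
Proof. by move=> mU mV VU ig; exact: integrableS ig. Qed.

Lemma II_disjoint_le n (E : 'I_n -> set R) U g : measurable U ->
  (forall i, measurable (E i)) -> (forall i, E i `<=` U) -> trivIset setT E ->
  intg U g -> (forall x, U x -> 0 <= g x) -> \sum_(i < n) II (E i) g <= II U g.
Proof.
move=> mU mE EU tE ig g0; rewrite -lee_fin -sumEFin II_EFin //.
have -> : (\sum_(i < n) (II (E i) g)%:E = \sum_(i < n) \int[mu]_(x in E i) (g x)%:E)%E.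
  by apply: eq_bigr => i _; rewrite II_EFin //; exact: intg_sub ig.
have sub : \big[setU/set0]_(i <- index_enum 'I_n) E i `<=` U.
  by apply: (big_ind (fun A => A `<=` U)) => // A B hA hB x [/hA|/hB].
have mD : measurable (\big[setU/set0]_(i <- index_enum 'I_n) E i).
  by apply: (big_ind measurable) => // A B; exact: measurableU.
have mg := measurable_int mu ig.
rewrite -(@ge0_integral_bigsetU _ _ _ mu _ E (EFin \o g) (index_enum 'I_n)) //.
- by apply: ge0_subset_integral.
- exact: index_enum_uniq.
- exact: sub_trivIset tE.
- exact: measurable_funS mg.
- by move=> x /sub /g0; rewrite /= lee_fin.
Qed.

Lemma II_bigcup_cvg_ge0 F g : (forall k, measurable (F k)) -> trivIset setT F ->
  intg (\bigcup_k F k) g -> (forall x, 0 <= g x) ->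
  (fun n => \sum_(k < n) II (F k) g) @ \oo --> II (\bigcup_k F k) g.
Proof.
move=> mF tF ig g0.
have mU : measurable (\bigcup_k F k) by exact: bigcup_measurable.
have iF k : intg (F k) g by apply: intg_sub ig => //; exact: bigcup_sup.
have := @ge0_integral_bigcup _ _ _ mu F (EFin \o g) mF (measurable_int mu ig)
  (fun x _ => _) tF.
move=> /(_ (fun x => _)) h.
have e : (\int[mu]_(x in \bigcup_k F k) (EFin \o g) x)%E =
    (\sum_(0 <= i <oo) \int[mu]_(x in F i) (EFin \o g) x)%E.
  by apply: h => x; rewrite lee_fin.
have c1 : (fun n => (\sum_(0 <= i < n) \int[mu]_(x in F i) (EFin \o g) x)%E) @ \oo -->
   (II (\bigcup_k F k) g)%:E.
  rewrite II_EFin // e; apply: is_cvg_nneseries => k _ _.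
  by apply: integral_ge0 => x _; rewrite lee_fin.
have /fine_cvgP[_] := c1; apply: cvg_trans; apply: near_eq_cvg; apply: nearW => n /=.
rewrite big_mkord -[RHS]/(fine (\sum_(k < n) II (F k) g)%:E) -sumEFin; congr fine.
by apply: eq_bigr => k _; rewrite II_EFin.
Qed.

Lemma II_bigcup_cvg F g : (forall k, measurable (F k)) -> trivIset setT F ->
  intg (\bigcup_k F k) g ->
  (fun n => \sum_(k < n) II (F k) g) @ \oo --> II (\bigcup_k F k) g.
Proof.
move=> mF tF ig.
have mU : measurable (\bigcup_k F k) by exact: bigcup_measurable.
have sF k : F k `<=` \bigcup_k F k by exact: bigcup_sup.
have ign := intg_norm ig; have igs := intg_D mU ig ign.
have c1 := @II_bigcup_cvg_ge0 F (fun x => `|g x|) mF tF ign (fun x => normr_ge0 _).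
have c2 := @II_bigcup_cvg_ge0 F (fun x => g x + `|g x|) mF tF igs.
have e V : measurable V -> intg V g -> II V g = II V (fun x => g x + `|g x|) - II V (fun x => `|g x|).
  by move=> mV iV; rewrite II_D // ?addrK //; exact: intg_norm.
rewrite e //.
have -> : (fun n => \sum_(k < n) II (F k) g) = (fun n => \sum_(k < n) II (F k) (fun x => g x + `|g x|) -
   \sum_(k < n) II (F k) (fun x => `|g x|)).
  apply/funext => n; rewrite -sumrB; apply: eq_bigr => k _.
  by apply: e; [exact: mF|exact: (intg_sub mU (mF k) (sF k) ig)].
apply: cvgB => //; apply: c2 => x.
by have := ler_norm (- g x); rewrite normrN; lra.
Qed.

Lemma measurable_Rplus : measurable (@Rplus R).
Proof.
have -> : @Rplus R = [set` `[0, +oo[].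
  by apply/seteqP; split => x; rewrite /Rplus /= in_itv /= andbT.
exact: measurable_itv.
Qed.

Lemma Rplus_bigcup : @Rplus R = \bigcup_(i : nat) (`[0, i%:R]%classic : set R).
Proof.
apply/seteqP; split => [x x0|x [i _]]; last by rewrite /= in_itv /= => /andP[].
exists (Num.trunc x).+1 => //=; rewrite in_itv /=; apply/andP; split => //.
by have /andP[_ /ltW] := trunc_itv x0.
Qed.

Lemma II_Rplus g Z : continuous g -> (forall x, 0 <= g x) ->
  (forall T, 0 <= T -> II `[0, T] g <= Z) ->
  intg (@Rplus R) g /\ (fun i : nat => II `[0, i%:R] g) @ \oo --> II (@Rplus R) g.
Proof.
move=> cg g0 gZ; have mR := measurable_Rplus.
have mg : measurable_fun (@Rplus R) (EFin \o g).
  by apply/measurable_EFinP; exact: cont_meas.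
have hF : {homo (fun i : nat => (`[0, i%:R]%classic : set R)) : n m / (n <= m)%N >-> (n <= m)%O}.
  move=> n m nm; apply/subsetPset => x /=; rewrite !in_itv /= => /andP[-> xn] /=.
  by apply: le_trans xn _; rewrite ler_nat.
have c1 := @ge0_nondecreasing_set_cvg_integral _ (measurableTypeR R) R (fun i : nat => (`[0, i%:R]%classic : set R)) (EFin \o g) mu hF
  (fun i => measurable_itv _).
have : (\int[mu]_(x in `[0%R, i%:R]) (EFin \o g) x)%E @[i --> \oo] -->
    (\int[mu]_(x in @Rplus R) (EFin \o g) x)%E.
  rewrite Rplus_bigcup; apply: c1 => [i|i x _]; last by rewrite lee_fin.
  by apply/measurable_EFinP; apply: cont_meas => //; exact: measurable_itv.
have e (i : nat) : (\int[mu]_(x in `[0%R, i%:R]) (EFin \o g) x)%E = (II `[0, i%:R] g)%:E.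
  by rewrite II_EFin //; exact: intg_cont.
under eq_fun do rewrite e.
move=> c2.
have fin : (\int[mu]_(x in @Rplus R) (EFin \o g) x <= Z%:E)%E.
  move: (c2) => /cvg_lim <- //; apply: lime_le; first by apply/cvg_ex; eexists; exact: c2.
  by apply: nearW => i; rewrite lee_fin; exact: gZ.
have ig : intg (@Rplus R) g.
  apply/integrableP; split => //.
  under eq_integral do rewrite /= ger0_norm //.
  exact: le_lt_trans fin (ltry _).
split => //; move: c2; rewrite -[X in _ --> X](II_EFin mR ig) => /fine_cvgP[_].
exact.
Qed.

End SetIntegrals.

Section Duhamel.
Variable R : realType.
Implicit Types (u : R -> R) (g : R -> R -> R).

Lemma wiener1_facts u : wiener 1 u -> [/\ continuous u, periodic u (2 * pi),
  fourier u 0 = 0 & exists S, bnd (fun k => k%:R * nrm (fourier u k)) S].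
Proof.
move=> wu; have [pu cu mu0 _] := wu; have [S _ hS] := @wiener_bnd R 1 u wu.
split => //; first exact: fourier0_mean.
exists S; apply: bnd_le hS => k; rewrite expr1 ler_peMl ?mulr_ge0 ?nrm_ge0 //.
by rewrite ler1n.
Qed.

Lemma wiener1_norm_bnd u S : wiener 1 u -> wiener_norm 1 u = S%:E ->
  bnd (fun k => k%:R * nrm (fourier u k)) (S / 2).
Proof.
move=> wu nu; have [cu _ u0 _] := wiener1_facts wu.
have /(@wiener_normP R 1 u S cu u0) h : (wiener_norm 1 u <= S%:E)%E by rewrite nu.
have h2 : 0 <= (2^-1 : R) by [].
by rewrite mulrC; apply: bnd_le (bndZ h2 h) => k; rewrite expr1 mulKf.
Qed.

Lemma wiener1_nonlinearity u (n : nat) : wiener 1 u ->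
  nonlinearity u n = nl (fun k => fourier u k) n.
Proof. by move=> /wiener1_facts[cu pu u0 [S hS]]; exact: nonlinearity_nl hS n. Qed.

Lemma wiener1_nonlinearityN u (n : nat) : wiener 1 u ->
  nonlinearity u (- n%:Z) = (nonlinearity u n)^*%C.
Proof. by move=> /wiener1_facts[cu pu u0 [S hS]]; exact: nonlinearityN hS n. Qed.

Lemma duhamel_cduh (f0 : R -> R) g t (n : nat) : (forall s, 0 <= s <= t -> wiener 1 (g s)) ->
  semigroup t (fourier f0) n +
    cintegral `[0, t] (fun s => semigroup (t - s) (nonlinearity (g s)) n) =
  cduh n%:R (fourier f0 n) (fun s => nl (fun k => fourier (g s) k) n) t.
Proof.
move=> wg; rewrite /semigroup /cduh ger0_norm // -pmulrn; congr (_ + _).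
apply: cint_ext => s /=; rewrite in_itv /= => hs.
by rewrite wiener1_nonlinearity //; exact: wg.
Qed.

End Duhamel.

(** * Existence *)

Section Existence.
Variable R : realType.
Notation c := (nc R).
Variables (f0 : R -> R) (S1 : R).
Hypotheses (wf0 : wiener 1 f0) (nf0 : wiener_norm 1 f0 = S1%:E) (S1lt : 2 * S1 < 1).

Let al (k : nat) : R[i] := fourier f0 k.
Let A := S1 / 2.

Let cf0 : continuous f0. Proof. by case: wf0. Qed.
Let al0 : al 0%N = 0. Proof. by apply: fourier0_mean; case: wf0. Qed.

Let alA : bnd (fun k => k%:R * nrm (al k)) A.
Proof. exact: wiener1_norm_bnd. Qed.

Let A4 : 4 * A < 1. Proof. by rewrite /A; move: S1lt; lra. Qed.
Let A0 : 0 <= A. Proof. exact: bnd_ge0 alA. Qed.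

Let m := Ml al.
Let m_ok : ok A m. Proof. exact: (Ml_ok al0 alA A4). Qed.
Let m0 : pos m. Proof. by case: m_ok. Qed.
Let mz : m 0%N = 0. Proof. by case: m_ok. Qed.
Let mX : bnd (fun k => k%:R * m k) (2 * A). Proof. by case: m_ok. Qed.

Let x (k : nat) (t : R) : R[i] := sol al k t.
Let x_cont k : ccont (x k). Proof. exact: (sol_cont al0 alA A4). Qed.
Let x_le k t : nrm (x k t) <= m k. Proof. exact: (sol_nrm al0 alA A4). Qed.
Let x0 t : x 0 t = 0. Proof. exact: (sol00 al0 alA A4). Qed.

Let mbnd : bnd m (2 * A).
Proof.
apply: bnd_le mX => -[|k]; first by rewrite mz mulr0.
by rewrite ler_peMl // ler1n.
Qed.

Let xbnd t : bnd (fun k => nrm (x k t)) (2 * A).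
Proof. exact: bnd_le (fun k => x_le k t) mbnd. Qed.

Definition fsol (t : R) : R -> R := synth (fun k => x k t).

Lemma fourier_fsol t (k : nat) : fourier (fsol t) k = x k t.
Proof. exact: (fourier_synth (xbnd t) (x0 t)). Qed.

Lemma fsol_wiener t : wiener 1 (fsol t).
Proof.
apply: (@synth_wiener R 1 (fun k => x k t) (2 * A) (x0 t)).
by apply: bnd_le mX => k; rewrite expr1 ler_wpM2l.
Qed.

Lemma fsol_norm1 t : 0 <= t -> (wiener_norm 1 (fsol t) <= S1%:E)%E.
Proof.
move=> t0; have [_ cf mu0 _] := fsol_wiener t.
apply/(@wiener_normP R 1) => //; first exact: fourier0_mean.
have h := sol_A1 al0 alA A4 t0.
have -> : S1 = 2 * A by rewrite /A; field.
apply: bnd_le (bndZ (ler0n R 2) h) => k.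
by rewrite fourier_fsol expr1.
Qed.

Lemma fsol_norm0 t S0 : 0 <= t -> (wiener_norm 0 f0 <= S0%:E)%E ->
  (wiener_norm 0 (fsol t) <= (S0 * expR (- ((1 - 2 * S1) * t)))%:E)%E.
Proof.
move=> t0 /(@wiener_normP R 0) h.
have h1 : bnd (fun k => nrm (al k)) (S0 / 2).
  have h2 : 0 <= (2^-1 : R) by [].
  rewrite mulrC; apply: bnd_le (bndZ h2 (h cf0 al0)) => k.
  by rewrite expr0 mul1r mulKf.
have [_ cf mu0 _] := fsol_wiener t.
apply/(@wiener_normP R 0) => //; first exact: fourier0_mean.
have h3 := sol_A0 al0 alA A4 t0 h1.
have -> : S0 * expR (- ((1 - 2 * S1) * t)) = 2 * (S0 / 2 * expR (- ((1 - 4 * A) * t))).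
  by rewrite (_ : 4 * A = 2 * S1); [field|rewrite /A; field].
apply: bnd_le (bndZ (ler0n R 2) h3) => k.
by rewrite fourier_fsol expr0 mul1r.
Qed.

Lemma synthB (a b : nat -> R[i]) S y : bnd (fun k => nrm (a k)) S -> bnd (fun k => nrm (b k)) S ->
  synth (fun k => a k - b k) y = synth a y - synth b y.
Proof.
move=> aS bS; rewrite !synthE -mulrBr -tsumB; [|exact: (summ_mode aS)|exact: (summ_mode bS)].
by congr (_ * tsum _); apply/funext => k; rewrite /mode mulrBl ReD ReN.
Qed.

Lemma wiener_norm_ge0 (p : R) (u : R -> R) : (0 <= wiener_norm p u)%E.
Proof. by apply: esum_ge0 => k _; rewrite lee_fin mulr_ge0 ?nrm_ge0 // powR_ge0. Qed.

Lemma synth_norm (p : nat) (a : nat -> R[i]) B : a 0%N = 0 ->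
  bnd (fun k => k%:R ^+ p * nrm (a k)) B -> (wiener_norm p%:R (synth a) <= (2 * B)%:E)%E.
Proof.
move=> a0 aB.
have aB' : bnd (fun k => nrm (a k)) B.
  apply: bnd_le aB => -[|k]; first by rewrite a0 nrm0 mulr0.
  by rewrite ler_peMl ?nrm_ge0 // exprn_ege1 // ler1n.
apply/wiener_normP; [exact: cont_synth aB'|by rewrite (fourier_synth aB')|].
by apply: bnd_le (bndZ (ler0n R 2) aB) => k; rewrite (fourier_synth aB').
Qed.

(** Continuity in time with values in A^1: each coefficient is continuous, and k m_k is a summable
    majorant independent of time. *)
Lemma fsol_cvg t (r : nat -> R) : r @ \oo --> t ->
  wiener_norm 1 (fun y => fsol (r j) y - fsol t y) @[j --> \oo] --> 0%E.
Proof.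
move=> cr.
pose u j k := k%:R * nrm (x k (r j) - x k t).
have u0 j k : 0 <= u j k by rewrite mulr_ge0 ?nrm_ge0.
have uM j k : `|u j k| <= 2 * (k%:R * m k).
  rewrite ger0_norm // /u mulrCA ler_wpM2l //.
  by apply: le_trans (nrmB _ _) _; have := x_le k (r j); have := x_le k t; lra.
have hB := bndZ (ler0n R 2) mX.
have uc k : (fun j => u j k) @ \oo --> (0 : R).
  rewrite -[X in _ --> X](mulr0 k%:R); apply: cvgMr.
  have cc : continuous (fun s => nrm (x k s - x k t)).
    apply: ccont_nrm; apply: ccontD => //; exact: ccont_cst.
  have := cvg_comp _ _ cr (cc t); rewrite subrr nrm0; exact.
have ht := tannery uM hB uc.
have e j : (wiener_norm 1 (fun y => (fsol (r j) y - fsol t y)%R) <= (2 * tsum (fun k => `|u j k|))%:E)%E.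
  have -> : (fun y => fsol (r j) y - fsol t y) = synth (fun k => x k (r j) - x k t).
    by apply/funext => y; rewrite (synthB y (xbnd _) (xbnd _)).
  apply: (@synth_norm 1 (fun k => x k (r j) - x k t)); first by rewrite !x0 subrr.
  have su : summ (fun k => `|u j k|).
    by apply: (@summ_le _ _ (fun k => 2 * (k%:R * m k)) (2 * (2 * A))) => // k; rewrite normr_id.
  have := bnd_tsum (fun k => normr_ge0 (u j k)) su.
  by apply: bnd_le => k; rewrite ger0_norm // /u expr1.
apply: (@squeeze_cvge _ _ _ _ (fun=> 0%E) _ (fun j => (2 * tsum (fun k => `|u j k|))%:E)).
- by apply: nearW => j; rewrite wiener_norm_ge0 /=; exact: e.
- exact: cvg_cst.
- apply: cvg_EFin; first exact: nearW.
  by rewrite -[X in _ --> X](mulr0 2); apply: cvgMr.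
Qed.

(** By continuity in time, step functions sampled at the left ends of the cells of a grid converge
    at every t >= 0. *)
Lemma fsol_strongly_measurable : strongly_measurable 1 fsol.
Proof.
(* These (j + 1)^2 cells of length 1 / (j + 1) cover [0, j + 1): the mesh tends to 0 and every time
   is eventually covered. *)
pose E j (i : 'I_(j.+1 * j.+1)) : set R := `[i%:R / j.+1%:R, i.+1%:R / j.+1%:R[%classic.
pose v j (i : 'I_(j.+1 * j.+1)) : R -> R := fsol (i%:R / j.+1%:R).
exists (fun j t y => \sum_(i < j.+1 * j.+1) \1_(E j i) t * v j i y); split.
  move=> j; exists (j.+1 * j.+1)%N, (@E j), (@v j); split.
  - by move=> i; exact: measurable_itv.
  - by move=> i; exact: fsol_wiener.
  - by [].
apply: aeW => t t0.
(* The left end of the cell that contains t. *)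
pose r (j : nat) : R := (Num.trunc (t * j.+1%:R))%:R / j.+1%:R.
have tr j : r j <= t < r j + j.+1%:R^-1.
  have p : 0 < (j.+1%:R : R) by rewrite ltr0n.
  have : 0 <= t * j.+1%:R by rewrite mulr_ge0.
  move=> /trunc_itv /andP[h1 h2].
  rewrite /r ler_pdivrMr // h1 /= -{2}[j.+1%:R^-1]mul1r -mulrDl ltr_pdivlMr //.
  by rewrite natr1.
have cr : r @ \oo --> t.
  apply: (@squeeze_cvgr _ _ _ _ (fun j => t - harmonic j) (fun=> t)).
  - by apply: nearW => j; have /andP[h1 h2] := tr j; rewrite /harmonic /= h1 andbT lerBlDr ltW.
  - rewrite -[X in _ --> X]subr0; apply: cvgB; [exact: cvg_cst|exact: cvg_harmonic].
  - exact: cvg_cst.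
suff ev j : (Num.trunc t <= j)%N -> forall y,
    \sum_(i < j.+1 * j.+1) \1_(@E j i) t * @v j i y = fsol (r j) y.
  have := fsol_cvg cr; apply: cvg_trans; apply: near_eq_cvg.
  exists (Num.trunc t); first exact: I.
  move=> j tj; congr wiener_norm; apply/funext => y; congr (_ - _).
  exact/esym/ev.
move=> tj y.
have p : 0 < (j.+1%:R : R) by rewrite ltr0n.
have tj1 : t < j.+1%:R.
  have /andP[_ h] := trunc_itv t0; apply: lt_le_trans h _.
  by rewrite ler_nat ltnS.
have tp : 0 <= t * j.+1%:R by rewrite mulr_ge0.
have hi : (Num.trunc (t * j.+1%:R) < j.+1 * j.+1)%N.
  by rewrite truncn_lt_nat // natrM ltr_pM2r.
rewrite (bigD1 (Ordinal hi)) //= big1 => [|i ne].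
  rewrite addr0 indicE mem_set ?mul1r // /E /= in_itv /=.
  have /andP[h1 h2] := trunc_itv tp.
  by rewrite ler_pdivrMr // h1 /= ltr_pdivlMr.
rewrite indicE memNset ?mul0r // /E /= in_itv /= => /andP[h1 h2].
move/eqP: ne; apply; apply/val_inj => /=; apply/esym/trunc_def.
by rewrite -ler_pdivrMr // h1 /= -ltr_pdivlMr.
Qed.

Let z (k : nat) : R := II (@Rplus R) (fun t => nrm (x k t)).

Let zk_bound k : exists Z, forall T, 0 <= T -> II `[0, T] (fun t => nrm (x k t)) <= Z.
Proof.
exists (2 * A) => T T0.
have h := sol_z al0 alA A4 T0.
case: k => [|k].
  rewrite (_ : (fun t => _) = fun=> 0); first by rewrite II_cst // mul0r mulr_ge0.
  by apply/funext => t; rewrite x0 nrm0.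
have p : pos (fun k : nat => k%:R ^+ 2 * zint T (sol al) k).
  by move=> i; rewrite mulr_ge0 ?exprn_ge0 //; apply: II_ge0 => s _; exact: nrm_ge0.
apply: le_trans (bnd_term k.+1 p h); rewrite ler_peMl ?exprn_ege1 ?ler1n //.
by apply: II_ge0 => s _; exact: nrm_ge0.
Qed.

Let x_intg_nrm k : intg (@Rplus R) (fun t => nrm (x k t)).
Proof.
have [Z hZ] := zk_bound k.
by have [] := II_Rplus (ccont_nrm (x_cont k)) (fun t => nrm_ge0 _) hZ.
Qed.

Let z_bnd : bnd (fun k => k%:R ^+ 2 * z k) (2 * A).
Proof.
move=> N.
have h : (fun i : nat => \sum_(k < N) k%:R ^+ 2 * II `[0, i%:R] (fun t => nrm (x k t))) @ \oo -->
    \sum_(k < N) k%:R ^+ 2 * z k.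
  have := @cvg_psum R nat \oo _ (fun k i => k%:R ^+ 2 * II `[0, i%:R] (fun t => nrm (x k t)))
     (fun k => k%:R ^+ 2 * z k) N.
  apply => k; apply: cvgMr.
  have [Z hZ] := zk_bound k.
  by have [] := II_Rplus (ccont_nrm (x_cont k)) (fun t => nrm_ge0 _) hZ.
move: (h) => /cvg_lim <- //; apply: limr_le; first by apply/cvg_ex; eexists; exact: h.
by apply: nearW => i; exact: (sol_z al0 alA A4).
Qed.

Let z0 : pos z. Proof. by move=> k; apply: II_ge0 => s _; exact: nrm_ge0. Qed.

Let x_cintg E k : measurable E -> E `<=` @Rplus R -> cintg E (x k).
Proof.
move=> mE ER; have mR := @measurable_Rplus R; have [h1 h2] := x_cont k.
have inrm := x_intg_nrm k.
split; apply: (intg_sub mR mE ER).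
  apply: (@le_integrable _ _ _ (@lebesgue_measure R) _ mR _ _ _ _ inrm).
    by apply/measurable_EFinP; exact: cont_meas.
  move=> s _; rewrite -[leLHS]/(`|complex.Re (x k s)|%:E) -[leRHS]/(`|nrm (x k s)|%:E).
by rewrite lee_fin [leRHS]ger0_norm ?nrm_ge0 // Re_le_nrm.
apply: (@le_integrable _ _ _ (@lebesgue_measure R) _ mR _ _ _ _ inrm).
  by apply/measurable_EFinP; exact: cont_meas.
move=> s _; rewrite -[leLHS]/(`|complex.Im (x k s)|%:E) -[leRHS]/(`|nrm (x k s)|%:E).
by rewrite lee_fin [leRHS]ger0_norm ?nrm_ge0 // Im_le_nrm.
Qed.

Let cint_le E k : measurable E -> E `<=` @Rplus R ->
  nrm (cintegral E (x k)) <= II E (fun t => nrm (x k t)).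
Proof.
move=> mE ER; apply: nrm_cint_le => //; first exact: x_cintg.
exact: intg_sub (@measurable_Rplus R) mE ER (x_intg_nrm k).
Qed.

Let cint_z E k : measurable E -> E `<=` @Rplus R -> nrm (cintegral E (x k)) <= z k.
Proof.
move=> mE ER; apply: le_trans (cint_le k mE ER) _.
by apply: II_sub => //; [exact: measurable_Rplus|move=> s _; exact: nrm_ge0].
Qed.

Let cint0 E : cintegral E (x 0%N) = 0.
Proof.
rewrite /cintegral; have e (g : R -> R) : (forall t, g t = 0) -> II E g = 0.
  move=> g0; rewrite (@II_ext _ E g (fun=> 0 * 0)); last by move=> s _; rewrite g0 mulr0.
  by rewrite /Rintegral mulr0 integral0.
by rewrite !e // => t; rewrite x0.
Qed.

(** The measure f(t) dt, built from integrated coefficients. These make sense for unbounded E as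
    well, since each coefficient is integrable on the half-line, whereas the pointwise integral is
    compared on bounded sets only. *)
Definition musol (E : set R) : R -> R := synth (fun k => cintegral E (x k)).

(** The weight k^2 says nothing about k = 0; that term is added back separately. *)
Let zbnd0 : bnd z (2 * A + z 0%N).
Proof.
have h : bnd (fun k : nat => (k == 0%N)%:R * z 0%N) (z 0%N).
  move=> N; apply: (@le_trans _ _ (\sum_(k < N.+1) (k == 0%N :> nat)%:R * z 0%N)).
    by rewrite big_ord_recr /= lerDl mulr_ge0.
  by rewrite big_ord_recl /= mul1r big1 ?addr0 // => i _; rewrite mul0r.
apply: bnd_le (bndD z_bnd h) => -[|k]; first by rewrite expr0n mul0r add0r mul1r.
by rewrite mul0r addr0 ler_peMl // exprn_ege1 // ler1n.
Qed.

(** Everything rests on the summable majorant k^2 z_k. It bounds the coefficients of each value;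
    with the scalar countable additivity of each coefficient it gives additivity in norm; and the
    integrals of |x_k| over disjoint sets add up to at most z_k, which bounds the total
    variation. *)
Lemma musol_measure : wiener_measure 2 musol.
Proof.
split.
- move=> E mE ER; apply: (@synth_wiener R 2 _ (2 * A)); first exact: cint0.
  by apply: bnd_le z_bnd => k; rewrite ler_wpM2l ?exprn_ge0 // cint_z.
- move=> F mF FR tF.
  have mU : measurable (\bigcup_k F k) by exact: bigcup_measurable.
  have UR : \bigcup_k F k `<=` @Rplus R by move=> s [k _ /FR].
  pose r n k : R[i] := cintegral (\bigcup_k F k) (x k) - \sum_(i < n) cintegral (F i) (x k).
  have sz n k : nrm (\sum_(i < n) cintegral (F i) (x k)) <= z k.
    apply: le_trans (nrm_sum _ (fun i => cintegral (F i) (x k))) _.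
    apply: (@le_trans _ _ (\sum_(i < n) II (F i) (fun t => nrm (x k t)))).
      by apply: ler_sum => i _; exact: cint_le.
    apply: (@II_disjoint_le _ n (fun i => F i)) => //.
    + exact: measurable_Rplus.
    + move=> i j _ _ h; apply: val_inj; exact: tF.
    + by move=> s _; exact: nrm_ge0.
  have rz n k : nrm (r n k) <= 2 * z k.
    apply: le_trans (nrmB _ _) _; have := sz n k; have := cint_z k mU UR; lra.
  pose u n k := k%:R ^+ 2 * nrm (r n k).
  have u0 n k : 0 <= u n k by rewrite mulr_ge0 ?nrm_ge0 // exprn_ge0.
  have uM n k : `|u n k| <= 2 * (k%:R ^+ 2 * z k).
    by rewrite ger0_norm // /u mulrCA ler_wpM2l // exprn_ge0.
  have hB := bndZ (ler0n R 2) z_bnd.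
  have cpart (g : R -> R) : intg (\bigcup_k F k) g ->
      (fun n => `|II (\bigcup_k F k) g - \sum_(i < n) II (F i) g|) @ \oo --> (0 : R).
    move=> ig; rewrite -[X in _ --> X](@normr0 _ R); apply: cvg_norm.
    rewrite -[X in _ --> X](subrr (II (\bigcup_k F k) g)).
    by apply: cvgB; [exact: cvg_cst|exact: II_bigcup_cvg].
  have uc k : (fun n => u n k) @ \oo --> (0 : R).
    rewrite -[X in _ --> X](mulr0 (k%:R ^+ 2)); apply: cvgMr.
    have [i1 i2] := x_cintg k mU UR.
    have cs : (fun n => `|II (\bigcup_k F k) (fun t => complex.Re (x k t)) -
          \sum_(i < n) II (F i) (fun t => complex.Re (x k t))| +
        `|II (\bigcup_k F k) (fun t => complex.Im (x k t)) -
          \sum_(i < n) II (F i) (fun t => complex.Im (x k t))|) @ \oo --> (0 : R).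
      by rewrite -[X in _ --> X](addr0 (0 : R)); apply: cvgD; exact: cpart.
    apply: (cvg0_le _ cs) => n; apply/andP; split; first exact: nrm_ge0.
    apply: le_trans (nrm_le_ReIm _) _.
    by rewrite /r !ReImE (Re_sum n (fun i => cintegral (F i) (x k))) (Im_sum n (fun i => cintegral (F i) (x k))).
  have ht := tannery uM hB uc.
  have e n : (wiener_norm 2 (fun y => (musol (\bigcup_k F k) y - \sum_(k < n) musol (F k) y)%R) <=
      (2 * tsum (fun k => `|u n k|))%:E)%E.
    have -> : (fun y => musol (\bigcup_k F k) y - \sum_(k < n) musol (F k) y) = synth (r n).
      apply/funext => y.
      have bU E : measurable E -> E `<=` @Rplus R ->
          bnd (fun k => nrm (cintegral E (x k))) (2 * A + z 0%N).
        by move=> mE ER; apply: bnd_le zbnd0 => k; exact: cint_z.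
      have bS q : bnd (fun k => nrm (\sum_(i < q) cintegral (F i) (x k))) (2 * A + z 0%N).
        by apply: bnd_le zbnd0 => k; exact: sz.
      rewrite (synthB y (bU _ mU UR) (bS n)); congr (_ - _).
      elim: (n) => [|q IH].
        rewrite big_ord0 synthE (_ : (fun k => mode _ k y) = fun=> 0); first by rewrite tsum0 mulr0.
        by apply/funext => k; rewrite /mode big_ord0 mul0r.
      rewrite big_ord_recr /= IH /musol !synthE -mulrDr -tsumD;
        [|exact: (summ_mode (bS q))|exact: (summ_mode (bU _ (mF q) (FR q)))].
      by congr (_ * tsum _); apply/funext => k; rewrite /mode big_ord_recr /= mulrDl ReD.
    apply: (@synth_norm 2 (r n)).
      by rewrite /r cint0 big1 ?subr0 // => i _; exact: cint0.
    have su : summ (fun k => `|u n k|).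
      by apply: (@summ_le _ _ (fun k => 2 * (k%:R ^+ 2 * z k)) (2 * (2 * A))) => // k; rewrite normr_id.
    have := bnd_tsum (fun k => normr_ge0 (u n k)) su.
    by apply: bnd_le => k; rewrite ger0_norm.
  apply: (@squeeze_cvge _ _ _ _ (fun=> 0%E) _ (fun n => (2 * tsum (fun k => `|u n k|))%:E)).
  + by apply: nearW => n; rewrite wiener_norm_ge0 /=; exact: e.
  + exact: cvg_cst.
  + apply: cvg_EFin; first exact: nearW.
    by rewrite -[X in _ --> X](mulr0 2); apply: cvgMr.
- exists (2 * (2 * A)) => n E mE ER tE.
  pose w i k := k%:R ^+ 2 * II (E i) (fun t => nrm (x k t)).
  have w0 i k : 0 <= w i k.
    by rewrite mulr_ge0 ?exprn_ge0 //; apply: II_ge0 => s _; exact: nrm_ge0.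
  have wz i k : w i k <= k%:R ^+ 2 * z k.
    rewrite ler_wpM2l ?exprn_ge0 //; apply: II_sub => //; first exact: measurable_Rplus.
    by move=> s _; exact: nrm_ge0.
  have sw i : summ (w i) by apply: (summ_nneg (w0 i) (bnd_le (wz i) z_bnd)).
  have e i : (wiener_norm 2 (musol (E i)) <= (2 * tsum (w i))%:E)%E.
    apply: (@synth_norm 2); first exact: cint0.
    apply: bnd_le (bnd_tsum (w0 i) (sw i)) => k.
    by rewrite ler_wpM2l ?exprn_ge0 // cint_le.
  apply: (@le_trans _ _ (\sum_(i < n) (2 * tsum (w i))%:E)%E); first exact: lee_sum.
  rewrite sumEFin lee_fin -mulr_sumr ler_wpM2l //.
  have c1 : (fun N => \sum_(i < n) \sum_(k < N) w i k) @ \oo --> \sum_(i < n) tsum (w i).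
    apply: (@cvg_seqsum _ _ _ (fun i N => \sum_(k < N) w i k) (fun i => tsum (w i))) => i.
    exact: summ_cvg.
  move: (c1) => /cvg_lim <- //; apply: limr_le; first by apply/cvg_ex; eexists; exact: c1.
  apply: nearW => N; rewrite exchange_big /=; apply: le_trans (z_bnd N).
  apply: ler_sum => k _; rewrite -mulr_sumr ler_wpM2l ?exprn_ge0 //.
  apply: II_disjoint_le => //; first exact: measurable_Rplus.
  by move=> s _; exact: nrm_ge0.
Qed.

Lemma fsol_M : M_wiener 2 fsol.
Proof.
exists musol; split; first exact: musol_measure.
move=> T E mE ET y.
rewrite /musol !synthE.
have ER : E `<=` @Rplus R by move=> s /ET /=; rewrite in_itv /= => /andP[].
have cmode k : continuous (fun t => mode (x k t) k y).
  by have [] := ccontM (x_cont k) (ccont_cst (expi (k%:R * y))).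
have [_ sI eI] := @int_tsum R E 0 T (fun k t => mode (x k t) k y) (2 * A) mE ET
  (fun k => cont_meas mE (cmode k)) (fun s _ => bnd_le (fun k => mode_le _ _ _) (xbnd s)).
have it : intg E (fun t => tsum (fun k => mode (x k t) k y)).
  apply: (@intg_contE _ _ 0 T) => //.
  exact: (@cont_tsum _ (fun k t => mode (x k t) k y) m (2 * A) cmode
    (fun k s => le_trans (mode_le _ _ _) (x_le k s)) mbnd).
rewrite (_ : (fun t => fsol t y) = (fun t => 2 * c * tsum (fun k => mode (x k t) k y))) //.
rewrite II_Z // eI; congr (_ * tsum _); apply/funext => k.
rewrite /mode mulrC -cintZ //; last exact: x_cintg.
by apply: II_ext => s _; rewrite mulrC.
Qed.

Lemma fsol_duhamel : duhamel f0 fsol.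
Proof.
move=> t t0 n; have t0' : 0 <= t := t0.
have e s : (fun k : nat => fourier (fsol s) k) = x^~ s.
  by apply/funext => k; exact: fourier_fsol.
have key (k : nat) : fourier (fsol t) k = semigroup t (fourier f0) k +
    cintegral `[0, t] (fun s => semigroup (t - s) (nonlinearity (fsol s)) k).
  rewrite duhamel_cduh => [|s _]; last exact: fsol_wiener.
  have -> : (fun s => nl (fun i : nat => fourier (fsol s) i) k) =
      (fun s => nl ((sol al)^~ s) k) by apply/funext => s; rewrite e.
  rewrite fourier_fsol; transitivity (step al (sol al) k t).
    exact: (sol_fixed al0 alA A4).
  by rewrite /step max0E.
have cfs s : continuous (fsol s) by case: (fsol_wiener s).
(* Negative frequencies follow by conjugation, both sides being Hermitian in n. *)
case: n => n; first exact: key.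
rewrite NegzE fourierN // key conjD; congr (_ + _).
  by rewrite /semigroup conjM conjR normrN fourierN.
rewrite -cintJ.
- apply: cint_ext => s _; rewrite /semigroup conjM conjR normrN.
  by rewrite (wiener1_nonlinearityN _ (fsol_wiener s)).
- exact: measurable_itv.
- apply: ccont_cintg.
  have -> : (fun s => semigroup (t - s) (nonlinearity (fsol s)) n.+1) =
    (fun s => (expR (- ((t - s) * n.+1%:R)))%:C * nl (x^~ s) n.+1).
    apply/funext => s; rewrite /semigroup ger0_norm // -pmulrn.
    by rewrite (wiener1_nonlinearity _ (fsol_wiener s)) e.
  apply: ccontM; first by apply: ccont_real; exact: cont_exp_shift.
  exact: nl_ccont x_cont x_le mX (ok_le m_ok).
Qed.

Lemma fsol_global : global_solution f0 fsol.
Proof.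
split; [split|exact: fsol_M|exact: fsol_duhamel].
- by move=> t _; exact: fsol_wiener.
- exact: fsol_strongly_measurable.
- by exists S1; apply: aeW => t t0; exact: fsol_norm1.
Qed.

End Existence.

(** * Uniqueness *)

Section NullSets.
Variable R : realType.
Implicit Types (E N : set R) (u v : R -> R).
Notation mu := (@lebesgue_measure R).
Import HBNNSimple.

Lemma le_integral_null N (f g : R -> \bar R) : measurable N -> mu N = 0%E ->
  (forall x, (0 <= f x)%E) -> (forall x, (0 <= g x)%E) ->
  (forall x, ~ N x -> f x = g x) -> (\int[mu]_x f x <= \int[mu]_x g x)%E.
Proof.
move=> mN N0 fge gge fg; rewrite !ge0_integralTE //.
apply: ge_ereal_sup => _ [h hf <-].
pose h' := proj_nnsfun h (measurableC mN).
apply: le_ereal_sup_tmp; exists (sintegral mu h').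
  exists h' => // x; have [Nx|Nx] := pselect (N x).
    by rewrite /= /mindic indicE memNset ?mulr0 // => /(_ Nx).
  by rewrite /= /mindic indicE mem_set ?mulr1 // -fg // hf.
rewrite -!integralT_nnsfun le_eqVlt; apply/orP; left; apply/eqP.
apply: ae_eq_integral => //.
- by apply/measurable_EFinP; exact: measurable_funP.
- by apply/measurable_EFinP; exact: measurable_funP.
exists N; split => // x /= nh; apply: contrapT => Nx; apply: nh => _.
by rewrite /= /mindic indicE mem_set ?mulr1.
Qed.

(* No measurability of u and v is assumed: the integral is a supremum over the
   simple functions below, and these may be cut off on the null set. *)
Lemma II_null N E u v : measurable N -> mu N = 0%E ->
  (forall s, E s -> ~ N s -> u s = v s) -> II E u = II E v.
Proof.
move=> mN N0 uv; rewrite /Rintegral; congr fine.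
rewrite integralE [RHS]integralE.
have key (p : (R -> \bar R) -> R -> \bar R) : (forall w x, (0 <= p w x)%E) ->
    (forall w w' x, w x = w' x -> p w x = p w' x) ->
    (\int[mu]_(x in E) p (EFin \o u) x = \int[mu]_(x in E) p (EFin \o v) x)%E.
  move=> pge pl; rewrite integral_mkcond [RHS]integral_mkcond.
  have ge w x : (0 <= ((p (EFin \o w)) \_ E) x)%E.
    by rewrite patchE; case: ifP.
  apply/eqP; rewrite eq_le; apply/andP; split; apply: (le_integral_null mN N0);
    by rewrite // => x Nx; rewrite !patchE; case: ifP => // /[!inE] Ex; apply: pl; rewrite /= uv.
congr (_ - _)%E.
- by apply: (key (@funepos R R)) => [w x|w w' x e]; rewrite ?funepos_ge0 // !funeposE e.
- by apply: (key (@funeneg R R)) => [w x|w w' x e]; rewrite ?funeneg_ge0 // !funenegE e.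
Qed.

Lemma cint_null N E (U V : R -> R[i]) : measurable N -> mu N = 0%E ->
  (forall s, E s -> ~ N s -> U s = V s) -> cintegral E U = cintegral E V.
Proof.
by move=> mN N0 UV; rewrite /cintegral; congr (_ +i* _);
  apply: (II_null mN N0) => s Es Ns; rewrite UV.
Qed.

Lemma II_setID E P u : measurable E -> measurable P -> intg E u ->
  II E u = II (E `&` P) u + II (E `\` P) u.
Proof.
move=> mE mP iu; rewrite -Rintegral_setU //.
- by rewrite setUIDK.
- exact: measurableI.
- exact: measurableD.
- by rewrite setUIDK.
- by apply/disj_setPS => x [[_ Px] [_ nPx]].
Qed.

(* On each piece the first K functions have a constant sign, so their L^1 norms
   are sums of absolute values of integrals: a bound on the total variation of a
   vector measure with density f becomes an L^1 bound on f. *)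
Lemma sign_partition E (f : nat -> R -> R) K : measurable E -> (forall k, intg E (f k)) ->
  exists n (F : 'I_n -> set R),
    [/\ forall i, measurable (F i), forall i, F i `<=` E, trivIset setT F,
        forall g, intg E g -> II E g = \sum_(i < n) II (F i) g &
        forall k, (k < K)%N -> II E (fun s => `|f k s|) <= \sum_(i < n) `|II (F i) (f k)|].
Proof.
move=> mE intf; elim: K => [|K [n [F [mF FE tF sF aF]]]].
  exists 1%N, (fun=> E); split.
  - by [].
  - by move=> i s.
  - by move=> i j _ _ _; rewrite (ord1 i) (ord1 j).
  - by move=> g _; rewrite big_ord1.
  - by [].
pose P := E `&` [set s | 0 <= f K s].
have mP : measurable P.
  have mf : measurable_fun E (f K).
    by have /integrableP[/measurable_EFinP] := intf K.
  rewrite /P (_ : [set s | 0 <= f K s] = f K @^-1` `[0, +oo[%classic).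
    exact: mf.
  by apply/seteqP; split => s /=; rewrite in_itv /= andbT.
have int i g : intg E g -> intg (F i) g by move=> ig; apply: (intg_sub mE).
have intD i g : intg E g -> intg (F i `\` P) g.
  by move=> ig; apply: (intg_sub mE) ig => [|s []]; [exact: measurableD|move/FE].
pose G (i : 'I_(n + n)) := match fintype.split i with
  | inl j => F j `&` P | inr j => F j `\` P end.
have Gl j : G (lshift n j) = F j `&` P by rewrite /G (unsplitK (inl j)).
have Gr j : G (rshift n j) = F j `\` P by rewrite /G (unsplitK (inr j)).
exists (n + n)%N, G; split.
- by move=> i; rewrite /G; case: fintype.split => j; [exact: measurableI|exact: measurableD].
- by move=> i; rewrite /G; case: fintype.split => j s [/FE].
- move=> i j _ _; rewrite -(splitK i) -(splitK j).
  have d (a b : 'I_n) s : F a s -> F b s -> a = b.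
    by move=> Fa Fb; apply: tF => //; exists s.
  case: (fintype.split i) => a; case: (fintype.split j) => b /=; rewrite ?Gl ?Gr.
  + by case=> s [[Fa _] [Fb _]]; rewrite (d _ _ _ Fa Fb).
  + by case=> s [[Fa Pa] [Fb Pb]].
  + by case=> s [[Fa Pa] [Fb Pb]].
  + by case=> s [[Fa _] [Fb _]]; rewrite (d _ _ _ Fa Fb).
- move=> g ig; rewrite big_split_ord /= -big_split /= (sF _ ig).
  by apply: eq_bigr => i _; rewrite Gl Gr -II_setID //; exact: int.
move=> k; rewrite ltnS leq_eqVlt => /predU1P[->|kK].
  rewrite sF; last exact: intg_norm.
  rewrite big_split_ord /= -big_split /=; apply: ler_sum => i _; rewrite Gl Gr.
  rewrite (II_setID (mF i) mP); last by apply: int; exact: intg_norm.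
  apply: lerD.
    rewrite (_ : II _ _ = II (F i `&` P) (f K)) ?ler_norm //.
    by apply: II_ext => s [_ [_ fs]]; rewrite ger0_norm.
  rewrite -normrN; suff -> : II (F i `\` P) (fun s => `|f K s|) = - II (F i `\` P) (f K).
    exact: ler_norm.
  rewrite -[RHS]mulN1r -II_Z //; [|exact: measurableD|exact: intD].
  apply: II_ext => s [Fs nP]; rewrite mulN1r ltr0_norm // ltNge.
  by apply/negP => fs; apply: nP; split => //; exact: FE Fs.
apply: le_trans (aF _ kK) _; rewrite big_split_ord /= -big_split /=.
apply: ler_sum => i _; rewrite Gl Gr (II_setID (mF i) mP); last exact: int.
exact: ler_normD.
Qed.
End NullSets.

Section Weights.
Variable R : realType.
Implicit Types (M w : nat -> R) (S e : R).

Lemma bnd_from w S K : (forall k, 0 <= w k) -> bnd (fun k => w (K + k)%N) S ->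
  bnd (fun k => if (K <= k)%N then w k else 0) S.
Proof.
move=> wge wS n; apply: le_trans (wS n).
apply: (@le_trans _ _ (\sum_(k < K + n) if (K <= k)%N then w k else 0)).
  by apply: (@psum_nd _ (fun k => if (K <= k)%N then w k else 0)) => [k|];
    [case: ifP|exact: leq_addl].
rewrite big_split_ord /= big1 ?add0r => [|i _]; last by rewrite leqNgt ltn_ord.
by apply: ler_sum => i _; rewrite leq_addr.
Qed.

(* The factor n / (n + lam) comes from integrating n exp(- (n + lam) (t - s)). *)
Lemma resolvent_small M S e : pos M -> bnd (fun n => n%:R * M n) S -> 0 < e ->
  exists2 lam : R, 0 < lam & bnd (fun n => n%:R / (n%:R + lam) * (n%:R * M n)) e.
Proof.
move=> Mge MS e_gt0; have S0 := bnd_ge0 MS.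
have e2 : 0 < e / 2 by lra.
have [K MK] := summ_tail (kpos Mge) MS e2.
have KS0 : 0 <= K%:R * S by rewrite mulr_ge0.
(* Frequencies below K carry a factor at most K / lam, which this choice makes small against S;
   those from K on lie in a tail of M that is at most e / 2. The summand 1 keeps lam positive when K
   S = 0. *)
pose lam := K%:R * S * 2 / e + 1.
have lam0 : 0 < lam by rewrite ltr_wpDl // divr_ge0 ?mulr_ge0 // ltW.
exists lam => //.
have small : K%:R / lam * S <= e / 2.
  rewrite mulrAC ler_pdivrMr // /lam mulrDr mulr1.
  by rewrite (_ : e / 2 * (K%:R * S * 2 / e) = K%:R * S); [lra|field; lra].
have h := bndD (bndZ (divr_ge0 (ler0n _ K) (ltW lam0)) MS) (bnd_from (kpos Mge) MK).
have tot : K%:R / lam * S + e / 2 <= e by lra.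
apply: (bnd_leS tot); apply: bnd_le h => n.
have nM := kpos Mge n; have nl0 : 0 < n%:R + lam by rewrite ltr_wpDl.
case: leqP => Kn.
  apply: (@le_trans _ _ (1 * (n%:R * M n))).
    by apply: ler_wpM2r => //; rewrite ler_pdivrMr // mul1r lerDl ltW.
  by rewrite mul1r lerDr mulr_ge0 // divr_ge0 // ltW.
rewrite addr0; apply: ler_wpM2r => //.
rewrite ler_pdivrMr // mulrAC ler_pdivlMr //.
apply: ler_pM => //; first exact: ltW.
  by rewrite ler_nat ltnW.
by rewrite lerDr.
Qed.

Lemma bnd_sum_tsum (a : nat -> nat -> R) S : (forall n, summ (a n)) ->
  (forall N J, \sum_(n < N) \sum_(k < J) a n k <= S) -> bnd (fun n => tsum (a n)) S.
Proof.
move=> sa aS N.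
have := @cvg_psum R nat \oo _ (fun n J => \sum_(k < J) a n k) (fun n => tsum (a n)) N.
move=> /(_ _ (fun n => summ_cvg (sa n))) h.
rewrite -(cvg_lim _ h) //; apply: limr_le; first by apply/cvg_ex; eexists; exact: h.
exact: nearW.
Qed.
End Weights.

(** * Measurability in time of Fourier coefficients *)

Section CoefficientMeasurability.
Variable R : realType.
Implicit Types (g : R -> R -> R).
Notation mu := (@lebesgue_measure R).

Lemma fourier_lincomb (I : Type) (r : seq I) (a : I -> R) (v : I -> R -> R) n :
  (forall i, continuous (v i)) ->
  continuous (fun x => \sum_(i <- r) a i * v i x) /\
  fourier (fun x => \sum_(i <- r) a i * v i x) n =
    \sum_(i <- r) (a i)%:C * fourier (v i) n.
Proof.
move=> cv; elim: r => [|i r [cr fr]].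
  have -> : (fun x => \sum_(i <- [::]) a i * v i x) = (fun=> 0 * 0).
    by apply/funext => x; rewrite big_nil mul0r.
  split; first exact: cont_cst.
  rewrite big_nil (@fourierZ _ (fun=> 0) 0) ?mul0r //; exact: cont_cst.
have -> : (fun x => \sum_(j <- i :: r) a j * v j x) =
    (fun x => a i * v i x + \sum_(j <- r) a j * v j x).
  by apply/funext => x; rewrite big_cons.
have ci : continuous (fun x => a i * v i x) by apply: cont_mulf => //; exact: cont_cst.
split; first exact: cont_addf.
by rewrite big_cons fourierD // fr fourierZ.
Qed.

Lemma wiener1_coef_le u (k : nat) e : continuous u -> fourier u 0 = 0 ->
  (wiener_norm 1 u <= e%:E)%E -> nrm (fourier u k) <= e :> R.
Proof.
move=> cu u0 /(@wiener_normP R 1%N u e cu u0) ue.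
have e0 := bnd_ge0 ue.
case: k => [|k]; first by rewrite u0 nrm0.
have := @bnd_term _ _ _ k.+1 _ ue; rewrite expr1 => h.
apply: le_trans (h _) => [|j]; last by rewrite !mulr_ge0 // nrm_ge0.
rewrite mulrA ler_peMl ?nrm_ge0 //.
by rewrite -natrM ler1n.
Qed.

(** A coefficient is bounded by the A^1 norm, so those of g are limits of those of the simple
    functions wherever these converge. That is known off N, hence the measurability on the
    complement of N. *)
Lemma strongly_measurable_coef g : (forall t, Rplus t -> wiener 1 (g t)) ->
  strongly_measurable 1 g -> exists N, [/\ measurable N, mu N = 0%E &
    forall k : nat, cmeas (@Rplus R `\` N) (fun t => fourier (g t) k)].
Proof.
move=> wg [s [simp [N [mN N0 sN]]]]; exists N; split => // k.
have mG : measurable (@Rplus R `\` N) by apply: measurableD => //; exact: measurable_Rplus.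
have facts j t : Rplus t -> [/\ continuous (s j t), fourier (s j t) 0 = 0 &
    continuous (g t) /\ fourier (g t) 0 = 0].
  move=> t0; have [cg _ g0 _] := wiener1_facts (wg _ t0).
  have [m [E [v [mE wv se]]]] := simp j.
  have cv i : continuous (v i) by have [] := wiener1_facts (wv i).
  have -> : s j t = (fun x => \sum_(i < m) \1_(E i) t * v i x).
    by apply/funext => x; rewrite se.
  have [cs fs] := @fourier_lincomb _ (index_enum 'I_m) (fun i => \1_(E i) t) v 0 cv.
  split => //; rewrite fs big1 // => i _.
  by have [_ _ -> _] := wiener1_facts (wv i); rewrite mulr0.
have ms j : cmeas (@Rplus R `\` N) (fun t => fourier (s j t) k).
  have [m [E [v [mE wv se]]]] := simp j.
  have cv i : continuous (v i) by have [] := wiener1_facts (wv i).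
  have e t : fourier (s j t) k = \sum_(i < m) (\1_(E i) t)%:C * fourier (v i) k.
    have -> : s j t = (fun x => \sum_(i < m) \1_(E i) t * v i x).
      by apply/funext => x; rewrite se.
    by have [_ ->] := @fourier_lincomb _ (index_enum 'I_m) (fun i => \1_(E i) t) v k cv.
  have m1 i r : measurable_fun (@Rplus R `\` N) (fun t => \1_(E i) t * r : R).
    apply: measurable_funM; last exact: measurable_cst.
    exact: measurable_indic.
  split.
    rewrite (_ : (fun t => _) = (fun t => \sum_(i < m) \1_(E i) t * complex.Re (fourier (v i) k))).
      by apply: measurable_sum => i; exact: m1.
    apply/funext => t; rewrite e (big_morph _ (@ReD R) (erefl _)).
    by apply: eq_bigr => i _; rewrite Re_realM.
  rewrite (_ : (fun t => _) = (fun t => \sum_(i < m) \1_(E i) t * complex.Im (fourier (v i) k))).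
    by apply: measurable_sum => i; exact: m1.
  apply/funext => t; rewrite e (big_morph _ (@ImD R) (erefl _)).
  by apply: eq_bigr => i _; rewrite Im_realM.
apply: (cmeas_cvg mG ms) => t [t0 Nt].
have : wiener_norm 1 (fun x => s j t x - g t x) @[j --> \oo] --> 0%E.
  by apply: contrapT => h; apply: Nt; apply: sN => /= /(_ t0).
move=> /fine_cvgP[fn fc]; apply/cvgrPdist_le => e e0.
have /cvgrPdist_le/(_ _ e0) := fc; apply: filterS2 fn => j fj.
rewrite !sub0r !normrN [X in _ -> X <= _]ger0_norm ?nrm_ge0 //.
move=> /(le_trans (ler_norm _)) hj.
have [cs s0 [cg g0]] := facts j t t0.
have cN : continuous (fun x => -1 * g t x) by apply: cont_mulf => //; exact: cont_cst.
have sgE : (fun x => s j t x - g t x) = (fun x => s j t x + -1 * g t x).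
  by apply/funext => x; rewrite mulN1r.
have sgF n : fourier (fun x => s j t x - g t x) n = fourier (s j t) n - fourier (g t) n.
  by rewrite sgE fourierD // fourierZ // rmorphN rmorph1 mulN1r.
rewrite -sgF; apply: wiener1_coef_le.
- by rewrite sgE; exact: cont_addf.
- by rewrite sgF s0 g0 subrr.
- by rewrite -lee_fin fineK // in hj.
Qed.
End CoefficientMeasurability.

(** * The bilinear majorant integrated in time *)

Section TimeIntegratedQ.
Variable R : realType.
Variables (E : set R) (a b B Z : R) (Y : nat -> R -> R).
Hypotheses (mE : measurable E) (Eab : E `<=` `[a, b]).
Hypotheses (mY : forall k, measurable_fun E (Y k)) (Y0 : forall k s, 0 <= Y k s).
Hypotheses (B0 : 0 <= B) (YB : forall s, E s -> bnd (fun k => k%:R * Y k s) B).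
Hypotheses (YleB : forall k s, E s -> Y k s <= B).
Hypotheses (YZ : bnd (fun k => k%:R ^+ 2 * II E (Y k)) Z).

Let u n k s := k%:R * Y k s * Y (n + k)%N s.

Let u0 n k s : 0 <= u n k s.
Proof. by rewrite /u !mulr_ge0. Qed.

Let uB n s : E s -> bnd (fun k => u n k s) (B * B).
Proof.
move=> Es.
apply: (@bnd_le _ _ (fun k => B * (k%:R * Y k s))) => [k|]; last exact: bndZ (YB Es).
by rewrite /u mulrC ler_wpM2r ?mulr_ge0 ?YleB.
Qed.

Let mu_ n k : measurable_fun E (u n k).
Proof. by apply: measurable_funM => //; apply: measurable_funM. Qed.

Let intY k : intg E (Y k).
Proof.
by apply: (intg_bdd (a:=a) (b:=b) (C:=B)) => // s Es; rewrite ger0_norm ?YleB.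
Qed.

Let intu n k : intg E (u n k).
Proof.
apply: (intg_bdd (a:=a) (b:=b) (C:=B * B)) => // s Es; rewrite ger0_norm //.
exact: (@bnd_term _ (fun k => u n k s)) (uB n Es).
Qed.

Let u_tsum n : [/\ measurable_fun E (fun s => tsum ((u n)^~ s)),
  summ (fun k => II E (u n k)) &
  II E (fun s => tsum ((u n)^~ s)) = tsum (fun k => II E (u n k))].
Proof.
apply: (@int_tsum R E a b (u n) (B * B) mE Eab (mu_ n)) => s Es.
by apply: bnd_le (uB n Es) => k; rewrite ger0_norm.
Qed.

Lemma Q_time_meas n : measurable_fun E (fun s => Q (Y^~ s) (Y^~ s) n).
Proof. by have [] := u_tsum n. Qed.

(** [Q_bnd] under a time integral: at each time the first factor is bounded in A^1 by B, and n^2 <=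
    (n + k)^2 puts the whole weight on the second factor, whose integral is bounded in A^2 by Z. *)
Lemma Q_time_bnd : bnd (fun n => n%:R ^+ 2 * II E (fun s => Q (Y^~ s) (Y^~ s) n)) (B * Z).
Proof.
have e n : n%:R ^+ 2 * II E (fun s => Q (Y^~ s) (Y^~ s) n) =
    tsum (fun k => n%:R ^+ 2 * II E (u n k)).
  by have [_ su eu] := u_tsum n; rewrite tsumZ // -eu.
have -> : (fun n => n%:R ^+ 2 * II E (fun s => Q (Y^~ s) (Y^~ s) n)) =
    (fun n => tsum (fun k => n%:R ^+ 2 * II E (u n k))) by apply/funext.
apply: bnd_sum_tsum => [n|N J]; first by have [_ su _] := u_tsum n; exact: summZ.
pose v i s := i%:R ^+ 2 * Y i s.
have v0 s i : 0 <= v i s by rewrite mulr_ge0 // exprn_ge0.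
have intv i : intg E (v i) by exact: intg_Z.
have intS K : intg E (fun s => \sum_(i < K) v i s) by exact: intg_sum.
have intuS n : intg E (fun s => \sum_(k < J) n%:R ^+ 2 * u n k s).
  by apply: (@intg_sum _ _ (fun k s => n%:R ^+ 2 * u n k s)) => // k; exact: intg_Z.
have -> : \sum_(n < N) \sum_(k < J) n%:R ^+ 2 * II E (u n k) =
    II E (fun s => \sum_(n < N) \sum_(k < J) n%:R ^+ 2 * u n k s).
  rewrite (@II_sum _ E (fun n s => \sum_(k < J) n%:R ^+ 2 * u n k s)) //.
  apply: eq_bigr => n _; rewrite (@II_sum _ E (fun k s => n%:R ^+ 2 * u n k s)) //.
    by apply: eq_bigr => k _; rewrite II_Z.
  by move=> k; exact: intg_Z.
apply: (@le_trans _ _ (II E (fun s => B * \sum_(i < N + J) v i s))); last first.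
  rewrite II_Z // (@II_sum _ E v) //.
  by apply: ler_wpM2l => //; under eq_bigr do rewrite II_Z //; exact: YZ.
apply: II_le => //.
- by apply: (@intg_sum _ _ (fun n s => \sum_(k < J) n%:R ^+ 2 * u n k s)).
- exact: intg_Z.
move=> s Es; rewrite exchange_big /=.
apply: (@le_trans _ _ (\sum_(k < J) k%:R * Y k s * \sum_(i < N + J) v i s)).
  apply: ler_sum => k _.
  have -> : \sum_(n < N) n%:R ^+ 2 * u n k s =
      k%:R * Y k s * \sum_(n < N) n%:R ^+ 2 * Y (n + k)%N s.
    by rewrite mulr_sumr; apply: eq_bigr => n _; rewrite /u mulrCA.
  apply: ler_wpM2l; first exact: mulr_ge0.
  apply: (@le_trans _ _ (\sum_(n < N) v (k + n)%N s)).
    apply: ler_sum => n _; rewrite /v addnC ler_wpM2r // lerXn2r ?nnegrE //.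
    by rewrite ler_nat leq_addl.
  apply: (@le_trans _ _ (\sum_(i < k + N) v i s)).
    by rewrite [leRHS]big_split_ord /= lerDr sumr_ge0.
  apply: (@psum_nd _ (v^~ s)) => //.
  by rewrite addnC leq_add2l ltnW.
by rewrite -mulr_suml ler_wpM2r ?sumr_ge0 //; exact: YB.
Qed.
End TimeIntegratedQ.

Section Duhamel.
Variable R : realType.

(** The semigroup is bounded by 1 and the integral extended to [0, T], which makes the bound uniform
    in t. The derivative in the nonlinearity is then paid for by integrability in A^2 instead of
    smoothing. *)
Lemma cduh_le (n T C : R) (z : R[i]) N t : 0 <= n -> 0 <= t <= T ->
  cmeas `[0, T] N -> (forall s, 0 <= s <= T -> nrm (N s) <= C) ->
  nrm (cduh n z N t) <= nrm z + II `[0, T] (fun s => nrm (N s)).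
Proof.
move=> n0 /andP[t0 tT] mN NC; apply: le_trans (nrmD _ _) _.
have mE r : measurable (`[0, r]%classic : set R) by exact: measurable_itv.
have sub : `[0, t]%classic `<=` (`[0, T]%classic : set R).
  by move=> s /=; rewrite !in_itv /= => /andP[-> /le_trans]; apply.
have mNt : cmeas `[0, t] N.
  by have [m1 m2] := mN; split; apply: measurable_funS sub _ => //; exact: mE.
have NCt s : 0 <= s <= t -> nrm (N s) <= C.
  by move=> /andP[s0 st]; apply: NC; rewrite s0 (le_trans st).
have intN : intg `[0, T] (fun s => nrm (N s)).
  apply: (intg_bdd (a:=0) (b:=T) (C:=C)) => //; first exact: cmeas_nrm.
  by move=> s /=; rewrite in_itv /= => hs; rewrite ger0_norm ?nrm_ge0 ?NC.
have intNt : intg `[0, t] (fun s => nrm (N s)) by exact: intg_sub intN.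
rewrite nrmM nrm_real ger0_norm ?expR_ge0 //; apply: lerD.
  by rewrite ler_piMl ?nrm_ge0 // expR_le1 oppr_le0 mulr_ge0.
apply: (@le_trans _ _ (II `[0, t] (fun s => nrm (N s)))); last first.
  by apply: II_sub => // s _; exact: nrm_ge0.
apply: nrm_cint_le => //; first exact: (@cduh_intg _ _ _ _ C).
move=> s /=; rewrite in_itv /= => /andP[s0 st].
rewrite nrmM nrm_real ger0_norm ?expR_ge0 // ler_piMl ?nrm_ge0 //.
by rewrite expR_le1 oppr_le0 mulr_ge0 // subr_ge0.
Qed.
End Duhamel.

(** * Comparison of an arbitrary solution with the constructed one *)

Section Uniqueness.
Variable R : realType.
Notation c := (nc R).
Notation mu := (@lebesgue_measure R).
Variables (f0 : R -> R) (A : R).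
Let al (k : nat) : R[i] := fourier f0 k.
Hypotheses (al0 : al 0%N = 0) (alA : bnd (fun k => k%:R * nrm (al k)) A) (A4 : 4 * A < 1).
Variables (g : R -> R -> R) (N : set R) (C T : R).
Hypotheses (wg : forall t, Rplus t -> wiener 1 (g t)) (mN : measurable N) (N0 : mu N = 0%E).
Hypothesis g_meas : forall k : nat, cmeas (@Rplus R `\` N) (fun t => fourier (g t) k).
Hypothesis gC : forall t, (@Rplus R `\` N) t -> (wiener_norm 1 (g t) <= C%:E)%E.
Hypotheses (dg : duhamel f0 g) (Mg : M_wiener 2 g) (T0 : 0 <= T).

Let A0 : 0 <= A. Proof. exact: bnd_ge0 alA. Qed.
Let c0 : 0 <= c. Proof. exact/ltW/nc_gt0. Qed.
Let c2 : 2 * c <= 1. Proof. have := nc_le R; lra. Qed.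
Let m := Ml al.
Let m_ok : ok A m. Proof. exact: (Ml_ok al0 alA A4). Qed.
Let m0 : pos m. Proof. by case: m_ok. Qed.
Let mz : m 0%N = 0. Proof. by case: m_ok. Qed.
Let mX : bnd (fun k => k%:R * m k) (2 * A). Proof. by case: m_ok. Qed.
Let x (k : nat) (t : R) : R[i] := sol al k t.
Let x_cont k : ccont (x k). Proof. exact: (sol_cont al0 alA A4). Qed.
Let x_le k t : nrm (x k t) <= m k. Proof. exact: (sol_nrm al0 alA A4). Qed.
Let x0 t : x 0 t = 0. Proof. exact: (sol00 al0 alA A4). Qed.

(* On the null set, where nothing is known about g, the coefficients of g are
   replaced by those of the constructed solution: this changes no integral, and
   the two sequences stay equal there. *)
Let y (k : nat) (t : R) : R[i] :=
  if t \in @Rplus R `\` N then fourier (g t) k else x k t.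

Let yG k t : (@Rplus R `\` N) t -> y k t = fourier (g t) k.
Proof. by move=> Gt; rewrite /y mem_set. Qed.

Let mG : measurable (@Rplus R `\` N).
Proof. by apply: measurableD => //; exact: measurable_Rplus. Qed.

Let y_meas k E : measurable E -> cmeas E (y k).
Proof.
move=> mE; have [gr gi] := g_meas k.
have [xr xi] := ccont_cmeas (measurableC mG) (x_cont k).
have U : setT = (@Rplus R `\` N) `|` ~` (@Rplus R `\` N) by rewrite setUv.
split; apply: measT_E => //; rewrite U; apply/measurable_funU => //; first exact: measurableC.
- split; [apply: eq_measurable_fun gr|apply: eq_measurable_fun xr] => t ht.
    by rewrite /y ht.
  by rewrite /y; case: ifPn => //; move: ht; rewrite in_setC => /negbTE ->.
- exact: measurableC.
- split; [apply: eq_measurable_fun gi|apply: eq_measurable_fun xi] => t ht.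
    by rewrite /y ht.
  by rewrite /y; case: ifPn => //; move: ht; rewrite in_setC => /negbTE ->.
Qed.

(** A bound for y at all times: C where y comes from g, 2 A where it comes from the constructed
    solution. The maximum with 0 makes both summands nonnegative. *)
Let C' := Num.max C 0 + 2 * A.

Let C'0 : 0 <= C'. Proof. by rewrite addr_ge0 ?mulr_ge0 // le_max lexx orbT. Qed.

Let y0 t : y 0 t = 0.
Proof.
rewrite /y; case: ifPn => [/[!inE] [[t0 _]]|_]; last exact: x0.
by have [] := wiener1_facts (wg t0).
Qed.

Let y_bnd t : bnd (fun k => k%:R * nrm (y k t)) C'.
Proof.
have [Gt|nGt] := pselect ((@Rplus R `\` N) t).
  have -> : (fun k => k%:R * nrm (y k t)) = (fun k => k%:R * nrm (fourier (g t) k)).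
    by apply/funext => k; rewrite yG.
  have [t0 _] := Gt; have [cg _ g0 _] := wiener1_facts (wg t0).
  have /(@wiener_normP _ 1 _ _ cg g0) h := gC Gt.
  apply: (@bnd_leS _ _ C).
    by rewrite /C' (@le_trans _ _ (Num.max C 0)) ?le_max ?lexx // lerDl mulr_ge0.
  apply: bnd_le h => k; rewrite expr1 ler_peMl ?mulr_ge0 ?nrm_ge0 //.
  by rewrite ler1n.
apply: (@bnd_leS _ _ (2 * A)); first by rewrite lerDr le_max lexx orbT.
by apply: bnd_le mX => k; rewrite ler_wpM2l // /y memNset.
Qed.

Let y_le k t : nrm (y k t) <= C'.
Proof.
by apply: (k_bound (m := fun k => nrm (y k t))) (y_bnd t) _ => [j|];
  [exact: nrm_ge0|rewrite y0 nrm0].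
Qed.

Let y_bnd0 t : bnd (fun k => nrm (y k t)) C'.
Proof.
apply: bnd_le (y_bnd t) => -[|k]; first by rewrite y0 nrm0 mulr0.
by rewrite ler_peMl ?nrm_ge0 // ler1n.
Qed.

Let y_cintg k (E : set R) (a b : R) : measurable E -> E `<=` `[a, b] -> cintg E (y k).
Proof. by move=> mE Eab; apply: (cintg_bdd mE Eab (y_meas k mE)) => s _; exact: y_le. Qed.

Let nly_meas n (E : set R) (a b : R) : measurable E -> E `<=` `[a, b] -> cmeas E (fun s => nl (y^~ s) n).
Proof.
move=> mE Eab.
apply: (@cmeas_mul R E (fun=> (2 * c * n%:R)%:C) (fun s => ctsum (nlt (y^~ s) n))) => //.
have [] // := @cint_ctsum R E a b (fun k s => nlt (y^~ s) n k) (C' * C') mE Eab.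
- move=> k; apply: cmeas_mul => //; last exact: y_meas.
  apply: cmeas_mul => //.
  by apply: cmeasJ => //; exact: y_meas.
- move=> s _; apply: (@bnd_le _ _ (fun k => C' * (k%:R * nrm (y k s)))).
    move=> k; apply: le_trans (@nrm_nlt _ _ (fun k => nrm (y k s)) n k _) _ => //.
    by rewrite mulrC ler_wpM2r ?mulr_ge0 ?nrm_ge0.
  exact: bndZ.
Qed.

Let nly_le n s : nrm (nl (y^~ s) n) <= n%:R * Q (fun k => nrm (y k s)) (fun k => nrm (y k s)) n.
Proof.
have p : pos (fun k => nrm (y k s)) by move=> k; exact: nrm_ge0.
have q0 := @Q_ge0 _ _ _ n _ _ p p (y_bnd s) (fun k => y_le k s).
apply: le_trans (@nrm_nl _ (y^~ s) _ _ n _ _ p p _ _ (y_bnd s) (fun k => y_le k s)) _ => //.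
apply: ler_wpM2r => //; rewrite -[leRHS]mul1r; exact: ler_wpM2r.
Qed.

Let nly_bd n s : nrm (nl (y^~ s) n) <= n%:R * (C' * C').
Proof.
apply: le_trans (nly_le n s) _; apply: ler_wpM2l => //.
have p : pos (fun k => nrm (y k s)) by move=> k; exact: nrm_ge0.
apply: tsum_le; first exact: (Q_summ _ p p (y_bnd s) (fun k => y_le k s)).
apply: (@bnd_le _ _ (fun k => C' * (k%:R * nrm (y k s)))); last exact: bndZ.
by move=> k; rewrite mulrC ler_wpM2r ?mulr_ge0 ?nrm_ge0.
Qed.

(** True also for t in N: the Duhamel identity holds at every time, and passing from g to y changes
    its integrand on a null set only. *)
Lemma fourier_cduh t (n : nat) : 0 <= t ->
  fourier (g t) n = cduh n%:R (al n) (fun s => nl (y^~ s) n) t.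
Proof.
move=> t0; rewrite (dg t0) duhamel_cduh => [|s /andP[s0 _]]; last exact: wg.
rewrite /cduh; congr (_ + _); apply: (cint_null mN N0) => s /=.
rewrite in_itv /= => /andP[s0 _] Ns; congr (_ * _).
suff -> : (fun k : nat => fourier (g s) k) = y^~ s by [].
by apply/funext => k; rewrite yG.
Qed.

Let mT : measurable (`[0, T]%classic : set R). Proof. exact: measurable_itv. Qed.

(** The value nu E is given pointwise in space as a time integral of g. Expanding g in its Fourier
    series and integrating term by term exhibits it as a Fourier series, whose coefficients can be
    read off. *)
Let mu_fourier (nu : set R -> R -> R) (E : set R) (k : nat) : measurable E -> E `<=` `[0, T] ->
  (forall z, nu E z = II E (fun t => g t z)) ->
  fourier (nu E) k = cintegral E (y k).
Proof.
move=> mE ET nuE.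
have m_nrm i : measurable_fun E (fun s => nrm (y i s)) by apply: cmeas_nrm => //; exact: y_meas.
have yabs s : E s -> bnd (fun k => `|nrm (y k s)|) C'.
  by move=> _; apply: bnd_le (y_bnd0 s) => i; rewrite ger0_norm ?nrm_ge0.
have [_ [S yS] _] := @int_tsum R E 0 T (fun k s => nrm (y k s)) C' mE ET m_nrm yabs.
have cS : bnd (fun k => nrm (cintegral E (y k))) S.
  apply: bnd_le yS => i; apply: le_trans (ler_norm _).
  apply: nrm_cint_le => //; first exact: (y_cintg i mE ET).
  by apply: (intg_bdd (a:=0) (b:=T) (C:=C')) => // s _; rewrite ger0_norm ?nrm_ge0.
have ci0 : cintegral E (y 0%N) = 0.
  have i0 : II E (fun=> 0) = 0 :> R by rewrite Rintegral_cst // mul0r.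
  rewrite /cintegral.
  have -> : (fun s => complex.Re (y 0%N s)) = (fun=> 0) by apply/funext => s; rewrite y0.
  have -> : (fun s => complex.Im (y 0%N s)) = (fun=> 0) by apply/funext => s; rewrite y0.
  by rewrite i0.
suff -> : nu E = synth (fun k => cintegral E (y k)) by exact: fourier_synth cS ci0 k.
apply/funext => z; rewrite nuE synthE //.
transitivity (II E (fun t => 2 * c * tsum (fun k => mode (y k t) k z))).
  apply: (II_null mN N0) => t /ET /=; rewrite in_itv /= => /andP[t0 _] Nt.
  have [cg pg g0 [S' gS]] := wiener1_facts (wg t0).
  have gy : (fun k : nat => fourier (g t) k) = y^~ t by apply/funext => i; rewrite yG.
  rewrite (@fourier_expand _ (g t) C') //; first by rewrite gy.
  have -> : (fun k : nat => nrm (fourier (g t) k)) = (fun k => nrm (y k t)).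
    by apply/funext => i; rewrite yG.
  exact: y_bnd0.
have mmode i : measurable_fun E (fun t => mode (y i t) i z).
  have [] // : cmeas E (fun t => y i t * expi (i%:R * z)).
  by apply: cmeas_mul => //; exact: y_meas.
have mb s : bnd (fun i => `|mode (y i s) i z|) C'.
  exact: bnd_le (fun i => mode_le _ _ _) (y_bnd0 s).
have [mt sI eI] := @int_tsum R E 0 T (fun k t => mode (y k t) k z) C' mE ET mmode (fun s _ => mb s).
rewrite II_Z //; last first.
  apply: (intg_bdd (a:=0) (b:=T) (C:=C')) => // s _.
  have sm := @summ_mode R (y^~ s) C' (y_bnd0 s) z.
  by apply: le_trans (ler_norm_tsum sm) _; apply: tsum_le; [exact: summ_norm|exact: mb].
rewrite eI; congr (_ * tsum _); apply/funext => i.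
have -> : mode (cintegral E (y i)) i z = complex.Re (expi (i%:R * z) * cintegral E (y i)).
  by rewrite /mode mulrC.
rewrite -cintZ //; last exact: (y_cintg i mE ET).
by apply: II_ext => s _; rewrite /mode mulrC.
Qed.

(** On a partition adapted to the signs of the first K coefficients, the L^1 norms of these
    coefficients are recovered from the values of nu, whose A^2 norms add up to at most the total
    variation bound. *)
Let y_dissip : exists Z, bnd (fun k => k%:R ^+ 2 * II `[0, T] (fun t => nrm (y k t))) Z.
Proof.
have [nu [[wnu _ [Z nuZ]] nuE]] := Mg; exists Z => K.
(* Real parts at even indices, imaginary parts at odd ones. The price of |Re| + |Im| is a factor 2,
   exactly the one in the folded Wiener norm. *)
pose f i (s : R) := if odd i then complex.Im (y i./2 s) else complex.Re (y i./2 s).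
have intf i : intg `[0, T] (f i).
  have [h1 h2] := y_cintg i./2 mT (@subset_refl _ _).
  by rewrite /f; case: odd.
have [n [F [mF FT tF sF aF]]] := sign_partition K.*2 mT intf.
have FR i : F i `<=` @Rplus R by move=> s /FT /=; rewrite in_itv /= => /andP[].
have w i : wiener 2%:R (nu (F i)) by apply: wnu.
pose S i := fine (wiener_norm 2 (nu (F i))).
have Sb i : wiener_norm 2 (nu (F i)) = (S i)%:E /\
    bnd (fun k => 2 * (k%:R ^+ 2 * nrm (cintegral (F i) (y k)))) (S i).
  have [r er hr] := wiener_bnd (w i); rewrite /S er; split => //=.
  apply: bnd_le hr => k; rewrite (@mu_fourier nu (F i) k) //.
  by move=> z; exact: nuE (FT i) z.
have SZ : \sum_(i < n) S i <= Z.
  have := nuZ n F mF FR tF; under eq_bigr do rewrite (proj1 (Sb _)).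
  by rewrite sumEFin lee_fin.
apply: le_trans SZ.
apply: (@le_trans _ _ (\sum_(k < K) \sum_(i < n) 2 * (k%:R ^+ 2 * nrm (cintegral (F i) (y k))))).
  apply: ler_sum => k _.
  have -> : \sum_(i < n) 2 * (k%:R ^+ 2 * nrm (cintegral (F i) (y k))) =
     k%:R ^+ 2 * \sum_(i < n) 2 * nrm (cintegral (F i) (y k)).
    by rewrite mulr_sumr; apply: eq_bigr => i _; rewrite mulrCA.
  apply: ler_wpM2l; first exact: exprn_ge0.
  have hk : (k.*2.+1 < K.*2)%N by rewrite -doubleS ltn_Sdouble.
  have f0E : f k.*2 = (fun s => complex.Re (y k s)).
    by apply/funext => s; rewrite /f odd_double doubleK.
  have f1E : f k.*2.+1 = (fun s => complex.Im (y k s)).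
    by apply/funext => s; rewrite /f /= odd_double uphalf_double.
  have h0 := aF k.*2 (ltnW hk); have h1 := aF k.*2.+1 hk.
  have i0 := intg_norm (intf k.*2); have i1 := intg_norm (intf k.*2.+1).
  rewrite f0E f1E in h0 h1 i0 i1.
  apply: (@le_trans _ _ (II `[0, T] (fun s => `|complex.Re (y k s)| + `|complex.Im (y k s)|))).
    apply: II_le => //.
    - apply: (intg_bdd (a:=0) (b:=T) (C:=C')) => //; first by apply: cmeas_nrm => //; exact: y_meas.
      by move=> s _; rewrite ger0_norm ?nrm_ge0.
    - exact: intg_D.
    - by move=> s _; exact: nrm_le_ReIm.
  rewrite II_D //; apply: le_trans (lerD h0 h1) _; rewrite -big_split /=.
  apply: ler_sum => i _; rewrite mulr2n mulrDl mul1r; apply: lerD.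
    exact: (Re_le_nrm (cintegral (F i) (y k))).
  exact: (Im_le_nrm (cintegral (F i) (y k))).
rewrite exchange_big /=; apply: ler_sum => i _.
by have [_] := Sb i; apply.
Qed.

(** The first two terms bound g on [0, T] through [cduh_le]; m is added so that M also covers the
    times of N, where y is the constructed solution. *)
Let M n := nrm (al n) + II `[0, T] (fun s => nrm (nl (y^~ s) n)) + m n.

Let II_nly_ge0 n : 0 <= II `[0, T] (fun s => nrm (nl (y^~ s) n)).
Proof. by apply: II_ge0 => s _; exact: nrm_ge0. Qed.

Let M0 : pos M. Proof. by move=> n; rewrite !addr_ge0 ?nrm_ge0. Qed.

Let Mz : M 0%N = 0.
Proof.
rewrite /M al0 mz nrm0 add0r addr0.
have -> : (fun s => nrm (nl (y^~ s) 0%N)) = (fun=> 0).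
  by apply/funext => s; rewrite /nl mulr0 mul0r nrm0.
by rewrite Rintegral_cst // mul0r.
Qed.

Let M_bnd : exists X, bnd (fun n => n%:R * M n) X.
Proof.
have [Z yZ] := y_dissip.
have p k s : 0 <= nrm (y k s) by exact: nrm_ge0.
have mY k : measurable_fun `[0, T] (fun s => nrm (y k s)).
  by apply: cmeas_nrm => //; exact: y_meas.
have h := @Q_time_bnd R _ 0 T C' Z (fun k s => nrm (y k s)) mT (@subset_refl _ _) mY p C'0
  (fun s _ => y_bnd s) (fun k s _ => y_le k s) yZ.
have mQ n := @Q_time_meas R _ 0 T C' (fun k s => nrm (y k s)) mT (@subset_refl _ _) mY p C'0
  (fun s _ => y_bnd s) (fun k s _ => y_le k s) n.
exists (A + C' * Z + 2 * A).
have -> : (fun n => n%:R * M n) = (fun n => n%:R * nrm (al n) +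
    n%:R * II `[0, T] (fun s => nrm (nl (y^~ s) n)) + n%:R * m n).
  by apply/funext => n; rewrite /M !mulrDr.
apply: bndD => //; apply: bndD => //; apply: bnd_le h => n.
rewrite expr2 -mulrA; apply: ler_wpM2l => //.
have iQ : intg `[0, T] (fun s => Q (fun k => nrm (y k s)) (fun k => nrm (y k s)) n).
  apply: (intg_bdd (a:=0) (b:=T) (C:=C' * C')) => // s _.
  have pp : pos (fun k => nrm (y k s)) by move=> k; exact: nrm_ge0.
  rewrite ger0_norm; last exact: (Q_ge0 _ pp pp (y_bnd s) (fun k => y_le k s)).
  apply: tsum_le; first exact: (Q_summ _ pp pp (y_bnd s) (fun k => y_le k s)).
  apply: (@bnd_le _ _ (fun k => C' * (k%:R * nrm (y k s)))); last exact: bndZ.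
  by move=> k; rewrite mulrC ler_wpM2r ?mulr_ge0 ?nrm_ge0.
rewrite -II_Z //; apply: II_le => //.
- apply: (intg_bdd (a:=0) (b:=T) (C:=n%:R * (C' * C'))) => //.
    by apply: cmeas_nrm => //; exact: (nly_meas n mT (@subset_refl _ _)).
  by move=> s _; rewrite ger0_norm ?nrm_ge0.
- exact: intg_Z.
Qed.

Let y_M k s : 0 <= s <= T -> nrm (y k s) <= M k.
Proof.
move=> hs; have /andP[s0 _] := hs; rewrite /y; case: ifPn => _; last first.
  by apply: le_trans (x_le k s) _; rewrite lerDr addr_ge0 ?nrm_ge0.
rewrite fourier_cduh //.
have h := @cduh_le R k%:R T (k%:R * (C' * C')) (al k) (fun s => nl (y^~ s) k) s (ler0n _ _) hs
  (nly_meas k mT (@subset_refl _ _)) (fun r _ => nly_bd k r).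
by apply: le_trans h _; rewrite lerDl.
Qed.

(** A bound d on the weighted difference yields a new one whose A^1 sum is smaller by 3 / 4: less
    than 1 / 2 from the constructed solution, as 4 A < 1, and 1 / 4 from M by the choice of lam. The
    start d = m + M is the triangle inequality, and lam is the same for all j. *)
Let contraction : exists lam D0 : R, forall j, exists d : nat -> R,
  [/\ pos d, d 0%N = 0, bnd (fun k => k%:R * d k) ((3 / 4) ^+ j * D0) &
      forall k s, 0 <= s <= T -> nrm (x k s - y k s) <= expR (lam * s) * d k].
Proof.
have [X MX] := M_bnd.
have q4 : (0 : R) < 1 / 4 by lra.
have [lam lam0 lamM] := resolvent_small M0 MX q4.
exists lam, (2 * A + X); elim=> [|j [d [d0 dz dX xyd]]].
  exists (fun k => m k + M k); split.
  - by move=> k; rewrite addr_ge0.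
  - by rewrite mz Mz addr0.
  - rewrite expr0 mul1r.
    have -> : (fun k => k%:R * (m k + M k)) = (fun k => k%:R * m k + k%:R * M k).
      by apply/funext => k; rewrite mulrDr.
    exact: bndD.
  move=> k s hs; have /andP[s0 _] := hs.
  apply: le_trans (nrmB _ _) _; apply: le_trans (lerD (x_le k s) (y_M k hs)) _.
  have e1 : 1 <= expR (lam * s).
    by apply: le_trans (expR_ge1Dx _); rewrite lerDl mulr_ge0 // ltW.
  by rewrite ler_peMl // addr_ge0.
set B := (3 / 4) ^+ j * (2 * A + X) in dX *.
have B0 : 0 <= B := bnd_ge0 dX.
have dB k : d k <= B by exact: k_bound d0 dz dX k.
have mB k : m k <= 2 * A by exact: k_bound m0 mz mX k.
have MB k : M k <= X by exact: k_bound M0 Mz MX k.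
have X0 : 0 <= X := bnd_ge0 MX.
have Qm0 n : 0 <= Q m d n by exact: Q_ge0 m0 d0 mX dB.
have QM0 n : 0 <= Q d M n by exact: Q_ge0 d0 M0 dX MB.
have nl0 (n : nat) : 0 < n%:R + lam by rewrite ltr_wpDl.
have r0 (n : nat) : 0 <= n%:R / (n%:R + lam) by rewrite divr_ge0 // ltW.
have r1 (n : nat) : n%:R / (n%:R + lam) <= 1 by rewrite ler_pdivrMr // mul1r lerDl ltW.
exists (fun n => n%:R / (n%:R + lam) * (2 * c * (Q m d n + Q d M n))); split.
- by move=> n; rewrite mulr_ge0 // !mulr_ge0 // addr_ge0.
- by rewrite !mul0r.
- have h1 : bnd (fun n => n%:R * Q m d n) (2 * A * B).
    apply: (@Q_bnd R m d (fun n => n%:R) (fun k => k%:R * d k) _ _ B) => //.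
      by move=> n k; rewrite ler_wpM2r // ler_nat leq_addr.
    by move=> k; rewrite mulr_ge0.
  (* The weight n / (n + lam) * n is nondecreasing, so it passes to the frequency n + k, where it
     acts on M and makes its sum at most 1 / 4. In front of Q m d, n / (n + lam) is merely bounded
     by 1. *)
  have h2 : bnd (fun n => n%:R / (n%:R + lam) * n%:R * Q d M n) (B * (1 / 4)).
    apply: (@Q_bnd R d M (fun n => n%:R / (n%:R + lam) * n%:R)
      (fun k => k%:R / (k%:R + lam) * (k%:R * M k)) _ _ X) => //.
    - by move=> n; rewrite mulr_ge0.
    - move=> n k; rewrite [leRHS]mulrA ler_wpM2r //; apply: ler_pM => //.
        rewrite ler_pdivrMr // mulrAC ler_pdivlMr // natrD.
        have := ler0n R n; have := ler0n R k; have := lam0; move=> l1 k1 n1.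
        have : 0 <= k%:R * lam by rewrite mulr_ge0 // ltW.
        lra.
      by rewrite ler_nat leq_addr.
    - by move=> k; rewrite mulr_ge0 // mulr_ge0.
  have h3 := bndZ (mulr_ge0 (ler0n R 2) c0) (bndD h1 h2).
  have e : 2 * c * (2 * A * B + B * (1 / 4)) <= (3 / 4) ^+ j.+1 * (2 * A + X).
    have -> : (3 / 4) ^+ j.+1 * (2 * A + X) = 3 / 4 * B by rewrite exprS -mulrA.
    have ab : 0 <= 2 * A * B + B * (1 / 4).
      by apply: addr_ge0; apply: mulr_ge0 => //; first [exact: mulr_ge0|exact: ltW].
    apply: (@le_trans _ _ (1 * (2 * A * B + B * (1 / 4)))); first exact: ler_wpM2r.
    rewrite mul1r [B * _]mulrC -mulrDl; apply: ler_wpM2r => //.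
    have := A4; lra.
  apply: (bnd_leS e); apply: bnd_le h3 => n.
  have := r0 n; have := r1 n; set r := n%:R / (n%:R + lam) => rn1 rn0.
  have -> : n%:R * (r * (2 * c * (Q m d n + Q d M n))) =
    2 * c * (r * (n%:R * Q m d n) + r * n%:R * Q d M n) by ring.
  apply: ler_wpM2l; first by rewrite mulr_ge0.
  by rewrite lerD2r ler_piMl // mulr_ge0.
move=> k s hs; have /andP[s0 sT] := hs; rewrite /y; case: ifPn => _; last first.
  by rewrite subrr nrm0 mulr_ge0 ?expR_ge0 // mulr_ge0 // !mulr_ge0 // addr_ge0.
rewrite fourier_cduh //.
have -> : x k s = cduh k%:R (al k) (fun s => nl (x^~ s) k) s.
  transitivity (step al x k s); first exact: (sol_fixed al0 alA A4).
  by rewrite /step max0E.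
have ms : measurable (`[0, s]%classic : set R) by exact: measurable_itv.
rewrite [leRHS]mulrC.
pose Y := Num.max (2 * A) (Num.max X B).
have b1 : 2 * A <= Y by rewrite le_max lexx.
have b2 : X <= Y by rewrite !le_max lexx orbT.
have b3 : B <= Y by rewrite !le_max lexx !orbT.
apply: (@duh_diff R al lam T m M d x y k s Y Y) => //.
- exact: ltW.
- apply: ccont_cmeas => //.
  exact: (@nl_ccont R x m k (2 * A) (2 * A) x_cont x_le mX mB).
- exact: (nly_meas k ms (@subset_refl _ _)).
- exact: (bnd_leS b1).
- exact: (bnd_leS b2).
- exact: (bnd_leS b3).
- by move=> i; exact: le_trans (mB i) b1.
- by move=> i; exact: le_trans (MB i) b2.
- by move=> i; exact: le_trans (dB i) b3.
Qed.

Lemma y_eq_sol k s : 0 <= s <= T -> y k s = x k s.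
Proof.
move=> hs; have [lam [D0 h]] := contraction.
apply/esym/eqP; rewrite -subr_eq0; apply/eqP/nrm_eq0/eqP.
rewrite eq_le nrm_ge0 andbT.
apply: (@le0_cvg _ _ (fun j => expR (lam * s) * ((3 / 4) ^+ j * D0))).
  move=> j; have [d [d0 dz dX xyd]] := h j.
  by apply: le_trans (xyd k s hs) _; rewrite ler_wpM2l ?expR_ge0 // (k_bound d0 dz dX).
rewrite -[X in _ --> X](mulr0 (expR (lam * s))); apply: cvgMr.
rewrite -[X in _ --> X](mul0r D0); apply: cvgMl.
by apply: cvg_expr; rewrite ger0_norm; lra.
Qed.

(** At a time T in N, the equality of y and x says nothing about g. The Duhamel formula at T does:
    its integral sees only y, which equals x on [0, T]. *)
Lemma fourier_unique (n : nat) : fourier (g T) n = sol al n T.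
Proof.
rewrite fourier_cduh //; transitivity (step al x n T); last exact/esym/(sol_fixed al0 alA A4).
have -> : step al x n T = cduh n%:R (al n) (fun s => nl (x^~ s) n) T by rewrite /step max0E.
apply: (congr1 (fun w => (expR (- (T * n%:R)))%:C * al n + w)).
apply: cint_ext => s /=; rewrite in_itv /= => hs; congr (_ * _).
by suff -> : y^~ s = x^~ s by []; apply/funext => k; exact: y_eq_sol.
Qed.
End Uniqueness.

Lemma global_solution_unique (R : realType) (f0 : R -> R) (S1 : R) g t :
  wiener 1 f0 -> wiener_norm 1 f0 = S1%:E -> 2 * S1 < 1 ->
  global_solution f0 g -> 0 <= t -> g t = fsol f0 t.
Proof.
move=> wf0 nf0 S1lt [[wg smg [C [NC [mNC NC0 gC]]]] Mg dg] t0.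
have [N [mN N0 mg]] := strongly_measurable_coef wg smg.
have [_ _ al0 _] := wiener1_facts wf0.
have alA := wiener1_norm_bnd wf0 nf0.
have A4 : 4 * (S1 / 2) < 1 by lra.
(* One null set collects the times where measurability or the uniform bound may fail. *)
have mU : measurable (N `|` NC) by exact: measurableU.
have U0 : lebesgue_measure (N `|` NC) = 0%E.
  by apply: measure_negligible => //; apply: negligibleU; exact/negligibleP.
have mgU (k : nat) : cmeas (@Rplus R `\` (N `|` NC)) (fun t => fourier (g t) k).
  have [h1 h2] := mg k.
  have mR : measurable (@Rplus R `\` N) by apply: measurableD => //; exact: measurable_Rplus.
  have sub : @Rplus R `\` (N `|` NC) `<=` @Rplus R `\` N.
    by move=> s [s0 h]; split => // Ns; apply: h; left.
  by split; apply: measurable_funS sub _.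
have gCU s : (@Rplus R `\` (N `|` NC)) s -> (wiener_norm 1 (g s) <= C%:E)%E.
  move=> [s0 h]; apply: contrapT => ns; apply: h; right; apply: gC => /= /(_ s0).
  exact: ns.
have e (n : nat) : fourier (g t) n = sol (fun k : nat => fourier f0 k) n t.
  exact: (fourier_unique al0 alA A4 wg mU U0 mgU gCU dg Mg t0).
have [cg pg g0 [S gS]] := wiener1_facts (wg _ t0).
apply/funext => z; rewrite (@fourier_expand _ (g t) S) //.
  by congr synth; apply/funext => n; exact: e.
apply: bnd_le gS => -[|k]; first by rewrite g0 nrm0 mulr0.
by rewrite ler_peMl ?nrm_ge0 // ler1n.
Qed.

Local Close Scope complex_scope.
Unset Implicit Arguments.
Set Strict Implicit.
Set Printing Implicit Defensive.

Theorem theorem2p3 (R : realType) (f0 : R -> R)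
    (hf0 : wiener 1 f0)
    (hsmall : (wiener_norm 1 f0 < (1 / 2)%:E)%E) :
  exists f : R -> R -> R,
    [/\ global_solution f0 f,
        forall g : R -> R -> R, global_solution f0 g ->
          forall t : R, 0 <= t -> g t = f t,
        forall t : R, 0 <= t ->
          (wiener_norm 1 (f t) <= wiener_norm 1 f0)%E &
        forall t : R, 0 <= t ->
          (wiener_norm 0 (f t) <=
             wiener_norm 0 f0 *
             (expR (- ((1 - 2 * fine (wiener_norm 1 f0)) * t)))%:E)%E].
Proof.
have [S1 nf0 _] := @wiener_bnd R 1 f0 hf0.
have S1lt : 2 * S1 < 1 by move: hsmall; rewrite nf0 lte_fin; lra.
have [cf0 _ al0 [S hS]] := wiener1_facts hf0.
(* For zero mean the A^1 bound controls the A^0 norm, since 1 <= k off the zero mode; this makes the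
   latter a real number. *)
have [S0 nf00] : exists S0 : R, wiener_norm 0 f0 = S0%:E.
  have h : (wiener_norm 0 f0 <= (2 * S)%:E)%E.
    apply/(@wiener_normP R 0 f0 (2 * S) cf0 al0); apply: bndZ => //.
    apply: bnd_le hS => -[|k]; first by rewrite al0 nrm0 !mulr0.
    by rewrite expr0 ler_wpM2r ?nrm_ge0 // ler1n.
  exists (fine (wiener_norm 0 f0)); rewrite fineK // fin_numElt.
  by rewrite (le_lt_trans h) ?ltry // andbT (lt_le_trans _ (wiener_norm_ge0 _ _)) ?ltNyr.
exists (fsol f0); split.
- exact: (fsol_global hf0 nf0 S1lt).
- by move=> g hg t t0; exact: global_solution_unique hf0 nf0 S1lt hg t0.
- by move=> t t0; rewrite nf0; exact: (fsol_norm1 hf0 nf0 S1lt t0).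
- move=> t t0; rewrite nf0 nf00 /= -EFinM.
  by apply: (fsol_norm0 hf0 nf0 S1lt t0); rewrite nf00.
Qed.
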